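(* Let $G\sim SBM(n,2,B,\theta)$ with $B=a_nB_0$, $B_0$ not depending on $n$, $\frac{50\log n}{n\min_j(B_0)_{jj}}\le a_n=o(1)$, and $(B_0)_{11}=(B_0)_{22}>(B_0)_{12}=(B_0)_{21}$. Let $d=n\cdot\max_{i,j}B_{ij}$, $D\in[3d,n]$, $\epsilon_1\asymp1$ and $\delta_1\asymp\frac{1}{\mathrm{poly}(n)}$. Let $\delta\in\left(\frac{e^{-\Theta(\epsilon)}}{\mathrm{poly}(n)},\frac{e^{-2\epsilon}}{\mathrm{poly}(n)}\right)$, $d>\log^3n$, and $D^2\log n<\epsilon$. Let $\mathcal A_{TC}$ be the two-community convex-relaxation algorithm described in the context. Then $$\hat\theta(G)=\mathcal A_{TC}^{\left(\epsilon/(4D\hat L_{\epsilon_1,\delta_1}(G)),\ \delta/\hat L_{\epsilon_1,\delta_1}(G)\right)}(T_D(G))$$ is $(3\epsilon,1/\mathrm{poly}(n))$-node DP. In addition, $$\mathcal L(\hat\theta(G),\theta)\precsim\frac{1}{\sqrt d}+\frac{D^2}{\epsilon}\precsim\frac{1}{\log n}$$ with probability at least $1-\frac{1}{\mathrm{poly}(n)}$.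
   Context: Asymptotics: parameters may depend on $n$. $f\precsim g$ means $f(n)\le c_1g(n)$ for all $n\ge c_2$, with constants $c_1,c_2\in(0,\infty)$ not depending on $n$; $f\asymp g$ means $f\precsim g$ and $g\precsim f$. $\mathrm{poly}(n)$ denotes a quantity of order $\Theta(n^\alpha)$ for some constant $\alpha>0$, possibly different at each occurrence. Graphs and privacy: $\mathcal G_n$ is the set of unweighted undirected graphs on $[n]$; $\mathcal G_{n,D}$ is the subset with maximum degree at most $D$. $d_{node}(G,G')$ is the minimum number of nodes that must be rewired (row/column of the adjacency matrix changed) to turn $G'$ into $G$; $G\sim_{node}G'$ if $d_{node}(G,G')\le1$. A randomized algorithm $\mathcal A$ is $(\epsilon,\delta)$-node DP if $\mathbb P(\mathcal A(G)\in S)\le e^\epsilon\mathbb P(\mathcal A(G')\in S)+\delta$ for all $G\sim_{node}G'$ in $\mathcal G_n$ and measurable $S$. Stochastic block model: $\theta\in[k]^n$ is balanced, $|\{i:\theta_i=j\}|=n/k$ for all $j$ (here $k=2$). $B\in(0,1]^{k\times k}$ is symmetric and invertible. $A\sim SBM(n,k,B,\theta)$ has independent $A_{ij}\sim\mathrm{Ber}(B_{\theta_i,\theta_j})$ for $i<j$, $A_{ji}=A_{ij}$, zero diagonal. Loss: $\mathcal L(\hat\theta,\theta)=\min_{\sigma\in S_k}\frac2n\sum_{i=1}^n\mathbf 1\{\sigma(\hat\theta_i)\ne\theta_i\}$, $S_k$ the permutation group of $[k]$. Degree truncation: for $G\in\mathcal G_n$ with $a_{uv}=1$ if $(u,v)$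 is an edge and $0$ otherwise, consider the linear program in variables $x_u$ and $w_{uv}=w_{vu}$: minimize $\sum_ux_u$ subject to $x_u\ge0$, $w_{uv}\ge0$, $a_{uv}\ge w_{uv}\ge a_{uv}-x_u-x_v$ for all $u,v$, and $\sum_{v\ne u}w_{uv}\le D$ for all $u$. Let $(x^*,w^* )$ be the optimal solution (chosen by a fixed deterministic rule). $T_D(G)\in\mathcal G_{n,2D}$ is obtained from $G$ by removing every edge $(u,v)$ with $x_u^*\ge\frac14$ or $x_v^*\ge\frac14$. Let $d_{T_D}(G)=4\sum_ux_u^*$ and $\hat L_{\epsilon,\delta}(G)=\max\{\frac12,\ 5+2d_{T_D}(G)+\mathrm{Lap}(8/\epsilon)+\frac{8\log(1/\delta)}{\epsilon}\}$, where $\mathrm{Lap}(b)$ is independent Laplace noise with scale $b$. Algorithm $\mathcal A_{TC}^{(\epsilon,\delta)}$ (input: adjacency matrix $A$, the probability matrix $B$ of the SBM, $\epsilon,\delta$): (1) Set $Y=\frac{2}{n(B_{11}-B_{12})}\left(A-\frac{B_{11}+B_{12}}{2}J_n\right)$, $J_n$ the all-ones matrix. (2) Let $\widehat X$ be the minimizer of $\|Y-X\|_F^2$ over $X\in\mathbb R^{n\times n}$ with $X\succeq0$ and $X_{ii}=\frac1n$ for all $i$. (3) Let $\widetilde x$ be the leading unit eigenvector of $\widehat X+N$, where $N\in\mathbb R^{n\times n}$ has i.i.d. $N\left(0,\frac{96\log(1/\delta)}{n^2\epsilon^2(B_{11}-B_{12})}\right)$ entries. (4) Assign node $i$ to community $\mathrm{sign}(\widetilde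 x_i)$ (identifying $\{-1,+1\}$ with $[2]$); return the resulting $\hat\theta\in[2]^n$. *)

(* Defs.v *)
From HB Require Import structures.
From mathcomp Require Import all_boot all_order all_fingroup all_algebra.
From mathcomp Require Import all_classical all_reals all_analysis.
Set Implicit Arguments.
Unset Strict Implicit.
Unset Printing Implicit Defensive.
Import Order.TTheory GRing.Theory Num.Theory.
Import numFieldNormedType.Exports.
Local Open Scope classical_set_scope.
Local Open Scope ring_scope.

(* A balanced labelling by two communities exists only for even n, so n tends
   to infinity along the even numbers. *)
Definition even_oo : set_system nat := within [set n | ~~ odd n] \oo.

#[global] Instance even_oo_filter : Filter even_oo.
Proof. exact: within_filter. Qed.

Section Asymptotics.
Context {R : realType}.
Implicit Types f g p : nat -> R.

Definition precsim f g : Prop :=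
  exists2 c : R, 0 < c & \forall n \near even_oo, f n <= c * g n.

Definition asymp f g : Prop := precsim f g /\ precsim g f.

Definition is_poly p : Prop :=
  exists2 alpha : R, 0 < alpha & asymp p (fun n => n%:R `^ alpha).

End Asymptotics.

Section Graphs.
Variable n : nat.
Implicit Types G : 'M[bool]_n.

(* Graphs are represented by their boolean adjacency matrices. *)
Definition simple_graph G : Prop := G^T = G /\ forall i, G i i = false.

(* The graphs agree outside the rows and columns indexed by S. *)
Definition agree_off (S : {set 'I_n}) G G' : bool :=
  [forall i, forall j, (i \notin S) && (j \notin S) ==> (G i j == G' i j)].

(* The default value n of the minimum is attained by S = [set: 'I_n]. *)
Definition d_node G G' : nat :=
  \big[minn/n]_(S : {set 'I_n} | agree_off S G G') #|S|.

End Graphs.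

Section Privacy.
Context {d : measure_display} {T : measurableType d} {R : realType}.
Variable P : probability T R.

(* A randomized algorithm maps a graph to a random element of O.  As O is
   finite, every set of outputs is measurable. *)
Definition node_DP (n : nat) (O : finType) (eps delta : R)
    (M : 'M[bool]_n -> T -> O) : Prop :=
  forall G G' : 'M[bool]_n, simple_graph G -> simple_graph G' ->
    (d_node G G' <= 1)%N ->
  forall S : {set O},
    (P [set w | M G w \in S] <=
       (expR eps)%:E * P [set w | M G' w \in S] + delta%:E)%E.

(* Mutual independence of a finite family of classes of events. *)
Definition mutual_indep (I : finType) (F : I -> set (set T)) : Prop :=
  forall (J : {set I}) (E : I -> set T),
    (forall i, i \in J -> F i (E i)) ->
    P (\bigcap_(i in [set` J]) E i) = (\prod_(i in J) P (E i))%E.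

Definition events_of d' (U : measurableType d') (X : T -> U) : set (set T) :=
  preimage_set_system setT X measurable.

(* The random graph takes finitely many values: every subset is measurable. *)
Definition events_of_graph n (A : T -> 'M[bool]_n) : set (set T) :=
  preimage_set_system setT A setT.

End Privacy.

Section BlockModel.
Context {R : realType}.

Definition balanced (n k : nat) (theta : 'I_n -> 'I_k) : Prop :=
  forall j : 'I_k, (k * #|[pred i | theta i == j]|)%N = n.

Definition sbm_matrix k (B : 'M[R]_k) : Prop :=
  [/\ forall i j, 0 < B i j <= 1, B^T = B & B \in unitmx].

Definition is_SBM d (T : measurableType d) (P : probability T R) (n k : nat)
    (B : 'M[R]_k) (theta : 'I_n -> 'I_k) (A : T -> 'M[bool]_n) : Prop :=
  [/\ forall w, simple_graph (A w),
      forall i j : 'I_n, measurable_fun setT (fun w => A w i j),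
      forall i j : 'I_n, (i < j)%N ->
        P [set w | A w i j] = (B (theta i) (theta j))%:E
    & mutual_indep P (fun e : {e : 'I_n * 'I_n | (e.1 < e.2)%N} =>
        events_of (fun w => A w (val e).1 (val e).2))].

Definition max_entry k (B : 'M[R]_k) : R :=
  \big[Num.max/0]_(i < k) \big[Num.max/0]_(j < k) B i j.

Definition loss (n k : nat) (that theta : 'I_n -> 'I_k) : R :=
  let err (s : 'S_k) := 2 / n%:R * \sum_(i < n) (s (that i) != theta i)%:R in
  \big[Num.min/err 1%g]_(s : 'S_k) err s.

End BlockModel.

Section DegreeTruncation.
Context {R : realType}.
Variable n : nat.
Implicit Types (G : 'M[bool]_n) (D : R) (xw : 'rV[R]_n * 'M[R]_n).

Definition lp_feasible D G xw : Prop :=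
  let: (x, w) := xw in
  [/\ forall u v, w u v = w v u,
      forall u, 0 <= x 0 u,
      forall u v, 0 <= w u v,
      forall u v, (G u v)%:R - x 0 u - x 0 v <= w u v <= (G u v)%:R
    & forall u, \sum_(v < n | v != u) w u v <= D].

Definition lp_optimal D G xw : Prop :=
  lp_feasible D G xw /\
  forall xw', lp_feasible D G xw' -> \sum_u xw.1 0 u <= \sum_u xw'.1 0 u.

(* A deterministic rule choosing an optimal solution; for D < 0 the program is
   infeasible. *)
Definition lp_rule (lp : R -> 'M[bool]_n -> 'rV[R]_n * 'M[R]_n) : Prop :=
  forall D G, 0 <= D -> simple_graph G -> lp_optimal D G (lp D G).

Variable lp : R -> 'M[bool]_n -> 'rV[R]_n * 'M[R]_n.

Definition trunc D G : 'M[bool]_n :=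
  let x := (lp D G).1 in
  \matrix_(u, v) (G u v && ~~ ((4^-1 <= x 0 u) || (4^-1 <= x 0 v))).

Definition d_trunc D G : R := 4 * \sum_u (lp D G).1 0 u.

(* z is the Laplace noise, of scale 8 / eps. *)
Definition Lhat (eps delta D : R) G (z : R) : R :=
  Num.max 2^-1 (5 + 2 * d_trunc D G + z + 8 * ln (1 / delta) / eps).

End DegreeTruncation.

Section TwoCommunities.
Context {R : realType}.
Variable n : nat.

Definition frobenius_sq (X : 'M[R]_n) : R := \sum_i \sum_j X i j ^+ 2.

Definition psd (X : 'M[R]_n) : Prop :=
  X^T = X /\ forall v : 'cV[R]_n, 0 <= (v^T *m X *m v) 0 0.

Definition sdp_feasible (X : 'M[R]_n) : Prop :=
  psd X /\ forall i, X i i = n%:R^-1.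

Definition sdp_minimizer (Y X : 'M[R]_n) : Prop :=
  sdp_feasible X /\
  forall X', sdp_feasible X' -> frobenius_sq (Y - X) <= frobenius_sq (Y - X').

Definition Xhat (Y : 'M[R]_n) : 'M[R]_n := xget 0 (sdp_minimizer Y).

Definition centered (B : 'M[R]_2) (A : 'M[bool]_n) : 'M[R]_n :=
  (2 / (n%:R * (B 0 0 - B 0 1))) *:
    (map_mx (fun b : bool => b%:R) A - const_mx ((B 0 0 + B 0 1) / 2)).

(* M need not be symmetric: "leading" refers to its largest real eigenvalue. *)
Definition leading_unit_eigenvector (M : 'M[R]_n) (x : 'cV[R]_n) : Prop :=
  \sum_i x i 0 ^+ 2 = 1 /\
  exists2 l : R, M *m x = l *: x & forall m, eigenvalue M m -> m <= l.

(* The Borel sigma-algebra of the space of matrices. *)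
Definition borel_mx : set (set 'M[R]_n) :=
  <<s [set C | exists i j (V : set R),
        measurable V /\ C = [set M : 'M[R]_n | V (M i j)]] >>.

(* A deterministic Borel rule choosing a leading unit eigenvector (in
   particular its sign) whenever there is one.  Measurability makes the output
   of the algorithm a random variable. *)
Definition eigenvector_rule (lev : 'M[R]_n -> 'cV[R]_n) : Prop :=
  (forall M, (exists x, leading_unit_eigenvector M x) ->
     leading_unit_eigenvector M (lev M)) /\
  (forall i (V : set R), measurable V -> borel_mx [set M | V (lev M i 0)]).

Variable lev : 'M[R]_n -> 'cV[R]_n.

Definition noise_variance (B : 'M[R]_2) (eps delta : R) : R :=
  96 * ln (1 / delta) / (n%:R ^+ 2 * eps ^+ 2 * (B 0 0 - B 0 1)).

(* The random seed g has i.i.d. standard normal entries, so that the added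
   noise has i.i.d. centered normal entries of variance noise_variance; this
   variance will itself be random, through eps and delta.
   The signs +1 and -1 stand for the communities 0 and 1. *)
Definition A_TC (B : 'M[R]_2) (eps delta : R) (A : 'M[bool]_n) (g : 'M[R]_n) :
    {ffun 'I_n -> 'I_2} :=
  let N := Num.sqrt (noise_variance B eps delta) *: g in
  let x := lev (Xhat (centered B A) + N) in
  [ffun i => if 0 <= x i 0 then 0 else 1].

Variable lp : R -> 'M[bool]_n -> 'rV[R]_n * 'M[R]_n.

Definition theta_hat (B : 'M[R]_2) (D eps delta eps1 delta1 : R)
    (G : 'M[bool]_n) (z : R) (g : 'M[R]_n) : {ffun 'I_n -> 'I_2} :=
  let L := Lhat lp eps1 delta1 D G z in
  A_TC B (eps / (4 * D * L)) (delta / L) (trunc lp D G) g.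

End TwoCommunities.

Section Noise.
Context {R : realType}.

Definition laplace_pdf (b x : R) : R := expR (- `|x| / b) / (2 * b).

Definition laplace_prob (b : R) : set R -> \bar R :=
  fun V => (\int[lebesgue_measure]_(x in V) (laplace_pdf b x)%:E)%E.

(* Z is Laplace of scale b, the entries of g are standard normal, and the graph
   A, the variable Z and all entries of g are mutually independent. *)
Definition independent_noise d (T : measurableType d) (P : probability T R)
    (n : nat) (A : T -> 'M[bool]_n) (b : R) (Z : {RV P >-> R})
    (g : 'I_n -> 'I_n -> {RV P >-> R}) : Prop :=
  [/\ forall V : set R, measurable V -> distribution P Z V = laplace_prob b V,
      forall i j (V : set R), measurable V ->
        distribution P (g i j) V = normal_prob 0 1 V
    & mutual_indep P (fun s : bool + 'I_n * 'I_n =>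
        match s with
        | inl true => events_of_graph A
        | inl false => events_of (Z : T -> R)
        | inr (i, j) => events_of (g i j : T -> R)
        end)].

End Noise.

(* Main.v *)
Require Import Defs.
From HB Require Import structures.
From mathcomp Require Import all_boot all_order all_fingroup all_algebra.
From mathcomp Require Import all_classical all_reals all_analysis.
From mathcomp Require Import measurable_realfun.
From mathcomp Require Import ring lra zify.
From mathcomp.real_closed Require polyrcf.
Set Implicit Arguments.
Unset Strict Implicit.
Unset Printing Implicit Defensive.
Import Order.TTheory GRing.Theory Num.Theory.
Import numFieldNormedType.Exports.
Local Open Scope classical_set_scope.
Local Open Scope ring_scope.

(** Privacy.  Let [G] and [H] differ in the rows and columns of one node.
    Setting the variable [x] of that node to 1 makes an optimal solution for one
    graph feasible for the other, so [2 * d_trunc] changes by at most 8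
    ([d_trunc_sensitivity]).  Shifting the Laplace variable by this
    amount costs a factor [expR eps1] and gives both graphs the same estimate
    [L] ([shifted_noise_comparison]); except with probability [delta1],
    [5 + 2 * d_trunc <= L].  Then the truncated graphs differ only at pairs
    meeting the rewired node or a node removed from one of them, hence in [O (D * L)]
    pairs ([trunc_distance]).  The projection onto the feasible set of the
    semidefinite program is monotone and feasible matrices have entries at
    most [1 / n], so the squared Frobenius distance between the two estimates is
    linear in the number of differing pairs ([Xhat_stability]).  In units of the
    noise scale that squared distance is at most [eps / 4]
    ([scaled_sensitivity]), and a shift [h] of a standard Gaussian matrix costs
    a factor [expR eps] outside an event of probability at most
    [expR (|h|^2 - eps)], by Markov's inequality applied to the density
    ([gauss_shift_bound]).

    Accuracy.  With high probability no degree exceeds [3 * d <= D], so that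
    the truncation does nothing and [d_trunc = 0], the cut norm of the centred
    adjacency matrix is [O (n * sqrt d)], the Laplace variable is [O (ln n)]
    and the Gaussian matrix has operator norm [O (sqrt (n * ln n))]
    ([degree_tail], [cut_tail], [laplace_upper_tail], [gauss_op_norm]).  By
    optimality of the projection, the squared distance from the estimate to the
    planted matrix is at most its inner product with the noise of the
    observation; Grothendieck's inequality bounds this by the cut norm, which
    gives [O (1 / sqrt d)] ([Xhat_error]).  The planted matrix is the projection
    on the unit vector of labels, up to sign and scaling; perturbing it by a
    matrix of operator norm [r <= 1 / 8], symmetric or not, moves the leading
    unit eigenvector by [O (r)], and the signs of that vector then
    misclassify a fraction [O (r ^+ 2)] of the nodes ([spectral_loss]).

    Rates.  The noise contributes [O (D ^+ 2 / eps * (ln n) ^+ 3 / d)] to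
    [r ^+ 2], so the assumption [(ln n) ^+ 3 < d] absorbs all logarithms
    ([radius_bound]).  Since [D ^+ 2 * ln n < eps] as well, the total is
    [O (1 / ln n)], which is eventually small enough for the perturbation
    argument. *)

(** * Positive semidefinite matrices *)

Lemma sum_Cauchy_Schwarz (R : realFieldType) (I : finType) (a b : I -> R) :
  (\sum_i a i * b i) ^+ 2 <= (\sum_i a i ^+ 2) * (\sum_i b i ^+ 2).
Proof.
set C := \sum_i a i * b i; set A := \sum_i a i ^+ 2; set B := \sum_i b i ^+ 2.
have B0 : 0 <= B by apply: sumr_ge0 => i _; exact: sqr_ge0.
have [B_eq0|B_neq0] := eqVneq B 0.
  have b0 i : b i = 0.
    have /eqP := B_eq0; rewrite psumr_eq0 => [/allP/(_ i)|j _]; last exact: sqr_ge0.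
    by rewrite mem_index_enum => /(_ isT); rewrite /= sqrf_eq0 => /eqP.
  by rewrite /C big1 ?B_eq0 ?mulr0 ?expr0n// => i _; rewrite b0 mulr0.
have : 0 <= \sum_i (B * a i - C * b i) ^+ 2.
  by apply: sumr_ge0 => i _; exact: sqr_ge0.
have -> : \sum_i (B * a i - C * b i) ^+ 2 = B * (A * B - C ^+ 2).
  transitivity (\sum_i (B ^+ 2 * a i ^+ 2 + (- (B * C) *+ 2) * (a i * b i) +
                        C ^+ 2 * b i ^+ 2)).
    by apply: eq_bigr => i _; ring.
  by rewrite !big_split/= -!mulr_sumr -/A -/B -/C; ring.
by rewrite pmulr_rge0 ?lt_def ?B_neq0// subr_ge0.
Qed.

Section Psd.
Context {R : realType} {n : nat}.
Implicit Types (X Y : 'M[R]_n) (u v : 'I_n -> R).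

Definition bilin X u v : R := \sum_i \sum_j u i * X i j * v j.

Lemma psd_bilin X : psd X <-> X^T = X /\ forall v, 0 <= bilin X v v.
Proof.
have E (v : 'cV[R]_n) : (v^T *m X *m v) 0 0 = bilin X (v ^~ 0) (v ^~ 0).
  rewrite mxE /bilin exchange_big/=; apply: eq_bigr => j _.
  by rewrite mxE mulr_suml; apply: eq_bigr => i _; rewrite mxE.
split=> -[XT X0]; split=> // v.
  have := X0 (\col_i v i); rewrite E; congr (_ <= _).
  by apply: eq_bigr => i _; apply: eq_bigr => j _; rewrite !mxE.
by rewrite E.
Qed.

Lemma bilin_add_delta X v e t : X^T = X ->
  let v' := fun i => v i + t * (i == e)%:R in
  bilin X v' v' = bilin X v v + 2 * t * (\sum_j X e j * v j) + t ^+ 2 * X e e.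
Proof.
move=> XT /=; set L := \sum_j _.
have symX i j : X i j = X j i by rewrite -[in LHS]XT mxE.
pose dl (i : 'I_n) : R := (i == e)%:R.
have sumd (f : 'I_n -> R) : \sum_i dl i * f i = f e.
  rewrite (bigD1 e)//= {1}/dl eqxx mul1r big1 ?addr0// => i /negbTE ie.
  by rewrite /dl ie mul0r.
transitivity (\sum_i \sum_j (v i * X i j * v j + t * (v i * (dl j * X i j)) +
   t * (dl i * (X i j * v j)) + t ^+ 2 * (dl i * (dl j * X i j)))).
  by apply: eq_bigr => i _; apply: eq_bigr => j _; rewrite -!/(dl _); ring.
under eq_bigr do rewrite !big_split/= -!mulr_sumr !sumd.
rewrite !big_split/= -!mulr_sumr !sumd -/(bilin _ _ _).
have -> : \sum_i v i * X i e = L.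
  by apply: eq_bigr => i _; rewrite mulrC symX.
by rewrite -/L; ring.
Qed.

(** The quadratic form [X] is nonnegative along the line [v + t * e]; its
    discriminant in [t] is therefore nonpositive. *)
Lemma psd_Cauchy_Schwarz X v e : psd X ->
  (\sum_j X e j * v j) ^+ 2 <= X e e * bilin X v v.
Proof.
move=> /psd_bilin[XT X0]; set L := \sum_j _.
have H t : 0 <= bilin X v v + 2 * t * L + t ^+ 2 * X e e.
  by rewrite -bilin_add_delta.
have c0 : 0 <= X e e.
  have /= := X0 (fun i => 0 + 1 * (i == e)%:R).
  rewrite (bilin_add_delta (fun=> 0))// /bilin big1 => [|i _]; last first.
    by rewrite big1// => j _; rewrite !mul0r.
  by rewrite big1 ?mulr0 ?addr0 ?add0r ?expr1n ?mul1r// => j _; rewrite mulr0.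
set c := X e e in H c0 *; set q := bilin X v v in H *.
have [c_eq0|c_neq0] := eqVneq c 0.
  have [->|L0] := eqVneq L 0; first by rewrite c_eq0 mul0r expr0n.
  have := H (- (q + 1) / (2 * L)); rewrite c_eq0 mulr0 addr0.
  have -> : 2 * (- (q + 1) / (2 * L)) * L = - (q + 1) by field.
  lra.
have {c_neq0}c0 : 0 < c by rewrite lt_def c_neq0.
have := H (- L / c).
have -> : q + 2 * (- L / c) * L + (- L / c) ^+ 2 * c = (c * q - L ^+ 2) / c.
  by field; rewrite gt_eqF.
by rewrite pmulr_lge0 ?invr_gt0// subr_ge0.
Qed.

Lemma sum_delta v e : \sum_i v i * (i == e)%:R = v e.
Proof.
rewrite (bigD1 e)//= eqxx mulr1 big1 ?addr0// => i /negbTE ->.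
by rewrite mulr0.
Qed.

Lemma bilin_delta X i j :
  bilin X (fun k => (k == i)%:R) (fun k => (k == j)%:R) = X i j.
Proof.
rewrite /bilin; under eq_bigr do rewrite sum_delta mulrC.
by rewrite sum_delta.
Qed.

Lemma psd_entry_sq X i j : psd X -> X i j ^+ 2 <= X i i * X j j.
Proof.
move=> Xpsd; have := psd_Cauchy_Schwarz (fun k => (k == j)%:R) i Xpsd.
by rewrite sum_delta bilin_delta.
Qed.

Lemma psd_diag_ge0 X i : psd X -> 0 <= X i i.
Proof. by move=> /psd_bilin[_ /(_ (fun k => (k == i)%:R))]; rewrite bilin_delta. Qed.

(** One step of the Cholesky factorization: the Schur complement of a positive
    semidefinite matrix is again positive semidefinite. *)
Lemma psd_Gram_step X (k : nat) :
  psd X -> (forall i j : 'I_n, (i < k)%N -> X i j = 0) ->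
  exists (u : 'I_n -> R) (X' : 'M[R]_n),
    [/\ psd X', forall i j, X i j = u i * u j + X' i j
      & forall i j : 'I_n, (i < k.+1)%N -> X' i j = 0].
Proof.
move=> Xpsd Xk; have [XT _] := Xpsd.
have symX i j : X i j = X j i by rewrite -[in LHS]XT mxE.
have [kn|nk] := ltnP k n; last first.
  exists (fun=> 0), X; split=> // [i j|i j _]; first by rewrite mul0r add0r.
  by rewrite Xk// (leq_trans (ltn_ord i)).
pose e := Ordinal kn; have c0 := psd_diag_ge0 e Xpsd.
have [c_eq0|c_neq0] := eqVneq (X e e) 0.
  exists (fun=> 0), X; split=> // [i j|i j]; first by rewrite mul0r add0r.
  rewrite ltnS leq_eqVlt => /orP[/eqP ik|/Xk//].
  have -> : i = e by exact: val_inj.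
  apply/eqP; rewrite -sqrf_eq0 eq_le sqr_ge0 andbT.
  by rewrite (le_trans (psd_entry_sq e j Xpsd))// c_eq0 mul0r.
have {c_neq0}c0 : 0 < X e e by rewrite lt_def c_neq0.
set c := X e e in c0; pose s := Num.sqrt c.
have s0 : s != 0 by rewrite gt_eqF// sqrtr_gt0.
have ss : s ^+ 2 = c by rewrite sqr_sqrtr// ltW.
exists (fun i => X e i / s), (\matrix_(i, j) (X i j - X e i * X e j / c)); split.
- apply/psd_bilin; split=> [|v].
    by apply/matrixP => i j; rewrite !mxE symX [X e i * _]mulrC.
  have -> : bilin (\matrix_(i, j) (X i j - X e i * X e j / c)) v v =
     bilin X v v - (\sum_j X e j * v j) ^+ 2 / c.
    rewrite [in RHS]expr2 -mulrA mulr_suml -sumrN -big_split/=.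
    apply: eq_bigr => i _; rewrite mulr_suml mulr_sumr -sumrN -big_split/=.
    by apply: eq_bigr => j _; rewrite !mxE; ring.
  rewrite subr_ge0 ler_pdivrMr// mulrC; exact: psd_Cauchy_Schwarz.
- by move=> i j; rewrite !mxE -ss; field.
- move=> i j; rewrite mxE ltnS leq_eqVlt => /orP[/eqP ik|ik].
    have -> : i = e by exact: val_inj.
    by rewrite -/c mulrC mulKf ?subrr// gt_eqF.
  by rewrite Xk// (symX e i) Xk// !mul0r subr0.
Qed.

(** [n] steps of the Cholesky factorization exhaust the rows. *)
Lemma psd_Gram X : psd X ->
  exists u : 'I_n -> nat -> R, forall i j, X i j = \sum_(k < n) u i k * u j k.
Proof.
move=> Xpsd.
suff H (k : nat) : exists (u : 'I_n -> nat -> R) (X' : 'M[R]_n),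
    [/\ psd X', forall i j, X i j = \sum_(l < k) u i l * u j l + X' i j
      & forall i j : 'I_n, (i < k)%N -> X' i j = 0].
  have [u [X' [_ XE X'0]]] := H n; exists u => i j.
  by rewrite XE X'0// addr0.
elim: k => [|k [u [X' [X'psd XE X'0]]]].
  by exists (fun _ _ => 0), X; split=> // i j; rewrite big_ord0 add0r.
have [w [X'' [X''psd X'E X''0]]] := psd_Gram_step X'psd X'0.
exists (fun i l => if l == k then w i else u i l), X''; split=> // i j.
rewrite big_ord_recr/= eqxx XE X'E addrA; congr (_ + _ + _).
by apply: eq_bigr => l _; rewrite ltn_eqF.
Qed.

End Psd.

(** * Grothendieck's inequality *)

(** The sign vectors of length [m], as nested pairs: averages over this cube are
    computed by recursion on [m], alongside the list of coefficients. *)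
Fixpoint cube (m : nat) : finType :=
  if m is m'.+1 then (bool * cube m')%type else unit.

Section Rademacher.
Context {R : realType}.

Definition cube_mean m (f : cube m -> R) : R := (\sum_w f w) / 2 ^+ m.

Lemma cube_mean_recl m (f : cube m.+1 -> R) :
  cube_mean f = cube_mean (fun w => (f (true, w) + f (false, w)) / 2).
Proof.
rewrite /cube_mean -mulr_suml exprS invfM mulrA; congr (_ / _ / _).
rewrite big_split/= (eq_bigr (fun p => f (p.1, p.2))); last by case.
by rewrite -(pair_bigA _ (fun b w => f (b, w)))/= big_bool.
Qed.

Lemma cube_mean_const m (c : R) : cube_mean (fun _ : cube m => c) = c.
Proof.
elim: m => [|m IH].
  by rewrite /cube_mean big_const card_unit/= addr0 expr0 divr1.
by rewrite cube_mean_recl -[RHS]IH; congr cube_mean; apply/funext => w; field.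
Qed.

Lemma cube_meanD m (f g : cube m -> R) :
  cube_mean (fun w => f w + g w) = cube_mean f + cube_mean g.
Proof. by rewrite /cube_mean big_split mulrDl. Qed.

Lemma cube_meanZ m (f : cube m -> R) c :
  cube_mean (fun w => c * f w) = c * cube_mean f.
Proof. by rewrite /cube_mean -mulr_sumr mulrA. Qed.

Lemma cube_mean_le m (f g : cube m -> R) :
  (forall w, f w <= g w) -> cube_mean f <= cube_mean g.
Proof.
by move=> fg; rewrite ler_pM2r ?invr_gt0 ?exprn_gt0//; apply: ler_sum => w _.
Qed.

Section Sums.
Variable I : Type.
Implicit Types (u v : I -> R) (s : seq I).

Fixpoint rademacher u s : cube (size s) -> R :=
  if s is k :: s' then fun w => (-1) ^+ w.1 * u k + rademacher u w.2
  else fun=> 0.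

Lemma rademacher_cov u v s :
  cube_mean (fun w => rademacher u w * @rademacher v s w) =
  \sum_(k <- s) u k * v k.
Proof.
elim: s => [|k s IH].
  by rewrite big_nil -[RHS](cube_mean_const 0); congr cube_mean;
     apply/funext => w /=; rewrite mulr0.
rewrite big_cons cube_mean_recl -IH -[X in X + _](cube_mean_const (size s)).
rewrite -cube_meanD; congr cube_mean; apply/funext => w /=.
by rewrite !expr0 !expr1; field.
Qed.

(** The cross terms of odd degree in the new sign cancel, and the induction
    closes because the other terms are dominated by those of
    [3 * (u k ^+ 2 + S) ^+ 2], [S] being the sum of squares of the tail. *)
Lemma rademacher_moment4 u s :
  cube_mean (fun w => @rademacher u s w ^+ 4) <=
  3 * (\sum_(k <- s) u k ^+ 2) ^+ 2.
Proof.
elim: s => [|k s IH].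
  by rewrite big_nil expr0n mulr0 -(cube_mean_const 0 0); apply: cube_mean_le
    => w /=; rewrite expr0n.
rewrite big_cons cube_mean_recl.
rewrite (_ : cube_mean _ = u k ^+ 4 + 6 * u k ^+ 2 * (\sum_(k <- s) u k ^+ 2) +
    cube_mean (fun w => @rademacher u s w ^+ 4)); last first.
  under [in RHS]eq_bigr do rewrite expr2.
  rewrite -rademacher_cov -[X in X + _ + _](cube_mean_const (size s)).
  rewrite -cube_meanZ -!cube_meanD; congr cube_mean; apply/funext => w /=.
  by rewrite !expr0 !expr1; field.
set S := \sum_(k <- s) _ in IH *; have := sqr_ge0 (u k ^+ 2).
move: IH; nra.
Qed.

End Sums.
End Rademacher.

Section Grothendieck.
Context {R : realType} {n : nat}.
Variables (W : 'I_n -> 'I_n -> R) (beta : R).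
Hypothesis W_beta : forall x y : 'I_n -> R,
  (forall i, `|x i| <= 1) -> (forall i, `|y i| <= 1) ->
  \sum_i \sum_j W i j * (x i * y j) <= beta.

Let gram_value (I : finType) (u v : 'I_n -> I -> R) :=
  \sum_i \sum_j W i j * \sum_k u i k * v j k.

Let subunit (I : finType) (u : 'I_n -> I -> R) :=
  forall i, \sum_k u i k ^+ 2 <= 1.

Let gram_values : set R :=
  [set r | exists (I : finType) (u v : 'I_n -> I -> R),
     [/\ subunit u, subunit v & r = gram_value u v]].

Let gram_has_sup : has_sup gram_values.
Proof.
split.
  exists 0, unit, (fun _ _ => 0), (fun _ _ => 0).
  split=> [i|i|].
  - by rewrite big1 ?ler01// => k _; rewrite expr0n.
  - by rewrite big1 ?ler01// => k _; rewrite expr0n.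
  - rewrite /gram_value big1// => i _; rewrite big1// => j _.
    by rewrite big1 ?mulr0// => k _; rewrite mulr0.
exists (\sum_i \sum_j `|W i j|) => _ [I [u [v [u1 v1 ->]]]].
apply: ler_sum => i _; apply: ler_sum => j _.
rewrite (le_trans (ler_norm _))// normrM ler_piMr//.
rewrite -ler_sqr ?nnegrE// ?ler01// expr1n real_normK ?num_real//.
rewrite (le_trans (sum_Cauchy_Schwarz _ _))// mulr_ile1//;
  exact: sumr_ge0 (fun _ _ => sqr_ge0 _).
Qed.

Let K := sup gram_values.

Let gram_value_le (I : finType) (u v : 'I_n -> I -> R) :
  subunit u -> subunit v -> gram_value u v <= K.
Proof.
by move=> u1 v1; apply: ub_le_sup; [case: gram_has_sup|exists I, u, v].
Qed.

(** The expectation of a product of random variables of variance at most 1 on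
    the cube is again an inner product of vectors of norm at most 1. *)
Let cube_value_le m (u v : 'I_n -> cube m -> R) :
  (forall i, cube_mean (fun w => u i w ^+ 2) <= 1) ->
  (forall i, cube_mean (fun w => v i w ^+ 2) <= 1) ->
  \sum_i \sum_j W i j * cube_mean (fun w => u i w * v j w) <= K.
Proof.
move=> u1 v1; pose c : R := Num.sqrt (2 ^+ m)^-1.
have cc : c ^+ 2 = (2 ^+ m)^-1 by rewrite sqr_sqrtr// invr_ge0 exprn_ge0.
rewrite (_ : \sum_i _ = gram_value (fun i w => c * u i w) (fun i w => c * v i w)).
  by apply: gram_value_le => i; [apply: le_trans (u1 i)|apply: le_trans (v1 i)];
     rewrite /cube_mean -cc [leRHS]mulrC mulr_sumr; apply: ler_sum => w _;
     rewrite exprMn.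
apply: eq_bigr => i _; apply: eq_bigr => j _; congr (_ * _).
rewrite /cube_mean -cc mulrC mulr_sumr; apply: eq_bigr => w _.
by rewrite expr2; ring.
Qed.

Let low (x : R) := if `|x| <= 8 then x else 0.
Let high (x : R) := x - low x.

Let low_le x : `|low x / 8| <= 1.
Proof.
by rewrite /low normrM [`|8^-1|]ger0_norm// ler_pdivrMr// mul1r; case: ifP;
   rewrite ?normr0.
Qed.

Let low_sq x : low x ^+ 2 <= x ^+ 2.
Proof. by rewrite /low; case: ifP; rewrite ?expr0n ?sqr_ge0. Qed.

Let high_sq x : high x ^+ 2 <= 64^-1 * x ^+ 4.
Proof.
rewrite /high /low; case: ifPn; first by rewrite subrr expr0n/= mulr_ge0// exprn_even_ge0.
rewrite -ltNge subr0 => x8; have : 8 ^+ 2 <= x ^+ 2.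
  by rewrite -[x ^+ 2]real_normK ?num_real// ler_sqr ?nnegrE// ltW.
by have := sqr_ge0 x; nra.
Qed.

(** A configuration of unit vectors is realized by Rademacher sums.  Truncated
    at level 8 these are, pointwise, 8 times admissible test
    vectors of the hypothesis on [W]; the truncated part has standard deviation at most
    1/4 by the fourth moment bound, and is handled by the supremum [K] itself. *)
Let self_improvement (I : finType) (u v : 'I_n -> I -> R) :
  subunit u -> subunit v -> gram_value u v <= 64 * beta + K / 2.
Proof.
move=> u1 v1; pose s := index_enum I; pose m := size s.
pose U i (w : cube m) := @rademacher R I (u i) s w.
pose V i (w : cube m) := @rademacher R I (v i) s w.
have sq1 (a : 'I_n -> I -> R) i : subunit a ->
    cube_mean (fun w => @rademacher R I (a i) s w ^+ 2) <= 1.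
  move=> a1; rewrite (_ : cube_mean _ = \sum_k a i k ^+ 2)//.
  by under eq_bigr do rewrite expr2; rewrite -rademacher_cov.
have high1 (a : 'I_n -> I -> R) i : subunit a ->
    cube_mean (fun w => (4 * high (@rademacher R I (a i) s w)) ^+ 2) <= 1.
  move=> a1; apply: (@le_trans _ _ (4^-1 * (3 * (\sum_k a i k ^+ 2) ^+ 2))).
    apply: le_trans (ler_wpM2l _ (rademacher_moment4 _ _)); last by [].
    rewrite -cube_meanZ; apply: cube_mean_le => w.
    by have := high_sq (rademacher (a i) w); rewrite exprMn; lra.
  have := a1 i; have : 0 <= \sum_k a i k ^+ 2.
    by apply: sumr_ge0 => k _; exact: sqr_ge0.
  nra.
have low1 (a : 'I_n -> I -> R) i : subunit a ->
    cube_mean (fun w => low (@rademacher R I (a i) s w) ^+ 2) <= 1.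
  by move=> a1; apply: le_trans (sq1 a i a1); apply: cube_mean_le => w.
pose LL := \sum_i \sum_j W i j * cube_mean (fun w => low (U i w) * low (V j w)).
pose HV := \sum_i \sum_j W i j * cube_mean (fun w => 4 * high (U i w) * V j w).
pose LH := \sum_i \sum_j W i j * cube_mean (fun w => low (U i w) * (4 * high (V j w))).
have -> : gram_value u v = LL + 4^-1 * HV + 4^-1 * LH.
  rewrite /LL /HV /LH !mulr_sumr -!big_split; apply: eq_bigr => i _ /=.
  rewrite !mulr_sumr -!big_split; apply: eq_bigr => j _ /=.
  rewrite -rademacher_cov ![4^-1 * (W i j * _)]mulrCA -!mulrDr; congr (_ * _).
  rewrite -!cube_meanZ -!cube_meanD; congr cube_mean; apply/funext => w.
  by rewrite /high /U /V; field.
have HVK : HV <= K by apply: cube_value_le => i; [exact: high1|exact: sq1].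
have LHK : LH <= K by apply: cube_value_le => i; [exact: low1|exact: high1].
suff : LL <= 64 * beta by move: HVK LHK; lra.
rewrite -[leRHS](cube_mean_const m).
rewrite (_ : LL = cube_mean (fun w =>
    64 * \sum_i \sum_j W i j * (low (U i w) / 8 * (low (V j w) / 8)))).
  apply: cube_mean_le => w; rewrite ler_pM2l//; exact: W_beta.
rewrite /cube_mean mulr_suml; under [in RHS]eq_bigr do rewrite mulr_sumr mulr_suml.
rewrite exchange_big/=; apply: eq_bigr => i _.
under [in RHS]eq_bigr do rewrite mulr_sumr mulr_suml.
rewrite exchange_big/=; apply: eq_bigr => j _.
rewrite mulrA mulr_sumr mulr_suml; apply: eq_bigr => w _.
by field; rewrite expf_neq0.
Qed.

(** The best constant [K] over all dimensions is finite by a crude bound, and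
    [self_improvement] bounds [K] by [64 * beta + K / 2]. *)
Lemma Grothendieck (I : finType) (u v : 'I_n -> I -> R) :
  (forall i, \sum_k u i k ^+ 2 <= 1) -> (forall i, \sum_k v i k ^+ 2 <= 1) ->
  \sum_i \sum_j W i j * (\sum_k u i k * v j k) <= 128 * beta.
Proof.
move=> u1 v1; rewrite (le_trans (gram_value_le u1 v1))//.
suff : K <= 64 * beta + K / 2 by lra.
apply: ge_sup; first by case: gram_has_sup.
by move=> _ [J [a [b [a1 b1 ->]]]]; exact: self_improvement.
Qed.

(** A positive semidefinite matrix is a Gram matrix. *)
Lemma Grothendieck_psd (X : 'M[R]_n) :
  psd X -> (forall i, X i i <= 1) ->
  \sum_i \sum_j W i j * X i j <= 128 * beta.
Proof.
move=> /psd_Gram[u XE] X1.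
have u1 i : \sum_(k < n) u i k ^+ 2 <= 1.
  by rewrite (le_trans _ (X1 i))// XE.
rewrite (le_trans _ (@Grothendieck 'I_n (fun i k => u i k) (fun i k => u i k) u1 u1))//.
by apply: ler_sum => i _; apply: ler_sum => j _; rewrite XE.
Qed.

End Grothendieck.

(** A bilinear form is maximized over the unit cube at a vertex. *)
Lemma cut_norm_signs (R : realType) (n : nat) (W : 'I_n -> 'I_n -> R) beta :
  (forall x y : {ffun 'I_n -> bool},
     \sum_i \sum_j W i j * ((-1) ^+ x i * (-1) ^+ y j) <= beta) ->
  forall x y : 'I_n -> R,
    (forall i, `|x i| <= 1) -> (forall i, `|y i| <= 1) ->
  \sum_i \sum_j W i j * (x i * y j) <= beta.
Proof.
move=> W_beta.
have vertex (c x : 'I_n -> R) : (forall i, `|x i| <= 1) ->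
    exists s : {ffun 'I_n -> bool}, \sum_i c i * x i <= \sum_i c i * (-1) ^+ s i.
  move=> x1; exists [ffun i => c i < 0]; apply: ler_sum => i _; rewrite ffunE.
  rewrite [leRHS]mulrC -normrEsign.
  rewrite (le_trans (ler_norm _))// normrM ler_piMr//.
move=> x y x1 y1.
have [s sx] := vertex (fun i => \sum_j W i j * y j) x x1.
have [t ty] := vertex (fun j => \sum_i W i j * (-1) ^+ s i) y y1.
apply: le_trans (W_beta s t).
rewrite (_ : \sum_i _ = \sum_i (\sum_j W i j * y j) * x i); last first.
  apply: eq_bigr => i _; rewrite mulr_suml; apply: eq_bigr => j _; ring.
apply: le_trans sx _.
rewrite [leLHS](_ : _ = \sum_j (\sum_i W i j * (-1) ^+ s i) * y j); last first.
  under eq_bigr do rewrite mulr_suml.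
  rewrite exchange_big; apply: eq_bigr => j _; rewrite mulr_suml.
  by apply: eq_bigr => i _; ring.
apply: le_trans ty _; rewrite exchange_big; apply: ler_sum => j _.
by rewrite mulr_suml; apply: ler_sum => i _; rewrite mulrA.
Qed.

(** * Projection onto the feasible set of the semidefinite program *)

Section Sdp.
Context {R : realType} {n : nat}.
Implicit Types X Y Z : 'M[R]_n.

Definition mxip X Y : R := \sum_i \sum_j X i j * Y i j.

Lemma mxipC X Y : mxip X Y = mxip Y X.
Proof. by apply: eq_bigr => i _; apply: eq_bigr => j _; rewrite mulrC. Qed.

Lemma mxip_linear Z c X Y : mxip Z (c *: X + Y) = c * mxip Z X + mxip Z Y.
Proof.
rewrite /mxip mulr_sumr -big_split; apply: eq_bigr => i _ /=.
rewrite mulr_sumr -big_split; apply: eq_bigr => j _ /=.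
by rewrite !mxE mulrDr mulrCA.
Qed.

Lemma mxipB Z X Y : mxip Z (X - Y) = mxip Z X - mxip Z Y.
Proof. by rewrite addrC -scaleN1r mxip_linear mulN1r addrC. Qed.

Lemma mxipBl Z X Y : mxip (X - Y) Z = mxip X Z - mxip Y Z.
Proof. by rewrite mxipC mxipB !(mxipC Z). Qed.

Lemma frobenius_ip X : frobenius_sq X = mxip X X.
Proof. by []. Qed.

Lemma frobenius_ge0 X : 0 <= frobenius_sq X.
Proof. by do 2!apply: sumr_ge0 => ? _; exact: sqr_ge0. Qed.

Lemma frobeniusB X Y t :
  frobenius_sq (X - t *: Y) =
  frobenius_sq X - 2 * t * mxip X Y + t ^+ 2 * frobenius_sq Y.
Proof.
rewrite /frobenius_sq /mxip !mulr_sumr -sumrB -big_split; apply: eq_bigr => i _ /=.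
rewrite !mulr_sumr -sumrB -big_split; apply: eq_bigr => j _ /=.
by rewrite !mxE; ring.
Qed.

Lemma sdp_feasible_entry X i j : sdp_feasible X -> `|X i j| <= n%:R^-1.
Proof.
case=> Xpsd Xd; rewrite -ler_sqr ?nnegrE ?invr_ge0// real_normK ?num_real//.
by rewrite (le_trans (psd_entry_sq i j Xpsd))// !Xd.
Qed.

Lemma bilin_linear X Y t (v : 'I_n -> R) :
  bilin (X + t *: Y) v v = bilin X v v + t * bilin Y v v.
Proof.
rewrite /bilin mulr_sumr -big_split; apply: eq_bigr => i _ /=.
rewrite mulr_sumr -big_split; apply: eq_bigr => j _ /=.
by rewrite !mxE; ring.
Qed.

Lemma sdp_feasible_convex X Y t : sdp_feasible X -> sdp_feasible Y ->
  0 <= t <= 1 -> sdp_feasible (X + t *: (Y - X)).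
Proof.
move=> [/psd_bilin[XT X0] Xd] [/psd_bilin[YT Y0] Yd] /andP[t0 t1]; split.
  apply/psd_bilin; split.
    have tr (Z : 'M[R]_n) i j : Z^T = Z -> Z j i = Z i j.
      by move=> ZT; rewrite -[in LHS]ZT mxE.
    by apply/matrixP => i j; rewrite !mxE (tr X)// (tr Y).
  move=> v; rewrite bilin_linear.
  have -> : bilin (Y - X) v v = bilin Y v v - bilin X v v.
    by rewrite -scaleN1r bilin_linear mulN1r.
  by have := X0 v; have := Y0 v; nra.
by move=> i; rewrite !mxE Xd Yd subrr mulr0 addr0.
Qed.

Lemma sdp_feasible_scalar : sdp_feasible (n%:R^-1%:M : 'M[R]_n).
Proof.
split; last by move=> i; rewrite mxE eqxx.
split; first exact: tr_scalar_mx.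
move=> v; rewrite mul_mx_scalar -scalemxAl mxE mulr_ge0 ?invr_ge0//.
by rewrite mxE sumr_ge0// => i _; rewrite mxE -expr2 sqr_ge0.
Qed.

(* Boxes are compact in spaces of row vectors. *)
Let vec := 'rV[R]_(n * n).

Let continuous_entry i j : continuous (fun v : vec => vec_mx v i j).
Proof.
have -> : (fun v : vec => vec_mx v i j) = (fun v => v 0 (mxvec_index i j)).
  by apply/funext => v; rewrite mxE.
exact: coord_continuous.
Qed.

Let continuous_sum (I : Type) (r : seq I) (f : I -> vec -> R) :
  (forall i, continuous (f i)) -> continuous (fun v => \sum_(i <- r) f i v).
Proof.
move=> cf; elim: r => [|i r IH].
  rewrite (_ : (fun v => _) = cst 0); first exact: cst_continuous.
  by apply/funext => v; rewrite big_nil.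
rewrite (_ : (fun v => _) = (fun v => f i v + \sum_(j <- r) f j v)).
  move=> v; exact: (continuousD (cf i v) (IH v)).
by apply/funext => v; rewrite big_cons.
Qed.

Let closed_comp (f : vec -> R) (A : set R) :
  continuous f -> closed A -> closed [set v | A (f v)].
Proof. by move=> /continuous_closedP cf cA; exact: cf. Qed.

Lemma sdp_feasible_compact : compact [set v : vec | sdp_feasible (vec_mx v)].
Proof.
have box : compact [set v : vec | forall k, `[- n%:R^-1, n%:R^-1]%classic (v ord0 k)].
  exact: (rV_compact (fun=> @segment_compact R _ _)).
apply: (subclosed_compact _ box); last first.
  move=> v /= vf k; case/mxvec_indexP: k => i j.
  have := sdp_feasible_entry i j vf.
  by rewrite mxE /= in_itv/= -ler_norml.
have -> : [set v : vec | sdp_feasible (vec_mx v)] =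
    (\bigcap_(p : 'I_n * 'I_n) [set v : vec | vec_mx v p.1 p.2 - vec_mx v p.2 p.1 = 0])
    `&` (\bigcap_(u : 'I_n -> R) [set v : vec | 0 <= bilin (vec_mx v) u u])
    `&` (\bigcap_i [set v : vec | vec_mx v i i = n%:R^-1]).
  apply/seteqP; split=> v /=.
    move=> [/psd_bilin[sX X0] Xd]; split; [split|].
    - move=> [i j] _ /=; apply/eqP; rewrite subr_eq0; apply/eqP.
      by rewrite -[in LHS]sX mxE.
    - by move=> u _; exact: X0.
    - by move=> i _; exact: Xd.
  move=> [[sX X0] Xd]; split.
    apply/psd_bilin; split=> [|u]; last exact: X0.
    apply/matrixP => i j; rewrite mxE; apply/eqP; rewrite -subr_eq0.
    by rewrite (sX (j, i)).
  by move=> i; exact: Xd.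
apply: closedI; first apply: closedI.
- apply: closed_bigI => -[i j] _ /=.
  apply: (@closed_comp (fun v => vec_mx v i j - vec_mx v j i) _ _ (@closed_eq R 0)).
  by move=> v; apply: continuousB; exact: continuous_entry.
- apply: closed_bigI => u _ /=.
  apply: (@closed_comp (fun v => bilin (vec_mx v) u u) _ _ (@closed_ge R 0)).
  apply: continuous_sum => i; apply: continuous_sum => j v.
  exact: (continuousM (continuousM (@cst_continuous _ _ (u i) v)
    (@continuous_entry i j v)) (@cst_continuous _ _ (u j) v)).
- apply: closed_bigI => i _ /=.
  apply: (@closed_comp (fun v => vec_mx v i i) _ _ (@closed_eq R _)).
  exact: continuous_entry.
Qed.

Lemma sdp_minimizer_exists Y : exists X, sdp_minimizer Y X.
Proof.
have [v] : exists2 v, v \in [set v : vec | sdp_feasible (vec_mx v)] &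
    forall t, t \in [set v : vec | sdp_feasible (vec_mx v)] ->
      frobenius_sq (Y - vec_mx v) <= frobenius_sq (Y - vec_mx t).
  apply: compact_EVT_min.
  - by exists (mxvec n%:R^-1%:M) => /=; rewrite mxvecK; exact: sdp_feasible_scalar.
  - exact: sdp_feasible_compact.
  - apply: continuous_subspaceT; apply: continuous_sum => i.
    apply: continuous_sum => j v.
    rewrite (_ : (fun v : vec => _) = (fun v : vec => (Y i j - vec_mx v i j) * (Y i j - vec_mx v i j))); last first.
      by apply/funext => w; rewrite !mxE expr2.
    have cB := continuousB (@cst_continuous _ _ (Y i j) v) (@continuous_entry i j v).
    exact: (continuousM cB cB).
rewrite inE /= => vf vmin; exists (vec_mx v); split=> // X' X'f.
by have := vmin (mxvec X'); rewrite inE/= mxvecK; exact.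
Qed.

Lemma XhatP Y : sdp_minimizer Y (Xhat Y).
Proof. by have [X XP] := sdp_minimizer_exists Y; exact: (xgetPex 0 (ex_intro _ X XP)). Qed.

Lemma Xhat_feasible Y : sdp_feasible (Xhat Y).
Proof. by case: (XhatP Y). Qed.

(** First order optimality: otherwise a short step from the minimizer towards
    [X] would decrease the distance to [Y]. *)
Lemma Xhat_variational Y X : sdp_feasible X ->
  mxip (Y - Xhat Y) (X - Xhat Y) <= 0.
Proof.
move=> Xf; have [hf hmin] := XhatP Y.
set H := Xhat Y in hf hmin *; set q := mxip _ _.
have F0 := frobenius_ge0 (X - H).
have step t : 0 <= t <= 1 -> 2 * t * q <= t ^+ 2 * frobenius_sq (X - H).
  move=> t01; have := hmin _ (sdp_feasible_convex hf Xf t01).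
  rewrite opprD addrA frobeniusB -/q; lra.
rewrite leNgt; apply/negP => q0.
pose F := frobenius_sq (X - H); pose t := q / (q + F).
have qF : 0 < q + F by rewrite ltr_wpDr.
have t0 : 0 < t by rewrite divr_gt0.
have t1 : t <= 1 by rewrite ler_pdivrMr// mul1r lerDl.
have := step t; rewrite (ltW t0) t1 => /(_ isT).
have -> : 2 * t * q = t * (2 * q) by ring.
have -> : t ^+ 2 * F = t * (t * F) by ring.
rewrite ler_pM2l//; suff : t * F <= q by move: q0; lra.
by rewrite /t mulrAC ler_pdivrMr// ler_pM2l// lerDr ltW.
Qed.

(** The three-point inequality of projections: the variational inequality
    tested at [X] itself. *)
Lemma Xhat_dist_feasible Y X : sdp_feasible X ->
  frobenius_sq (Xhat Y - X) <= mxip (Y - X) (Xhat Y - X).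
Proof.
move=> /(@Xhat_variational Y); rewrite frobenius_ip !(mxipBl, mxipB).
by rewrite !(mxipC X) !(mxipC _ (Xhat Y)); lra.
Qed.

(** The sum of the two variational inequalities, each tested at the other
    projection. *)
Lemma Xhat_nonexpansive Y1 Y2 :
  frobenius_sq (Xhat Y1 - Xhat Y2) <= mxip (Y1 - Y2) (Xhat Y1 - Xhat Y2).
Proof.
have := Xhat_variational Y1 (Xhat_feasible Y2).
have := Xhat_variational Y2 (Xhat_feasible Y1).
rewrite frobenius_ip !(mxipBl, mxipB) (mxipC (Xhat Y2) (Xhat Y1)); lra.
Qed.

(** Monotonicity of the projection, together with the entrywise bound of order
    [1 / n] on feasible matrices, makes the squared distance linear (rather
    than quadratic) in the size of the perturbation. *)
Lemma Xhat_stability Y1 Y2 :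
  frobenius_sq (Xhat Y1 - Xhat Y2) <=
  2 / n%:R * \sum_i \sum_j `|Y1 i j - Y2 i j|.
Proof.
rewrite (le_trans (Xhat_nonexpansive _ _))// mulr_sumr.
apply: ler_sum => i _; rewrite mulr_sumr; apply: ler_sum => j _.
rewrite !mxE (le_trans (ler_norm _))// normrM mulrC ler_wpM2r//.
rewrite (le_trans (ler_normB _ _))// (_ : 2 / n%:R = n%:R^-1 + n%:R^-1); last by ring.
by rewrite lerD// sdp_feasible_entry//; exact: Xhat_feasible.
Qed.

End Sdp.

(** * Leading eigenvectors of nonsymmetric perturbations of rank one matrices *)

(** Both factorizations of the block matrix with blocks 1, [v], [w], 1 by Schur
    complements have the same determinant. *)
Lemma det_one_sub_rank1 (K : comNzRingType) n (w : 'cV[K]_n) (v : 'rV[K]_n) :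
  \det (1%:M - w *m v) = 1 - (v *m w) 0 0.
Proof.
pose L := block_mx 1%:M 0 w 1%:M; pose U := block_mx 1%:M v w 1%:M.
have EL : U = L *m block_mx 1%:M v 0 (1%:M - w *m v).
  by rewrite mulmx_block !mulmx1 !mul1mx ?mulmx0 ?mul0mx !addr0 addrC subrK.
have ER : U = block_mx 1%:M v 0 1%:M *m block_mx (1%:M - v *m w) 0 w 1%:M.
  by rewrite mulmx_block !mulmx1 !mul1mx ?mulmx0 ?mul0mx !add0r subrK.
have := congr1 (fun A => \det A) EL; rewrite ER !det_mulmx !det_lblock !det_ublock.
by rewrite !det1 !mul1r mulr1 det_mx11 !mxE => <-.
Qed.

Section Vectors.
Context {R : realType} {n : nat}.
Implicit Types (u v x y : 'cV[R]_n) (E M : 'M[R]_n).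

Definition dot u v : R := \sum_i u i 0 * v i 0.
Definition sqn v : R := \sum_i v i 0 ^+ 2.

Lemma sqn_ge0 v : 0 <= sqn v.
Proof. by apply: sumr_ge0 => i _; exact: sqr_ge0. Qed.

Lemma sqn_eq0 v : sqn v = 0 -> v = 0.
Proof.
move=> /eqP; rewrite psumr_eq0 => [/allP v0|i _]; last exact: sqr_ge0.
apply/matrixP => i j; rewrite ord1 mxE; apply/eqP; rewrite -sqrf_eq0.
by apply: v0; rewrite mem_index_enum.
Qed.

Lemma sqn_lin a b u v :
  sqn (a *: u + b *: v) = a ^+ 2 * sqn u + 2 * a * b * dot u v + b ^+ 2 * sqn v.
Proof.
rewrite /sqn /dot !mulr_sumr -!big_split; apply: eq_bigr => i _ /=.
by rewrite !mxE; ring.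
Qed.

Lemma sqnZ a v : sqn (a *: v) = a ^+ 2 * sqn v.
Proof. by rewrite /sqn mulr_sumr; apply: eq_bigr => i _; rewrite mxE exprMn. Qed.

Lemma dotZ a u v : dot u (a *: v) = a * dot u v.
Proof. by rewrite /dot mulr_sumr; apply: eq_bigr => i _; rewrite mxE mulrCA. Qed.

Lemma dotD u v w : dot u (v + w) = dot u v + dot u w.
Proof. by rewrite /dot -big_split; apply: eq_bigr => i _; rewrite mxE mulrDr. Qed.

Lemma dotC u v : dot u v = dot v u.
Proof. by apply: eq_bigr => i _; rewrite mulrC. Qed.

Lemma dotvv v : dot v v = sqn v.
Proof. by []. Qed.

Lemma dot_sq_le u v : dot u v ^+ 2 <= sqn u * sqn v.
Proof. exact: sum_Cauchy_Schwarz. Qed.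

Lemma rank1_mul x y : x *m x^T *m y = dot x y *: x.
Proof.
rewrite -mulmxA; apply/matrixP => i j; rewrite ord1 !mxE big_ord1 !mxE mulrC.
by congr (_ * _); apply: eq_bigr => k _; rewrite mxE.
Qed.

(** [r] bounds the operator norm of [E] with respect to Euclidean norms. *)
Definition op_norm_le E (r : R) : Prop :=
  forall v, sqn (E *m v) <= r ^+ 2 * sqn v.

Lemma op_norm_leD E M r s : 0 <= r -> 0 <= s ->
  op_norm_le E r -> op_norm_le M s -> op_norm_le (E + M) (r + s).
Proof.
move=> r0 s0 Er Ms v; rewrite mulmxDl -[E *m v]scale1r -[M *m v]scale1r sqn_lin.
rewrite !expr1n !mul1r !mulr1.
have q0 := sqn_ge0 v; have := Er v; have := Ms v.
set a := sqn (E *m v); set b := sqn (M *m v); set q := sqn v in q0 * => bM aE.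
have : `|dot (E *m v) (M *m v)| <= r * s * q.
  rewrite -ler_sqr ?nnegrE ?mulr_ge0// real_normK ?num_real//.
  rewrite (le_trans (dot_sq_le _ _))// -/a -/b.
  have -> : (r * s * q) ^+ 2 = (r ^+ 2 * q) * (s ^+ 2 * q) by ring.
  by rewrite ler_pM// sqn_ge0.
move=> /(le_trans (ler_norm _)); lra.
Qed.

Lemma op_norm_le_frobenius E r : 0 <= r -> frobenius_sq E <= r ^+ 2 -> op_norm_le E r.
Proof.
move=> r0 Er v; apply: le_trans (ler_wpM2r (sqn_ge0 v) Er).
rewrite /sqn /frobenius_sq mulr_suml; apply: ler_sum => i _.
by rewrite mxE; exact: sum_Cauchy_Schwarz.
Qed.

Lemma op_norm_le_scale E r c : 0 <= c -> op_norm_le E r ->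
  op_norm_le (c *: E) (c * r).
Proof.
move=> c0 Er v; rewrite -scalemxAl sqnZ exprMn -[leRHS]mulrA ler_wpM2l ?sqr_ge0//.
Qed.

Lemma op_norm_le_eigenvalue E r t : op_norm_le E r -> 0 <= r -> r < t ->
  forall v, t *: v - E *m v = 0 -> v = 0.
Proof.
move=> Er r0 rt v /eqP; rewrite subr_eq0 => /eqP tv.
apply: sqn_eq0; apply/eqP; rewrite eq_le sqn_ge0 andbT leNgt; apply/negP => v0.
have := Er v; rewrite -tv sqnZ ler_pM2r// ler_sqr ?nnegrE ?(ltW (le_lt_trans r0 rt))//.
by rewrite leNgt rt.
Qed.

End Vectors.

(** A monic polynomial is eventually positive, so the intermediate value
    theorem applies to the right of [t]. *)
Lemma monic_root_ge (R : rcfType) (p : {poly R}) (t : R) :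
  p \is monic -> p.[t] <= 0 -> exists2 m, t <= m & root p m.
Proof.
move=> /monicP p_monic pt.
have [T pT] : exists T, forall x, T <= x -> lead_coef p <= p.[x].
  by apply: polyrcf.poly_pinfty_gt_lc; rewrite p_monic.
have tT : t <= Num.max t T by rewrite le_max lexx.
have p0 : 0 <= p.[Num.max t T].
  by rewrite (le_trans _ (pT _ _)) ?p_monic// le_max lexx orbT.
have [|m /andP[tm _] pm] := @poly_ivt R p t (Num.max t T) tT; first by rewrite pt.
by exists m.
Qed.

Section Leading.
Context {R : realType} {n : nat}.
Implicit Types (u v x y : 'cV[R]_n) (E M : 'M[R]_n).

Lemma eigenvalue_column M l :
  eigenvalue M l <-> exists2 v : 'cV[R]_n, M *m v = l *: v & v != 0.
Proof.
have trE : eigenvalue M l = eigenvalue M^T l.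
  rewrite !eigenvalue_root_char /char_poly -det_tr; congr (root (\det _) l).
  by apply/matrixP => i j; rewrite !mxE eq_sym.
rewrite trE; split=> [/eigenvalueP[v vM v0]|[v vM v0]].
  exists v^T; last by rewrite -(inj_eq trmx_inj) trmxK trmx0.
  by apply: trmx_inj; rewrite trmx_mul trmxK vM linearZ/= trmxK.
apply/eigenvalueP; exists v^T; last by rewrite -(inj_eq trmx_inj) trmxK trmx0.
by rewrite -trmx_mul vM linearZ.
Qed.

(** The characteristic polynomial has finitely many real roots; if it has any,
    the largest one is the leading eigenvalue. *)
Lemma leading_unit_eigenvector_exists M t : eigenvalue M t ->
  exists x, leading_unit_eigenvector M x.
Proof.
move=> Mt; set p := char_poly M.
have p0 : p != 0 by rewrite monic_neq0// char_poly_monic.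
have rootE m : eigenvalue M m = (m \in polyrcf.rootsR p).
  by rewrite eigenvalue_root_char -(polyrcf.roots_on_rootsR p0) in_itv.
pose s := polyrcf.rootsR p.
have [l ls lmax] : exists2 l, l \in s & forall m, m \in s -> m <= l.
  have : t \in s by rewrite -rootE.
  elim: s t {Mt} => [//|a s IH] t _; have [s0|] := eqVneq s [::].
    by exists a; rewrite s0 ?mem_head// => m; rewrite inE => /eqP->.
  case: s => [//|b s] in IH * => _.
  have [l ls lmax] := IH b (mem_head _ _).
  exists (Num.max a l) => [|m]; first by rewrite inE; case: leP => _; rewrite ?ls ?eqxx ?orbT.
  by rewrite inE le_max => /orP[/eqP->|/lmax ->]; rewrite ?lexx ?orbT.
have /eigenvalue_column[v Mv v0] : eigenvalue M l by rewrite rootE.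
have q0 : 0 < sqn v.
  rewrite lt_def sqn_ge0 andbT; apply: contra v0 => /eqP/sqn_eq0 ->; exact: eqxx.
exists ((Num.sqrt (sqn v))^-1 *: v); split.
  rewrite -[LHS]/(sqn _) sqnZ exprVn sqr_sqrtr ?mulVf ?gt_eqF//.
  exact: ltW.
exists l; first by rewrite -scalemxAr Mv !scalerA mulrC.
by move=> m; rewrite rootE; exact: lmax.
Qed.

Variables (x : 'cV[R]_n) (E : 'M[R]_n) (r : R).
Hypotheses (x1 : sqn x = 1) (Er : op_norm_le E r) (r0 : 0 <= r) (r8 : r <= 8^-1).
Let M := x *m x^T + E.

Lemma char_poly_det (A : 'M[R]_n) t : (char_poly A).[t] = \det (t%:M - A).
Proof.
rewrite /char_poly -horner_evalE -det_map_mx; congr (\det _).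
apply/matrixP => i j; rewrite !mxE /= /horner_eval !hornerE.
by case: (i == j); rewrite ?mulr1n ?mulr0n ?hornerX ?horner0.
Qed.

(** At [t = 1/2], between the spectrum of [E] and the eigenvalue 1 of
    [x *m x^T], the matrix determinant lemma gives
    det (t - M) = det (t - E) * (1 - x^T (t - E)^-1 x), whose first factor is
    positive and whose second factor is close to 1 - 1 / t = -1. *)
Lemma rank1_perturbation_eigenvalue : exists2 t, 2^-1 <= t & eigenvalue M t.
Proof.
suff /monic_root_ge [|t t2] : (char_poly M).[2^-1] <= 0.
- exact: char_poly_monic.
- by rewrite -eigenvalue_root_char => Mt; exists t.
pose A := (2^-1)%:M - E.
have rlt : r < 2^-1 by move: r8; lra.
have detA : 0 < \det A.
  rewrite -char_poly_det ltNge; apply/negP => /monic_root_ge[|t t2].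
    exact: char_poly_monic.
  rewrite -eigenvalue_root_char => /eigenvalue_column[v Ev /negP[]]; apply/eqP.
  by apply: (op_norm_le_eigenvalue Er r0 (lt_le_trans rlt t2)); rewrite Ev subrr.
have Aunit : A \in unitmx by rewrite unitmxE unitfE gt_eqF.
pose y := invmx A *m x.
have Ay : A *m y = x by rewrite /y mulKVmx.
have ME : (2^-1)%:M - M = A *m (1%:M - y *m x^T).
  by rewrite mulmxBr mulmx1 mulmxA Ay /A /M opprD addrA addrAC.
rewrite char_poly_det ME det_mulmx det_one_sub_rank1 pmulr_rle0// subr_le0.
have -> : (x^T *m y) 0 0 = dot x y.
  by rewrite mxE; apply: eq_bigr => i _; rewrite mxE.
have half_y : 2^-1 *: y = x + E *m y.
  by rewrite -Ay /A mulmxBl mul_scalar_mx subrK.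
have dotxy : 2^-1 * dot x y = 1 + dot x (E *m y).
  by rewrite -dotZ half_y dotD dotvv x1.
have := dot_sq_le x (E *m y); rewrite x1 mul1r.
have Ey := Er y.
have := sqn_lin 2^-1 (-1) y (E *m y).
have -> : 2^-1 *: y + -1 *: (E *m y) = x by rewrite scaleN1r half_y addrK.
have := dot_sq_le y (E *m y).
have := sqn_ge0 y; have := sqn_ge0 (E *m y).
rewrite x1; move: Ey; set q := sqn y; set e := sqn (E *m y).
set f := dot x (E *m y) in dotxy *; set c := dot y _.
move=> eq e0 q0 cqe one fe.
have r2 : r ^+ 2 <= 64^-1 by move: r0 r8; nra.
have e64 : e <= 64^-1 * q by move: eq; nra.
have c8 : - (8^-1 * q) <= c <= 8^-1 * q.
  rewrite -ler_norml -ler_sqr ?nnegrE ?mulr_ge0// real_normK ?num_real//.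
  by rewrite (le_trans cqe)//; nra.
have : - 2^-1 <= f <= 2^-1.
  by rewrite -ler_norml -ler_sqr ?nnegrE// real_normK ?num_real//; lra.
lra.
Qed.

Lemma leading_perturbation_exists : exists y, leading_unit_eigenvector M y.
Proof.
by have [t _ Mt] := rank1_perturbation_eigenvalue;
   exact: leading_unit_eigenvector_exists Mt.
Qed.

(** The component of the eigenvector orthogonal to [x] is produced by [E]
    alone, and the eigenvalue is at least 1/2. *)
Lemma leading_perturbation_close y : leading_unit_eigenvector M y ->
  sqn (y - dot x y *: x) <= 4 * r ^+ 2.
Proof.
move=> [y1 [l My lmax]]; have {}y1 : sqn y = 1 by [].
have [t t2 /lmax tl] := rank1_perturbation_eigenvalue.
have l2 := le_trans t2 tl.
set c := dot x y.
have Ey : E *m y = l *: y + (- c) *: x.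
  by rewrite -My /M mulmxDl rank1_mul -/c scaleNr addrAC subrr add0r.
have := Er y; rewrite Ey sqn_lin y1 x1 (dotC y x) -/c => H.
have -> : y - c *: x = 1 *: y + (- c) *: x by rewrite scale1r scaleNr.
rewrite sqn_lin y1 x1 (dotC y x) -/c.
have c1 : c ^+ 2 <= 1 by have := dot_sq_le x y; rewrite x1 y1 mulr1.
have H1 : l ^+ 2 * (1 - c ^+ 2) <= r ^+ 2.
  by have := mulr_ge0 (sqr_ge0 c) (sqr_ge0 (l - 1)); move: H; nra.
have : 4^-1 * (1 - c ^+ 2) <= l ^+ 2 * (1 - c ^+ 2).
  by rewrite ler_wpM2r ?subr_ge0//; move: l2; nra.
by move: H1; lra.
Qed.

End Leading.

(** A coordinate on which the two signs differ contributes at least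
    [(dot x y * x i) ^+ 2] to the squared distance. *)
Lemma sign_mismatch_count (R : realType) n (x y : 'cV[R]_n) (r : R)
    (Mis : {set 'I_n}) :
  sqn x = 1 -> sqn y = 1 -> (forall i, x i 0 ^+ 2 = n%:R^-1) ->
  (forall i, i \in Mis -> dot x y * x i 0 * y i 0 <= 0) ->
  sqn (y - dot x y *: x) <= 4 * r ^+ 2 -> 0 <= r <= 8^-1 ->
  #|Mis|%:R / n%:R <= 6 * r ^+ 2.
Proof.
move=> x1 y1 xn; set c := dot x y => mis; set z := y - _ => zr /andP[r0 r8].
have zE : sqn z = 1 - c ^+ 2.
  by rewrite /z -[y in y - _]scale1r -scaleNr sqn_lin (dotC y) -/c x1 y1; ring.
have : c ^+ 2 * (#|Mis|%:R / n%:R) <= sqn z.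
  rewrite -sum1_card natr_sum mulr_suml mulr_sumr /sqn [leRHS](bigID (mem Mis))/=.
  rewrite -[leLHS]addr0 lerD ?sumr_ge0// => [|i _]; last exact: sqr_ge0.
  apply: ler_sum => i iM; rewrite !mxE div1r -(xn i).
  have sq (a b e : R) : e * a * b <= 0 -> e ^+ 2 * a ^+ 2 <= (b - e * a) ^+ 2.
    by have := sqr_ge0 b; nra.
  exact: sq (mis i iM).
have : 0 <= #|Mis|%:R / n%:R :> R by rewrite divr_ge0.
move: zr; rewrite zE; set q := #|Mis|%:R / _ => zr q0 cq.
have r2 : r ^+ 2 <= 64^-1 by move: r0 r8; nra.
have c2 : 15 / 16 <= c ^+ 2 by move: zr r2; lra.
have := ler_wpM2r q0 c2; move: cq zr; lra.
Qed.

(** * Degree truncation *)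

Lemma d_node_le1 n (G G' : 'M[bool]_n) : (1 < n)%N -> (d_node G G' <= 1)%N ->
  exists2 S : {set 'I_n}, (#|S| <= 1)%N & agree_off S G G'.
Proof.
move=> n1; rewrite /d_node => dG; apply: contrapT => noS.
suff : (1 < \big[minn/n]_(S : {set 'I_n} | agree_off S G G') #|S|)%N.
  by rewrite ltnNge dG.
apply: (big_ind (fun m => 1 < m)%N) => // [a b a1 b1|S GS].
  by rewrite leq_min a1.
by rewrite ltnNge; apply/negP => S1; apply: noS; exists S.
Qed.

Section Truncation.
Context {R : realType} {n : nat}.
Variable lp : R -> 'M[bool]_n -> 'rV[R]_n * 'M[R]_n.
Hypothesis lp_ok : lp_rule lp.
Variable D : R.
Hypothesis D0 : 0 <= D.
Implicit Types G H : 'M[bool]_n.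

Let x G : 'rV[R]_n := (lp D G).1.
Let w G : 'M[R]_n := (lp D G).2.
Let heavy G : {set 'I_n} := [set u | 4^-1 <= x G 0 u].

Let feasible G : simple_graph G -> lp_feasible D G (x G, w G).
Proof. by move=> sG; have [] := lp_ok D0 sG; rewrite -surjective_pairing. Qed.

Let optimal G y v : simple_graph G -> lp_feasible D G (y, v) ->
  \sum_u x G 0 u <= \sum_u y 0 u.
Proof. by move=> sG /(proj2 (lp_ok D0 sG)). Qed.

Let x_ge0 G u : simple_graph G -> 0 <= x G 0 u.
Proof. by move=> /feasible[]. Qed.

Lemma d_trunc_ge0 G : simple_graph G -> 0 <= d_trunc lp D G.
Proof. by move=> sG; rewrite mulr_ge0// sumr_ge0// => u _; exact: x_ge0. Qed.

Let truncE G u v : trunc lp D G u v = [&& G u v, u \notin heavy G & v \notin heavy G].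
Proof. by rewrite mxE negb_or !inE. Qed.

Let trunc_sym G u v : simple_graph G -> trunc lp D G u v = trunc lp D G v u.
Proof.
move=> [sG _]; rewrite !truncE -{1}sG mxE.
by rewrite [(v \notin _) && _]andbC.
Qed.

(** A surviving edge has weight at least 1/2, so at most [2 * D] survive at
    each node. *)
Lemma trunc_degree G u : simple_graph G ->
  \sum_v (trunc lp D G u v)%:R <= 2 * D.
Proof.
move=> sG; have [_ x0 w0 wG wD] := feasible sG.
have ww v : v != u -> 2^-1 * (trunc lp D G u v)%:R <= w G u v.
  move=> _; rewrite truncE !inE -!ltNge; case: and3P => [[Guv xu xv]|_]; last first.
    by rewrite mulr0.
  by have /andP[+ _] := wG u v; rewrite Guv mulr1 /=; move: xu xv; lra.
rewrite (bigD1 u)//= truncE (proj2 sG) add0r.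
rewrite -ler_pdivrMl// mulr_sumr (le_trans _ (wD u))//; exact: ler_sum.
Qed.

(** Markov's inequality for the counting measure. *)
Lemma heavy_card G : simple_graph G -> #|heavy G|%:R <= d_trunc lp D G.
Proof.
move=> sG; rewrite /d_trunc -/(x G) mulr_sumr (bigID (mem (heavy G)))/=.
rewrite -[leLHS]addr0 lerD//; last first.
  by apply: sumr_ge0 => u _; rewrite mulr_ge0// x_ge0.
rewrite -sum1_card natr_sum; apply: ler_sum => u; rewrite inE; lra.
Qed.

(** Setting [x] to 1 on [S] and [w] to 0 on the pairs meeting [S] turns the
    solution for [G] into a feasible one for [H], at cost at most [#|S|]. *)
Lemma d_trunc_sensitivity G H (S : {set 'I_n}) :
  simple_graph G -> simple_graph H -> agree_off S G H -> (#|S| <= 1)%N ->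
  d_trunc lp D H <= d_trunc lp D G + 4.
Proof.
move=> sG sH /forallP agree S1.
have {}agree u v : u \notin S -> v \notin S -> G u v = H u v.
  by move=> uS vS; move/forallP: (agree u) => /(_ v); rewrite uS vS => /eqP.
have [wsym x0 w0 wG wD] := feasible sG.
pose y := \row_u (if u \in S then 1 else x G 0 u).
pose v := \matrix_(u, t) (if (u \in S) || (t \in S) then 0 else w G u t).
have feas : lp_feasible D H (y, v).
  split=> [u t|u|u t|u t|u].
  - by rewrite !mxE orbC wsym.
  - by rewrite mxE; case: ifP.
  - by rewrite mxE; case: ifP.
  - rewrite !mxE; have [uS|uS] /= := boolP (u \in S).
      rewrite ler0n andbT; have : 0 <= (if t \in S then 1 else x G 0 t) by case: ifP.
      by case: (H u t) => /=; rewrite ?mulr1n ?mulr0n; lra.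
    have [tS|tS] /= := boolP (t \in S); last by rewrite -(agree u t uS tS).
    by rewrite ler0n andbT; have := x0 u; case: (H u t) => /=; rewrite ?mulr1n ?mulr0n; lra.
  - apply: le_trans (wD u); apply: ler_sum => t _; rewrite mxE.
    by case: ifP.
have := optimal sH feas; rewrite /d_trunc -/(x H) -/(x G) => xH.
rewrite -[X in _ + X]mulr1 -mulrDr ler_pM2l// (le_trans xH)//.
apply: (@le_trans _ _ (\sum_u (x G 0 u + (u \in S)%:R))).
  by apply: ler_sum => u _; rewrite mxE; case: ifP => _; rewrite ?addr0// lerDr.
have SE : \sum_(u < n) (u \in S)%:R = #|S|%:R :> R.
  by rewrite -sum1_card natr_sum [RHS]big_mkcond; apply: eq_bigr => u _; case: ifP.
by rewrite big_split lerD//= SE -[1]/(1%:R) ler_nat.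
Qed.

(** The truncated graphs agree off [S] and the removed nodes of either graph.
    The number of removed nodes is controlled by [heavy_card] and by the
    sensitivity, and each row carries at most [4 * D] differences. *)
Lemma trunc_distance G H (S : {set 'I_n}) :
  simple_graph G -> simple_graph H -> agree_off S G H -> (#|S| <= 1)%N ->
  \sum_u \sum_v `|(trunc lp D G u v)%:R - (trunc lp D H u v)%:R| <=
  8 * D * (5 + 2 * d_trunc lp D G).
Proof.
move=> sG sH agree S1; pose C := S :|: heavy G :|: heavy H.
have Cle : #|C|%:R <= 5 + 2 * d_trunc lp D G.
  have := d_trunc_sensitivity sG sH agree S1.
  have := heavy_card sG; have := heavy_card sH.
  have : #|S|%:R <= 1 :> R by rewrite -[1]/(1%:R) ler_nat.
  have : #|C|%:R <= #|S|%:R + #|heavy G|%:R + #|heavy H|%:R :> R.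
    rewrite -!natrD ler_nat /C.
    by rewrite (leq_trans (leq_card_setU _ _))// leq_add2r leq_card_setU.
  lra.
pose dl u v : R := `|(trunc lp D G u v)%:R - (trunc lp D H u v)%:R|.
have dl_row u : \sum_v dl u v <= 4 * D.
  apply: (@le_trans _ _ (\sum_v ((trunc lp D G u v)%:R + (trunc lp D H u v)%:R))).
    by apply: ler_sum => v _; rewrite (le_trans (ler_normB _ _))// !ger0_norm.
  by rewrite big_split/=; have := trunc_degree u sG; have := trunc_degree u sH; lra.
have dl_sym u v : dl u v = dl v u by rewrite /dl (trunc_sym _ _ sG) (trunc_sym _ _ sH).
have dl_le u v : dl u v <= (u \in C)%:R * dl u v + (v \in C)%:R * dl u v.
  have dl0 : 0 <= dl u v by exact: normr_ge0.
  have [uC|uC] := boolP (u \in C); first by rewrite mul1r lerDl mulr_ge0.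
  have [vC|vC] := boolP (v \in C); first by rewrite mul0r mul1r add0r.
  rewrite !mul0r addr0 /dl !truncE; move: uC vC; rewrite !finset.in_setU !negb_or.
  move=> /andP[/andP[uS -> ->]] /andP[/andP[vS -> ->]].
  by move/forallP: agree => /(_ u)/forallP/(_ v); rewrite uS vS => /eqP ->; rewrite subrr normr0.
have C_row : \sum_u \sum_v (u \in C)%:R * dl u v <= 4 * D * #|C|%:R.
  rewrite -sum1_card natr_sum mulr_sumr [leRHS]big_mkcond/=; apply: ler_sum => u _.
  by rewrite -mulr_sumr; case: ifP => _; rewrite ?mul0r// mulr1 mul1r.
apply: (@le_trans _ _ (\sum_u \sum_v ((u \in C)%:R * dl u v + (v \in C)%:R * dl u v))).
  by apply: ler_sum => u _; apply: ler_sum => v _; exact: dl_le.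
under eq_bigr do rewrite big_split/=.
rewrite big_split/= [X in _ + X]exchange_big/=.
under [X in _ + X]eq_bigr do under eq_bigr do rewrite dl_sym.
have := ler_wpM2l D0 Cle; move: C_row; lra.
Qed.

(** When all degrees are at most [D], the solution [x = 0], [w = G] is
    feasible, hence [x = 0] is the only optimal one. *)
Lemma trunc_low_degree G : simple_graph G ->
  (forall u, \sum_v (G u v)%:R <= D) -> d_trunc lp D G = 0 /\ trunc lp D G = G.
Proof.
move=> sG degG.
have feas : lp_feasible D G (0, map_mx (fun b : bool => b%:R) G).
  split=> [u v|u|u v|u v|u]; rewrite ?mxE//.
  - by rewrite -[in LHS](proj1 sG) mxE.
  - by rewrite !subr0 lexx.
  - rewrite (le_trans _ (degG u))// [leRHS](bigD1 u)//= (proj2 sG) add0r.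
    by apply: ler_sum => v _; rewrite mxE.
have := optimal sG feas; rewrite [leRHS]big1 => [x_le0|u _]; last by rewrite mxE.
have sum0 : \sum_u x G 0 u = 0.
  by apply/eqP; rewrite eq_le x_le0 sumr_ge0// => u _; exact: x_ge0.
have x0 u : x G 0 u = 0.
  have /eqP := sum0; rewrite psumr_eq0 => [/allP/(_ u)|v _]; last exact: x_ge0.
  by rewrite mem_index_enum => /(_ isT)/eqP.
split; first by rewrite /d_trunc -/(x G) sum0 mulr0.
apply/matrixP => u v; rewrite truncE !inE !x0.
have -> : (4^-1 <= 0 :> R) = false by apply/negbTE; rewrite -ltNge.
by rewrite andbT.
Qed.

End Truncation.

(** * Densities, translations and independence *)

Section DensityTransfer.
Context d1 d2 (X : measurableType d1) (Y : measurableType d2) (R : realType).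
Variables (m : {measure set X -> \bar R}) (nu : {measure set Y -> \bar R}).
Variables (phi : X -> Y) (F : X -> R) (c : R).
Hypotheses (mphi : measurable_fun setT phi) (mF : measurable_fun setT F).
Hypothesis F0 : forall x, 0 <= F x.
Hypothesis density : forall V, measurable V ->
  (\int[m]_(x in phi @^-1` V) (F x)%:E = c%:E * nu V)%E.

Import HBNNSimple.

Let simple_case (f : {nnsfun Y >-> R}) :
  (\int[m]_x (F x * f (phi x))%:E = c%:E * \int[nu]_y (f y)%:E)%E.
Proof.
have mpre r : measurable (phi @^-1` (f @^-1` [set r])).
  by rewrite -[X in measurable X]setTI; exact: mphi.
transitivity (\sum_(k \in range f) (\int[m]_x (k%:E * (F x * \1_(phi @^-1` (f @^-1` [set k])) x)%:E))%E).
  rewrite -ge0_integral_fsum//.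
  - apply: eq_integral => x _; rewrite fimfunE mulr_fsumr -fsumEFin//.
    by apply: eq_fsbigr => k _; rewrite -EFinM mulrCA.
  - move=> k; apply: measurable_funeM; apply/measurable_EFinP.
    exact: measurable_funM.
  - move=> k x _; have [k0|k0] := ltP k 0.
      by rewrite preimage_nnfun0// preimage_set0 indicE in_set0 mulr0 mule0.
    by rewrite mule_ge0 ?lee_fin// mulr_ge0.
rewrite integralT_nnsfun sintegralE ge0_mule_fsumr; last first.
  move=> k; have [k0|k0] := ltP k 0; first by rewrite preimage_nnfun0// measure0 mule0.
  by rewrite mule_ge0.
apply: eq_fsbigr => k; rewrite inE => -[y _ <-{k}].
rewrite ge0_integralZl_EFin//; last 2 first.
- by move=> x _; rewrite lee_fin mulr_ge0.
- by apply/measurable_EFinP; exact: measurable_funM.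
rewrite muleCA; congr (_ * _)%E; rewrite -density// [RHS]integral_mkcond.
by apply: eq_integral => x _; rewrite restrict_EFin patch_indic.
Qed.

(** Indicators are the hypothesis, simple functions follow by linearity and
    nonnegative functions by monotone convergence.  The constant [c] lets one
    variable of a product be isolated while the others are integrated out. *)
Lemma density_transfer (f : Y -> \bar R) :
  measurable_fun setT f -> (forall y, (0 <= f y)%E) ->
  (\int[m]_x ((F x)%:E * f (phi x)) = c%:E * \int[nu]_y f y)%E.
Proof.
move=> mf f0; pose f_ := nnsfun_approx measurableT mf.
have f_cvg y : EFin \o f_ ^~ y @ \oo --> f y.
  by apply: cvg_nnsfun_approx => // z _; exact: f0.
have f_nd y : {homo (fun n => f_ n y) : a b / (a <= b)%N >-> a <= b}.
  by move=> a b ab; exact/lefP/nd_nnsfun_approx.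
transitivity (limn (fun n => \int[m]_x (F x * f_ n (phi x))%:E)%E).
  rewrite -monotone_convergence//=.
  - apply: eq_integral => x _; apply/esym/cvg_lim => //=.
    under eq_fun do rewrite EFinM.
    by apply: cvgeZl => //; exact: f_cvg.
  - move=> n; apply/measurable_EFinP; apply: measurable_funM => //.
    exact: measurableT_comp.
  - by move=> n x _; rewrite lee_fin mulr_ge0.
  - by move=> x _ a b ab; rewrite lee_fin ler_wpM2l// f_nd.
under eq_fun do rewrite simple_case.
rewrite limeMl//.
  rewrite -monotone_convergence//=.
  - congr (_ * _)%E; apply: eq_integral => y _; by apply/cvg_lim => //; exact: f_cvg.
  - by move=> n; apply/measurable_EFinP.
  - by move=> n x _; rewrite lee_fin.
  - by move=> x _ a b ab; rewrite lee_fin f_nd.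
apply: ereal_nondecreasing_is_cvgn => a b ab; apply: ge0_le_integral => //=.
- by move=> x _; rewrite lee_fin.
- by apply/measurable_EFinP.
- by apply/measurable_EFinP.
- by move=> x _; rewrite lee_fin f_nd.
Qed.

End DensityTransfer.

Lemma integral_shift (R : realType) (s : R) (f : R -> \bar R) :
  measurable_fun setT f -> (forall x, (0 <= f x)%E) ->
  (\int[lebesgue_measure]_x f (x + s)%R = \int[lebesgue_measure]_x f x)%E.
Proof.
move=> mf f0; pose phi : R -> measurableTypeR R := fun x => x + s.
have mphi : measurable_fun setT phi by exact: measurable_funD.
have -> : (\int[lebesgue_measure]_x f (x + s)%R =
    \int[pushforward lebesgue_measure phi]_x f x)%E.
  by rewrite ge0_integral_pushforward//= => y _; exact: f0.
apply: eq_measure_integral => A mA _.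
apply/esym/lebesgue_measure_unique => //= _ [[a b]] _ <-.
rewrite /pushforward.
have -> : phi @^-1` [set` `]a, b]] = [set` `]a - s, b - s]].
  by apply/seteqP; split=> x /=; rewrite !in_itv/= ltrBlDr lerBrDr.
rewrite !lebesgue_measure_itv/= !lte_fin ltrD2r; case: ifP => // _.
by rewrite -!EFinB opprB addrA subrK.
Qed.

Section Independence.
Context d (T : measurableType d) (R : realType) (P : probability T R).

Lemma mutual_indep_sub (I : finType) (F F' : I -> set (set T)) :
  mutual_indep P F -> (forall i, F' i `<=` F i) -> mutual_indep P F'.
Proof. by move=> indF sub J E EF'; apply: indF => i iJ; apply: sub; exact: EF'. Qed.

(** The expectation of a product of independent nonnegative variables
    factorizes.  The indicators with which the hypothesis starts are replaced
    by arbitrary functions one variable at a time. *)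
Lemma expectation_prod_indep (I : finType) (X : I -> T -> R) (f : I -> R -> R) :
  (forall i, measurable_fun setT (X i)) ->
  (forall i, measurable_fun setT (f i)) -> (forall i x, 0 <= f i x) ->
  (forall i, (\int[P]_w (f i (X i w))%:E < +oo)%E) ->
  mutual_indep P (fun i => events_of (X i)) ->
  (\int[P]_w (\prod_i f i (X i w))%:E = \prod_i \int[P]_w (f i (X i w))%:E)%E.
Proof.
move=> mX mf f0 ffin indX.
suff H (s : seq I) : uniq s -> forall g : I -> R -> R,
    (forall i, i \in s -> g i = f i) ->
    (forall i, i \notin s -> exists2 V, measurable V & g i = \1_V) ->
    (\int[P]_w (\prod_i g i (X i w))%:E = \prod_i \int[P]_w (g i (X i w))%:E)%E.
  apply: (H (enum I)) => [|//|i]; first exact: enum_uniq.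
  by rewrite mem_enum.
have mXpre i V : measurable V -> measurable (X i @^-1` V).
  by move=> mV; rewrite -[X in measurable X]setTI; exact: mX.
have int1 i V : measurable V -> (\int[P]_w (\1_V (X i w))%:E = P (X i @^-1` V))%E.
  move=> mV; have := @integral_indic _ _ _ P setT measurableT _ (mXpre i V mV).
  by rewrite setIT.
elim: s => [_ g _ gV|k s IH /= /andP[ks us] g gf gV].
  have {}gV i := gV i isT.
  pose V i := projT1 (cid2 (gV i)).
  have mV i : measurable (V i) by rewrite /V; case: cid2.
  have gE i : g i = \1_(V i) by rewrite /V; case: cid2.
  under [RHS]eq_bigr do rewrite gE int1//.
  have -> : (\prod_i P (X i @^-1` V i))%E =
      (\prod_(i in [set: I]%SET) P (X i @^-1` V i))%E.
    by apply: eq_bigl => i; rewrite inE.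
  rewrite -indX; last by move=> i _; exists (V i) => //; rewrite setTI.
  pose A := \bigcap_(i in [set` [set: I]%SET]) (X i @^-1` V i).
  have mA : measurable A.
    by apply: fin_bigcap_measurable => // i _; exact: mXpre.
  have := @integral_indic _ _ _ P setT measurableT A mA.
  rewrite setIT => <-; apply: eq_integral => w _; congr EFin.
  under eq_bigr do rewrite gE.
  rewrite indicE; case: (boolP (w \in A)) => /=.
    rewrite inE => Aw; rewrite big1// => i _; rewrite indicE mem_set//.
    by apply: Aw; rewrite /= inE.
  rewrite notin_setE => /existsNP[i /not_implyP[_ wV]].
  by apply/eqP/prodf_eq0; exists i => //; rewrite indicE memNset.
have mg i : measurable_fun setT (g i).
  have [/gf->//|/gV[V mV ->]] := boolP (i \in k :: s); exact: measurable_indic.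
have g0 i x : 0 <= g i x.
  by have [/gf->//|/gV[V mV ->]] := boolP (i \in k :: s).
have gfin i : (\int[P]_w (g i (X i w))%:E < +oo)%E.
  have [/gf->//|/gV[V mV ->]] := boolP (i \in k :: s).
  by rewrite int1// (le_lt_trans (probability_le1 _ _)) ?ltry//; exact: mXpre.
pose F w := \prod_(i | i != k) g i (X i w).
have F0 w : 0 <= F w by exact: prodr_ge0.
have mF : measurable_fun setT F.
  rewrite /F; under eq_fun do rewrite -big_filter.
  by apply: measurable_prod => i _; exact: measurableT_comp.
pose c := (\prod_(i | i != k) \int[P]_w (g i (X i w))%:E)%E.
have cfin : c \is a fin_num.
  apply: (big_ind (fun y => y \is a fin_num)) => // [x y|i _]; first exact: fin_numM.
  by rewrite ge0_fin_numE//; apply: integral_ge0 => w _; rewrite lee_fin.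
have c0 : (0 <= c)%E.
  by apply: prode_ge0 => i _; apply: integral_ge0 => w _; rewrite lee_fin.
rewrite [RHS](bigD1 k)//= -/c muleC -[X in _ = (X * _)%E](fineK cfin).
transitivity (\int[P]_w ((F w)%:E * (g k (X k w))%:E))%E.
  by apply: eq_integral => w _; rewrite (bigD1 k)//= -EFinM mulrC.
pose Xk : {mfun T >-> R} := HB.pack (X k) (isMeasurableFun.Build _ _ _ _ _ (mX k)).
rewrite (@density_transfer _ _ _ _ _ P (pushforward P Xk) (X k) F (fine c)
  _ _ _ _ (EFin \o g k))//; last 3 first.
- move=> V mV; rewrite fineK//.
  pose g' i := if i == k then \1_V else g i.
  have g'k : g' k = \1_V by rewrite /g' eqxx.
  have g'i i : i != k -> g' i = g i by rewrite /g' => /negbTE->.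
  have /= := IH us g'; rewrite (bigD1 k)//= g'k int1//.
  under eq_bigr do rewrite g'i//.
  rewrite -/c muleC => <-.
  - rewrite integral_mkcond; apply: eq_integral => w _.
    rewrite restrict_EFin patch_indic (bigD1 k)//= g'k mulrC.
    by under eq_bigr do rewrite g'i//.
  - by move=> i iS; rewrite g'i ?gf ?inE ?iS ?orbT//; apply: contraNneq ks => <-.
  - move=> i iS; have [->|ik] := eqVneq i k; first by exists V.
    by rewrite g'i//; apply: gV; rewrite inE negb_or ik.
- exact/measurable_EFinP.
- by move=> y; rewrite lee_fin.
by rewrite (ge0_integral_pushforward (mX k))//=; [exact/measurable_EFinP|move=> y _; rewrite lee_fin].
Qed.

End Independence.

(** * Shifts of Gaussian vectors *)

Section ExpDensity.
Context d (T : measurableType d) (R : realType).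
Variables (m : {measure set T -> \bar R}) (f : {mfun T >-> R}).

(** The measure of density [exp f] with respect to [m]. *)
Definition exp_density (V : set T) : \bar R :=
  (\int[m]_(x in V) (expR (f x))%:E)%E.

Let exp_density0 : exp_density set0 = 0%E.
Proof. exact: integral_set0. Qed.

Let exp_density_ge0 V : (0 <= exp_density V)%E.
Proof. by apply: integral_ge0 => x _; rewrite lee_fin expR_ge0. Qed.

Let exp_density_sigma_additive : semi_sigma_additive exp_density.
Proof.
move=> A mA tA mUA; rewrite /exp_density ge0_integral_bigcup//.
- apply: is_cvg_ereal_nneg_natsum_cond => k _ _.
  by apply: integral_ge0 => x _; rewrite lee_fin expR_ge0.
- by apply/measurable_EFinP; apply: measurable_funTS; exact: measurableT_comp.
Qed.

HB.instance Definition _ := isMeasure.Build _ _ _ exp_density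
  exp_density0 exp_density_ge0 exp_density_sigma_additive.

End ExpDensity.

Section StandardNormal.
Context d (T : measurableType d) (R : realType) (P : probability T R).
Variable X : {RV P >-> R}.
Hypothesis normalX : forall V : set R, measurable V ->
  distribution P X V = normal_prob 0 1 V.
Implicit Types f : R -> \bar R.

Let mpdf : measurable_fun setT (normal_pdf 0 1 : R -> R).
Proof. exact: measurable_normal_pdf. Qed.

Let pdf0 (x : R) : 0 <= normal_pdf 0 1 x.
Proof. exact: normal_pdf_ge0. Qed.

Lemma integral_std_normal f : measurable_fun setT f -> (forall x, (0 <= f x)%E) ->
  (\int[P]_w f (X w) = \int[lebesgue_measure]_x ((normal_pdf 0 1 x)%:E * f x))%E.
Proof.
move=> mf f0.
rewrite (@density_transfer _ _ _ _ _ lebesgue_measure (distribution P X) idfun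
  (normal_pdf 0 1) 1 _ _ _ _ f)//; first last.
- by move=> V mV; rewrite mul1e; exact/esym/normalX.
- exact: measurable_id.
by rewrite mul1e ge0_integral_distribution.
Qed.

Lemma normal_pdf_shift (t x : R) :
  normal_pdf 0 1 (x - t) = normal_pdf 0 1 x * expR (t * x - t ^+ 2 / 2).
Proof.
rewrite !normal_pdfE ?oner_neq0//= /normal_fun -mulrA -expRD; congr (_ * expR _).
by rewrite !subr0 expr1n; field.
Qed.

Lemma std_normal_shift f t : measurable_fun setT f -> (forall x, (0 <= f x)%E) ->
  (\int[P]_w f (X w + t)%R =
   \int[P]_w ((expR (t * X w - t ^+ 2 / 2))%:E * f (X w)))%E.
Proof.
move=> mf f0.
have mexp : measurable_fun setT (fun x : R => expR (t * x - t ^+ 2 / 2)).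
  by apply: measurableT_comp => //; apply: measurable_funB => //; exact: measurable_funM.
rewrite (@integral_std_normal (fun x => f (x + t)))//; last first.
  by apply: measurableT_comp => //; exact: measurable_funD.
rewrite (@integral_std_normal (fun x => (expR (t * x - t ^+ 2 / 2))%:E * f x)%E); last 2 first.
- by apply: emeasurable_funM => //; exact/measurable_EFinP.
- by move=> x; rewrite mule_ge0// lee_fin expR_ge0.
transitivity (\int[lebesgue_measure]_x ((normal_pdf 0 1 (x - t))%:E * f x))%E.
  rewrite -(@integral_shift _ t (fun x => (normal_pdf 0 1 (x - t))%:E * f x)%E).
  - by apply: eq_integral => x _; rewrite addrK.
  - apply: emeasurable_funM => //; apply/measurable_EFinP.
    by apply: measurableT_comp => //; exact: measurable_funB.
  - by move=> x; rewrite mule_ge0// lee_fin.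
by apply: eq_integral => x _; rewrite normal_pdf_shift EFinM muleA.
Qed.

End StandardNormal.

(** The space of matrices with the sigma-algebra generated by boxes, a
    pi-system; it is the Borel sigma-algebra. *)
Section MatrixSpace.
Context {R : realType} {n : nat}.

Definition box (V : 'I_n -> 'I_n -> set R) : set 'M[R]_n :=
  [set M | forall i j, V i j (M i j)].

Definition boxes : set (set 'M[R]_n) :=
  [set C | exists2 V, (forall i j, measurable (V i j)) & C = box V].

Definition mxspace := g_sigma_algebraType boxes.

Lemma boxes_setI : setI_closed boxes.
Proof.
move=> _ _ [V mV ->] [W mW ->]; exists (fun i j => V i j `&` W i j).
  by move=> i j; exact: measurableI.
apply/seteqP; split=> M /=; first by move=> [MV MW] i j; split; [exact: MV|exact: MW].
by move=> MVW; split=> i j; have [] := MVW i j.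
Qed.

Lemma boxes_setT : boxes setT.
Proof. by exists (fun _ _ => setT) => //; apply/seteqP; split. Qed.

Lemma borel_mx_measurable (C : set 'M[R]_n) :
  borel_mx C -> measurable (C : set mxspace).
Proof.
apply: sub_sigma_algebra2 => _ [i [j [V [mV ->]]]].
exists (fun k l => if (k == i) && (l == j) then V else setT) => [k l|].
  by case: ifP.
apply/seteqP; split=> M /= => [Vij k l|/(_ i j)]; last by rewrite !eqxx.
by case: ifP => // /andP[/eqP-> /eqP->].
Qed.

Lemma measurable_mxspace d (T : measurableType d) (M : T -> 'M[R]_n) :
  (forall i j, measurable_fun setT (fun w => M w i j)) ->
  measurable_fun setT (M : T -> mxspace).
Proof.
move=> mM; apply: (@measurability _ _ _ mxspace setT M boxes) => //.
move=> _ [_ [V mV ->] <-]; rewrite setTI.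
have -> : M @^-1` box V = \bigcap_(p in [set: 'I_n * 'I_n])
    ((fun w => M w p.1 p.2) @^-1` V p.1 p.2).
  apply/seteqP; split=> w /= => [Vw [i j] _|Vw i j]; first exact: Vw.
  exact: (Vw (i, j)).
apply: fin_bigcap_measurable => [|[i j] _]; first exact: finite_finset.
by rewrite -[X in measurable X]setTI; exact: mM.
Qed.

Lemma measurable_mxspace_entry i j :
  measurable_fun setT (fun M : mxspace => (M : 'M[R]_n) i j).
Proof.
move=> _ V mV; rewrite setTI; apply: borel_mx_measurable.
by apply: sub_sigma_algebra; exists i, j, V.
Qed.

Lemma mxspace_measure_unique (m1 m2 : {measure set mxspace -> \bar R}) :
  (m1 setT < +oo)%E ->
  (forall V, (forall i j, measurable (V i j)) -> m1 (box V) = m2 (box V)) ->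
  forall C, measurable C -> m1 C = m2 C.
Proof.
move=> m1oo m12 C mC.
apply: (@measure_unique _ _ mxspace boxes (fun=> setT)) => //.
- exact: boxes_setI.
- by move=> _; exact: boxes_setT.
- by rewrite bigcup_const//; exists 0%N.
- by move=> _ [V mV ->]; exact: m12.
Qed.

End MatrixSpace.
Arguments mxspace : clear implicits.

Section GaussianMatrix.
Context d (T : measurableType d) (R : realType) (P : probability T R) (n : nat).
Variable g : 'I_n -> 'I_n -> {RV P >-> R}.
Hypothesis normal_g : forall i j (V : set R), measurable V ->
  distribution P (g i j) V = normal_prob 0 1 V.
Hypothesis indep_g : mutual_indep P
  (fun p : 'I_n * 'I_n => events_of (g p.1 p.2 : T -> R)).

Let M (w : T) : 'M[R]_n := \matrix_(i, j) g i j w.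

(** The logarithm of the density of the law of [M + h] with respect to the law
    of [M], at [M]. *)
Definition log_density (h : 'M[R]_n) (w : T) : R :=
  \sum_(p : 'I_n * 'I_n) (h p.1 p.2 * g p.1 p.2 w - h p.1 p.2 ^+ 2 / 2).

Lemma measurable_log_density h : measurable_fun setT (log_density h).
Proof.
by apply: measurable_sum => p; apply: measurable_funB => //; exact: measurable_funM.
Qed.

Lemma measurable_shifted_matrix h : measurable_fun setT ((fun w => M w + h) : T -> mxspace R n).
Proof.
apply: measurable_mxspace => i j.
rewrite (_ : (fun w => _) = (fun w => g i j w + h i j)); last first.
  by apply/funext => w; rewrite !mxE.
exact: measurable_funD.
Qed.

Lemma measurable_gauss_matrix : measurable_fun setT (M : T -> mxspace R n).
Proof.
apply: measurable_mxspace => i j.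
by rewrite (_ : (fun w => _) = g i j)//; apply/funext => w; rewrite mxE.
Qed.

Let prod_expectation (f : 'I_n * 'I_n -> R -> R) :
  (forall p, measurable_fun setT (f p)) -> (forall p x, 0 <= f p x) ->
  (forall p, (\int[P]_w (f p (g p.1 p.2 w))%:E < +oo)%E) ->
  (\int[P]_w (\prod_p f p (g p.1 p.2 w))%:E =
   \prod_p \int[P]_w (f p (g p.1 p.2 w))%:E)%E.
Proof. by move=> mf f0 ffin; apply: (expectation_prod_indep _ mf f0 ffin indep_g). Qed.

(** The two sides are finite measures in [C], so it suffices to compare them on
    boxes, where both factorize by independence and each factor is the shift
    formula for one standard normal variable. *)
Lemma gauss_shift h (C : set 'M[R]_n) : measurable (C : set (mxspace R n)) ->
  P [set w | C (M w + h)] = (\int[P]_(w in M @^-1` C) (expR (log_density h w))%:E)%E.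
Proof.
pose L : {mfun T >-> R} :=
  HB.pack (log_density h) (isMeasurableFun.Build _ _ _ _ _ (measurable_log_density h)).
pose Mh : T -> mxspace R n := fun w => M w + h.
pose M0 : T -> mxspace R n := M.
have mMh : measurable_fun setT Mh by exact: measurable_shifted_matrix.
have mM0 : measurable_fun setT M0 by exact: measurable_gauss_matrix.
pose mMh_pack : {mfun T >-> mxspace R n} := HB.pack Mh (isMeasurableFun.Build _ _ _ _ _ mMh).
pose mM0_pack : {mfun T >-> mxspace R n} := HB.pack M0 (isMeasurableFun.Build _ _ _ _ _ mM0).
move=> mC.
have H : forall C : set (mxspace R n), measurable C ->
    pushforward P mMh_pack C = pushforward (exp_density P L) mM0_pack C.
  apply: mxspace_measure_unique => [|V mV].
    change (P (Mh @^-1` setT) < +oo)%E.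
    by rewrite preimage_setT probability_setT ltry.
  change (P (Mh @^-1` box V) = exp_density P L (M0 @^-1` box V)).
  pose f (p : 'I_n * 'I_n) (x : R) : R :=
    expR (h p.1 p.2 * x - h p.1 p.2 ^+ 2 / 2) * \1_(V p.1 p.2) x.
  pose s (p : 'I_n * 'I_n) (x : R) : R := \1_(V p.1 p.2) (x + h p.1 p.2).
  have ms p : measurable_fun setT (s p).
    rewrite (_ : s p = \1_(V p.1 p.2) \o (fun x => x + h p.1 p.2))//.
    by apply: measurableT_comp; [exact: measurable_indic|exact: measurable_funD].
  have mf p : measurable_fun setT (f p).
    apply: measurable_funM; last exact: measurable_indic.
    by apply: measurableT_comp => //; apply: measurable_funB => //; exact: measurable_funM.
  have fs p : (\int[P]_w (f p (g p.1 p.2 w))%:E = \int[P]_w (s p (g p.1 p.2 w))%:E)%E.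
    have := @std_normal_shift _ _ _ P (g p.1 p.2) (normal_g p.1 p.2)
      (EFin \o \1_(V p.1 p.2)) (h p.1 p.2).
    move=> H; apply/esym; rewrite [LHS]H.
    - by apply: eq_integral => w _; rewrite -EFinM.
    - by apply/measurable_EFinP; exact: measurable_indic.
    - by move=> x; rewrite lee_fin.
  have s_fin p : (\int[P]_w (s p (g p.1 p.2 w))%:E < +oo)%E.
    apply: (@le_lt_trans _ _ (\int[P]_w 1)%E); last first.
      rewrite integral_cst// mul1e; apply: (le_lt_trans (probability_le1 P measurableT)).
      exact: ltry.
    apply: ge0_le_integral => //.
    - by move=> w _; rewrite lee_fin.
    - by apply/measurable_EFinP; exact: measurableT_comp.
    - by move=> w _; rewrite lee_fin /s indicE; case: (_ \in _).
  transitivity (\int[P]_w (\prod_p s p (g p.1 p.2 w))%:E)%E.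
    rewrite -[X in P X]setIT -integral_indic//; last first.
      rewrite -[X in measurable X]setTI; apply: (mMh measurableT).
      by apply: sub_sigma_algebra; exists V.
    apply: eq_integral => w _; congr EFin; rewrite indicE.
    case: (boolP (w \in _)) => /=.
      rewrite inE => /= Vw; rewrite big1// => p _; rewrite /s indicE mem_set//.
      by have := Vw p.1 p.2; rewrite /Mh !mxE.
    rewrite notin_setE => /= Vw; apply/esym/eqP/prodf_eq0.
    apply: contrapT => noV; apply: Vw => i j; apply: contrapT => ijV.
    apply: noV; exists (i, j) => //; rewrite /s indicE memNset//=.
    by move: ijV; rewrite /Mh !mxE.
  rewrite prod_expectation//.
  under eq_bigr do rewrite -fs.
  rewrite -prod_expectation//; first last.
  - by move=> p; rewrite fs.
  - by move=> p x; rewrite mulr_ge0// expR_ge0.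
  rewrite /exp_density [RHS]integral_mkcond.
  apply: eq_integral => w _; rewrite restrict_EFin patch_indic/=; congr EFin.
  rewrite /f big_split/= -expR_sum -/(log_density h w); congr (_ * _).
  rewrite indicE; case: (boolP (w \in _)) => /=.
    rewrite inE => /= Vw; rewrite big1// => p _; rewrite indicE mem_set//.
    by have := Vw p.1 p.2; rewrite /M0 !mxE.
  rewrite notin_setE => /= Vw; apply/eqP/prodf_eq0.
  apply: contrapT => noV; apply: Vw => i j; apply: contrapT => ijV.
  apply: noV; exists (i, j) => //; rewrite indicE memNset//=.
  by move: ijV; rewrite /M0 !mxE.
exact: (H C mC).
Qed.

Lemma gauss_exp_moment h : (\int[P]_w (expR (log_density h w))%:E = 1)%E.
Proof.
have := @gauss_shift h setT measurableT; rewrite preimage_setT => <-.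
by rewrite -[RHS](probability_setT P); congr (P _); apply/seteqP; split.
Qed.

(** The density of the shifted law has second moment [expR (frobenius_sq h)],
    so by Markov's inequality it rarely exceeds [expR a]. *)
Lemma gauss_shift_bound (h : 'M[R]_n) (a : R) (C : set 'M[R]_n) : measurable (C : set (mxspace R n)) ->
  (P [set w | C (M w + h)%R] <=
   (expR a)%:E * P [set w | C (M w)] + (expR (frobenius_sq h - a))%:E)%E.
Proof.
move=> mC; rewrite gauss_shift//; set A := M @^-1` C.
have mA : measurable A.
  by rewrite -[A]setTI; exact: measurable_gauss_matrix.
have log_density2 w : 2 * log_density h w = log_density (2 *: h) w + frobenius_sq h.
  rewrite /log_density /frobenius_sq mulr_sumr (pair_bigA _ (fun i j => h i j ^+ 2))/=.
  by rewrite -big_split; apply: eq_bigr => p _; rewrite !mxE/=; field.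
have mE c : measurable_fun setT (fun w => (expR (log_density c w))%:E).
  apply/measurable_EFinP; apply: measurableT_comp => //.
  exact: measurable_log_density.
apply: (@le_trans _ _ (\int[P]_(w in A) ((expR a)%:E +
    (expR (frobenius_sq h - a) )%:E * (expR (log_density (2 *: h) w))%:E))%E).
  apply: ge0_le_integral => //.
  - exact: measurable_funTS.
  - apply: emeasurable_funD => //; apply: measurable_funeM.
    exact: measurable_funTS.
  - move=> w _; rewrite -EFinM -EFinD lee_fin -expRD.
    set l := log_density h w; have -> : frobenius_sq h - a + log_density (2 *: h) w = 2 * l - a.
      by rewrite log_density2; ring.
    have [la|al] := leP l a; first by rewrite ler_wpDr ?expR_ge0// ler_expR.
    by rewrite ler_wpDl ?expR_ge0// ler_expR; move: al; lra.
rewrite ge0_integralD//; last first.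
  by apply: measurable_funeM; exact: measurable_funTS.
rewrite integral_cst// leeD2l// ge0_integralZl_EFin ?expR_ge0//; last first.
  exact: measurable_funTS.
rewrite -[leRHS]mule1 lee_wpmul2l ?lee_fin ?expR_ge0//.
rewrite -(gauss_exp_moment (2 *: h)); exact: ge0_subset_integral.
Qed.

End GaussianMatrix.

(** * Laplace noise *)

Section Laplace.
Context {R : realType}.
Variable b : R.
Hypothesis b0 : 0 < b.

Lemma laplace_pdf_ge0 x : 0 <= laplace_pdf b x.
Proof. by rewrite divr_ge0 ?expR_ge0// mulr_ge0// ltW. Qed.

Lemma measurable_laplace_pdf : measurable_fun setT (laplace_pdf b).
Proof.
apply: measurable_funM => //; apply: measurableT_comp => //.
by apply: measurable_funM => //; apply: measurableT_comp => //; exact: measurableT_comp.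
Qed.

Lemma laplace_pdf_shift s x :
  laplace_pdf b x <= expR (`|s| / b) * laplace_pdf b (x + s).
Proof.
rewrite /laplace_pdf [leRHS]mulrA -expRD ler_pM2r ?invr_gt0 ?mulr_gt0//.
rewrite ler_expR -mulrDl ler_pM2r ?invr_gt0//.
by have := ler_normD x s; lra.
Qed.

End Laplace.

Section LaplaceVariable.
Context d (T : measurableType d) (R : realType) (P : probability T R).
Variables (Z : {RV P >-> R}) (b : R).
Hypothesis b0 : 0 < b.
Hypothesis laplaceZ : forall V : set R, measurable V ->
  distribution P Z V = laplace_prob b V.

Lemma integral_laplace (f : R -> \bar R) :
  measurable_fun setT f -> (forall x, (0 <= f x)%E) ->
  (\int[P]_w f (Z w) = \int[lebesgue_measure]_x ((laplace_pdf b x)%:E * f x))%E.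
Proof.
move=> mf f0.
rewrite (@density_transfer _ _ _ _ _ lebesgue_measure (distribution P Z) idfun
  (laplace_pdf b) 1 _ _ _ _ f)//; first last.
- by move=> V mV; rewrite mul1e; exact/esym/laplaceZ.
- exact: laplace_pdf_ge0.
- exact: measurable_laplace_pdf.
- exact: measurable_id.
by rewrite mul1e ge0_integral_distribution.
Qed.

(** The density and its translate differ by a factor at most
    [expR (`|s| / b)]. *)
Lemma laplace_shift_le (f : R -> \bar R) s :
  measurable_fun setT f -> (forall x, (0 <= f x)%E) ->
  (\int[P]_w f (Z w + s)%R <= (expR (`|s| / b))%:E * \int[P]_w f (Z w))%E.
Proof.
move=> mf f0; rewrite (@integral_laplace (fun x => f (x + s)))//; last first.
  by apply: measurableT_comp => //; exact: measurable_funD.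
rewrite integral_laplace//.
rewrite -(@integral_shift _ s (fun x => (laplace_pdf b x)%:E * f x)%E); last 2 first.
- by apply: emeasurable_funM => //; apply/measurable_EFinP; exact: measurable_laplace_pdf.
- by move=> x; rewrite mule_ge0// lee_fin laplace_pdf_ge0.
have msh : measurable_fun setT (fun x : R => (laplace_pdf b (x + s))%:E * f (x + s)%R)%E.
  apply: emeasurable_funM => //.
    apply/measurable_EFinP; apply: measurableT_comp; last exact: measurable_funD.
    exact: measurable_laplace_pdf.
  by apply: measurableT_comp => //; exact: measurable_funD.
rewrite -ge0_integralZl_EFin ?expR_ge0//; last first.
  by move=> x _; rewrite mule_ge0// lee_fin laplace_pdf_ge0.
apply: ge0_le_integral => //.
- by move=> x _; rewrite mule_ge0// lee_fin laplace_pdf_ge0.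
- apply: emeasurable_funM; first by apply/measurable_EFinP; exact: measurable_laplace_pdf.
  by apply: measurableT_comp => //; exact: measurable_funD.
- exact: measurable_funeM.
- by move=> x _; rewrite muleA lee_wpmul2r// -EFinM lee_fin laplace_pdf_shift.
Qed.

(** On a half-line the density is exactly proportional to its translate, whose
    total mass is 1. *)
Let laplace_tail (A : set R) s : measurable A ->
  (forall x, A x -> laplace_pdf b x = expR (- `|s| / b) * laplace_pdf b (x + s)) ->
  (P [set w | A (Z w)] <= (expR (- `|s| / b))%:E)%E.
Proof.
move=> mA Atail.
have mAs : measurable_fun setT (fun x : R => (\1_A x : R)%:E).
  by apply/measurable_EFinP; exact: measurable_indic.
have As0 x : (0 <= (\1_A x : R)%:E)%E by rewrite lee_fin.
have -> : P [set w | A (Z w)] = (\int[P]_w (\1_A (Z w) : R)%:E)%E.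
  have mZA : measurable (Z @^-1` A).
    by rewrite -[X in measurable X]setTI; exact: measurable_funPT.
  by have := @integral_indic _ _ _ P setT measurableT _ mZA; rewrite setIT.
rewrite (@integral_laplace (fun x => (\1_A x)%:E))//.
have mlap c : measurable_fun setT (fun x : R => (laplace_pdf b (x + c))%:E).
  apply/measurable_EFinP; apply: measurableT_comp; last exact: measurable_funD.
  exact: measurable_laplace_pdf.
apply: (@le_trans _ _ (\int[lebesgue_measure]_x ((expR (- `|s| / b))%:E * (laplace_pdf b (x + s))%:E))%E).
  apply: ge0_le_integral => //.
  - by move=> x _; rewrite mule_ge0// lee_fin laplace_pdf_ge0.
  - apply: emeasurable_funM => //; by apply/measurable_EFinP; exact: measurable_laplace_pdf.
  - by apply: measurable_funeM; exact: mlap.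
  - move=> x _; rewrite -!EFinM lee_fin indicE; case: (boolP (x \in A)) => /= xA.
      by rewrite mulr1 Atail//; rewrite inE in xA.
    by rewrite mulr0 mulr_ge0 ?expR_ge0// laplace_pdf_ge0.
rewrite ge0_integralZl_EFin ?expR_ge0//; last 2 first.
- by move=> x _; rewrite lee_fin laplace_pdf_ge0.
- exact: mlap.
have total : (\int[lebesgue_measure]_x (laplace_pdf b x)%:E = 1)%E.
  have := @integral_laplace (cst 1%E) (measurable_cst _) (fun=> lee01).
  rewrite (eq_integral (cst 1%E))// integral_cst// mul1e => H.
  transitivity (P setT); last exact: probability_setT.
  by rewrite [RHS]H; apply: eq_integral => x _; rewrite mule1.
rewrite [X in (_ * X)%E](_ : _ = 1%E) ?mule1// -[RHS]total.
apply: (@integral_shift _ s (EFin \o laplace_pdf b)).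
  by apply/measurable_EFinP; exact: measurable_laplace_pdf.
by move=> x; rewrite lee_fin laplace_pdf_ge0.
Qed.

Lemma laplace_lower_tail t : 0 <= t -> (P [set w | Z w < - t]%R <= (expR (- t / b))%:E)%E.
Proof.
move=> t0; rewrite -[in leRHS](ger0_norm t0).
have -> : [set w | Z w < - t] = [set w | [set x | x < - t] (Z w)] by [].
apply: laplace_tail => [|x /= xt].
  have -> : [set x | x < - t] = `]-oo, - t[%classic.
    by apply/seteqP; split=> x /=; rewrite in_itv.
  exact: measurable_itv.
rewrite /laplace_pdf mulrA -expRD (ger0_norm t0) !ler0_norm; first by congr (expR _ / _); ring.
  by move: xt; lra.
by move: xt t0; lra.
Qed.

Lemma laplace_upper_tail t : 0 <= t -> (P [set w | Z w > t]%R <= (expR (- t / b))%:E)%E.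
Proof.
move=> t0; rewrite -[in leRHS](ger0_norm t0) -[in leRHS]normrN.
have -> : [set w | Z w > t] = [set w | [set x | x > t] (Z w)] by [].
apply: laplace_tail => [|x /= xt].
  have -> : [set x | x > t] = `]t, +oo[%classic.
    by apply/seteqP; split=> x /=; rewrite in_itv/= andbT.
  exact: measurable_itv.
rewrite /laplace_pdf mulrA -expRD normrN (ger0_norm t0) !ger0_norm; first by congr (expR _ / _); ring.
  by move: xt; lra.
by move: xt t0; lra.
Qed.

End LaplaceVariable.

(** * Joint law of the noise *)

Lemma mutual_indep_reindex d (T : measurableType d) (R : realType)
    (P : probability T R) (I J : finType) (e : J -> I) (F : I -> set (set T)) :
  injective e -> mutual_indep P F -> mutual_indep P (F \o e).
Proof.
move=> einj indF K E EF.
pose E' i := if [pick j | e j == i] is Some j then E j else setT.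
have E'e j : E' (e j) = E j.
  rewrite /E'; case: pickP => [j' /eqP/einj->//|/(_ j)]; by rewrite eqxx.
have := indF [set e j | j in K]%SET E'.
rewrite big_imset/=; last by move=> j j' _ _; exact: einj.
under eq_bigr do rewrite E'e.
move=> <-; last by move=> _ /imsetP[j jK ->]; rewrite E'e; exact: EF.
congr (P _); apply/seteqP; split=> w /= Ew i.
  by move=> /imsetP[j jK ->]; rewrite E'e; exact: Ew.
by move=> iK; rewrite -E'e; apply: Ew; apply/imsetP; exists i.
Qed.

Section JointNoise.
Context d (T : measurableType d) (R : realType) (P : probability T R) (n : nat).
Variables (Z : {RV P >-> R}) (g : 'I_n -> 'I_n -> {RV P >-> R}) (b : R).
Variable A : T -> 'M[bool]_n.
Hypothesis b0 : 0 < b.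
Hypothesis noise : independent_noise A b Z g.

Let M (w : T) : 'M[R]_n := \matrix_(i, j) g i j w.

Lemma noise_laplace V : measurable V -> distribution P Z V = laplace_prob b V.
Proof. by case: noise => + _ _; apply. Qed.

Lemma noise_normal i j V : measurable V -> distribution P (g i j) V = normal_prob 0 1 V.
Proof. by case: noise => _ + _; apply. Qed.

Lemma noise_indep_normal :
  mutual_indep P (fun p : 'I_n * 'I_n => events_of (g p.1 p.2 : T -> R)).
Proof.
case: noise => _ _ /(mutual_indep_reindex (e := @inr bool _)) H.
by apply: (mutual_indep_sub (H _)) => [p q []//|[i j]].
Qed.

Let noise_indep_option : mutual_indep P (fun o : option ('I_n * 'I_n) =>
  if o is Some p then events_of (g p.1 p.2 : T -> R) else events_of (Z : T -> R)).
Proof.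
pose e (o : option ('I_n * 'I_n)) : bool + 'I_n * 'I_n :=
  if o is Some p then inr p else inl false.
case: noise => _ _ /(mutual_indep_reindex (e := e)) H.
by apply: (mutual_indep_sub (H _)) => [[p|] [q|]//[]->//|[[i j]|]].
Qed.

Let mM : measurable_fun setT (M : T -> mxspace R n).
Proof. exact: measurable_gauss_matrix. Qed.

Let indep_box (U : set R) V : measurable U -> (forall i j, measurable (V i j)) ->
  P (Z @^-1` U `&` M @^-1` box V) = (P (Z @^-1` U) * P (M @^-1` box V))%E.
Proof.
move=> mU mV.
pose E (o : option ('I_n * 'I_n)) :=
  if o is Some p then g p.1 p.2 @^-1` V p.1 p.2 else Z @^-1` U.
have Eev o : (if o is Some p then events_of (g p.1 p.2 : T -> R)
    else events_of (Z : T -> R)) (E o).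
  by case: o => [p|]; [exists (V p.1 p.2) => //|exists U => //]; rewrite setTI.
have boxE : M @^-1` box V = \bigcap_(o in [set` [set~ None]%SET]) E o.
  apply/seteqP; split=> w /= Vw.
    by case=> [[i j]|]; rewrite /= !inE//= => _; have := Vw i j; rewrite !mxE.
  by move=> i j; rewrite mxE; apply: (Vw (Some (i, j))); rewrite /= !inE.
have allE : Z @^-1` U `&` M @^-1` box V = \bigcap_(o in [set` [set: option ('I_n * 'I_n)]%SET]) E o.
  rewrite boxE; apply/seteqP; split=> w /=.
    by move=> [Uw Vw] [p|] _//; apply: (Vw (Some p)); rewrite /= !inE.
  move=> Ew; split; first by apply: (Ew None); rewrite /= inE.
  by move=> o _; apply: Ew; rewrite /= inE.
rewrite allE boxE !noise_indep_option => [|o _|o _]; [|exact: Eev|exact: Eev].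
rewrite (bigD1 (None : option ('I_n * 'I_n)))/= ?inE//; congr (_ * _)%E.
by apply: eq_bigl => o; rewrite !inE.
Qed.

(** For fixed [U] both sides are finite measures in [C]; they agree on boxes. *)
Lemma noise_indep (U : set R) (C : set (mxspace R n)) : measurable U -> measurable C ->
  P (Z @^-1` U `&` M @^-1` C) = (P (Z @^-1` U) * P (M @^-1` C))%E.
Proof.
move=> mU.
have mZU : measurable (Z @^-1` U).
  by rewrite -[X in measurable X]setTI; exact: measurable_funPT.
have pfin : P (Z @^-1` U) \is a fin_num by rewrite fin_num_measure.
have p0 : 0 <= fine (P (Z @^-1` U)) by exact: fine_ge0.
pose M0 : T -> mxspace R n := M.
pose M0_pack : {mfun T >-> mxspace R n} := HB.pack M0 (isMeasurableFun.Build _ _ _ _ _ mM).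
move=> mC; have H := @mxspace_measure_unique R n (pushforward (mrestr P mZU) M0_pack)
  (mscale (NngNum p0) (pushforward P M0_pack)).
suff E : P (M @^-1` C `&` Z @^-1` U) = ((fine (P (Z @^-1` U)))%:E * P (M @^-1` C))%E.
  by rewrite setIC E fineK.
apply: (H mM mM _ _ C mC) => [|V mV].
  change (P (M0 @^-1` setT `&` Z @^-1` U) < +oo)%E.
  rewrite preimage_setT setTI; apply: (le_lt_trans (probability_le1 P mZU)).
  exact: ltry.
change (P (M0 @^-1` box V `&` Z @^-1` U) =
  ((fine (P (Z @^-1` U)))%:E * P (M0 @^-1` box V))%E).
by rewrite setIC fineK//; exact: indep_box.
Qed.

Let M0 : T -> mxspace R n := M.
Let M0_pack : {mfun T >-> mxspace R n} := HB.pack M0 (isMeasurableFun.Build _ _ _ _ _ mM).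

Let section_law (F : set (R * mxspace R n)) (z : R) : P [set w | F (z, M w)] =
  distribution P M0_pack (xsection F z).
Proof.
rewrite /distribution/= /pushforward; congr (P _).
by apply/seteqP; split=> w /=; rewrite /xsection/= inE.
Qed.

Lemma measurable_noise_section (F : set (R * mxspace R n)) : measurable F ->
  measurable_fun setT (fun z => P [set w | F (z, M w)]).
Proof.
move=> mF; under eq_fun do rewrite section_law.
exact: (measurable_fun_xsection (distribution P M0_pack)).
Qed.

(** The joint law of the noise is the product of its marginals, so the Laplace
    variable can be conditioned on. *)
Lemma noise_joint (F : set (R * mxspace R n)) : measurable F ->
  P [set w | F (Z w, M w)] = (\int[P]_w (P [set w' | F (Z w, M w')]))%E.
Proof.
move=> mF; pose ZM w : R * mxspace R n := (Z w, M0 w).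
have mZM : measurable_fun setT ZM by exact: measurable_fun_pair.
pose ZM_pack : {mfun T >-> (R * mxspace R n)%type} :=
  HB.pack ZM (isMeasurableFun.Build _ _ _ _ _ mZM).
have prodE := @product_measure_unique _ _ R (mxspace R n) R
  (distribution P Z) (distribution P M0_pack) (distribution P ZM_pack).
have -> : P [set w | F (Z w, M w)] = distribution P ZM_pack F by [].
rewrite -prodE//; last first.
  by move=> U C mU mC; exact: noise_indep.
rewrite /product_measure1 ge0_integral_pushforward//=.
  rewrite preimage_setT; apply: eq_integral => w _.
  by rewrite section_law.
exact: (measurable_fun_xsection (distribution P M0_pack)).
Qed.

(** If, conditionally on a value [z >= - t] of the Laplace variable, the event
    [F1] is controlled by the event [F2] at the shifted value [z + s], then
    [F1] is controlled by [F2]: the shift costs a factor [expR (`|s| / b)], and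
    values below [- t] are rare. *)
Lemma shifted_noise_comparison (F1 F2 : set (R * mxspace R n)) (s t a kappa : R) :
  measurable F1 -> measurable F2 -> 0 <= t -> 0 <= kappa ->
  (forall z, - t <= z -> (P [set w | F1 (z, M w)] <=
     (expR a)%:E * P [set w | F2 ((z + s)%R, M w)] + kappa%:E)%E) ->
  (P [set w | F1 (Z w, M w)] <=
     (expR (a + `|s| / b))%:E * P [set w | F2 (Z w, M w)] +
     (kappa + expR (- t / b))%:E)%E.
Proof.
move=> mF1 mF2 t0 k0 F12; rewrite !noise_joint//.
pose phi1 z := P [set w | F1 (z, M w)]; pose phi2 z := P [set w | F2 (z, M w)].
have mphi1 : measurable_fun setT phi1 by exact: measurable_noise_section.
have mphi2 : measurable_fun setT phi2 by exact: measurable_noise_section.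
have phi2_0 z : (0 <= phi2 z)%E by [].
have mtail : measurable [set w | Z w < - t].
  have -> : [set w | Z w < - t] = Z @^-1` `]-oo, - t[.
    by apply/seteqP; split=> x /=; rewrite in_itv.
  by rewrite -[X in measurable X]setTI; exact: measurable_funPT.
have mphi2s : measurable_fun setT (fun w => phi2 (Z w + s)).
  apply: (measurableT_comp mphi2); exact: measurable_funD.
apply: (@le_trans _ _ (\int[P]_w (((expR a)%:E * phi2 (Z w + s)%R + kappa%:E) +
    (\1_[set w | Z w < - t] w)%:E))%E).
  apply: ge0_le_integral => //.
  - exact: (measurableT_comp mphi1).
  - apply: emeasurable_funD; first by apply: emeasurable_funD => //; exact: measurable_funeM.
    by apply/measurable_EFinP; exact: measurable_indic.
  - move=> w _; have [Zt|Zt] := leP (- t) (Z w).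
      by rewrite -[leLHS]adde0 leeD ?F12// lee_fin.
    rewrite indicE mem_set//= -[leLHS]add0e leeD//.
      by rewrite adde_ge0 ?mule_ge0 ?lee_fin ?expR_ge0.
    rewrite section_law; apply: probability_le1.
    exact: measurable_xsection.
have m1 : measurable_fun setT (fun w => (expR a)%:E * phi2 (Z w + s)%R)%E.
  exact: measurable_funeM.
have p1 w : (0 <= (expR a)%:E * phi2 (Z w + s)%R)%E.
  by rewrite mule_ge0// lee_fin expR_ge0.
rewrite ge0_integralD//; last 3 first.
- by move=> w _; rewrite adde_ge0.
- exact: emeasurable_funD.
- by apply/measurable_EFinP; exact: measurable_indic.
rewrite ge0_integralD// integral_cst// integral_indic// setIT.
rewrite [X in (_ * X)%E](_ : _ = 1%E) ?mule1; last exact: probability_setT.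
rewrite EFinD [leRHS]addeA; apply: leeD; last exact: (laplace_lower_tail b0 noise_laplace).
apply: leeD => //.
rewrite ge0_integralZl_EFin ?expR_ge0// expRD EFinM -muleA lee_wpmul2l ?lee_fin ?expR_ge0//.
exact: (laplace_shift_le b0 noise_laplace).
Qed.

End JointNoise.

(** * Degrees and cut norm of the stochastic block model *)

(** From [expR (- x) >= 1 - x], as [(1 + x + 2 * x ^+ 2) * (1 - x) >= 1]. *)
Lemma expR_le_quadratic (R : realType) (x : R) : x <= 2^-1 ->
  expR x <= 1 + x + 2 * x ^+ 2.
Proof.
move=> x2; have := expR_ge1Dx (- x); have := expRN x; have := expR_gt0 x.
set e := expR x => e0 ->.
rewrite -[in X in _ -> X](@ler_pM2r _ e^-1) ?invr_gt0// divff ?gt_eqF//.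
move=> e1; have : (1 + x + 2 * x ^+ 2) * (1 - x) <= (1 + x + 2 * x ^+ 2) * e^-1.
  rewrite ler_wpM2l//; have := sqr_ge0 (x + 4^-1); nra.
apply: le_trans; have := mulr_ge0 (sqr_ge0 x) (_ : 0 <= 1 - 2 * x); nra.
Qed.

Section Tails.
Context d (T : measurableType d) (R : realType) (P : probability T R).

Lemma measurable_gt (f : T -> R) (s : R) : measurable_fun setT f ->
  measurable [set w | s < f w].
Proof.
move=> mf; have -> : [set w | s < f w] = f @^-1` `]s, +oo[.
  by apply/seteqP; split=> x /=; rewrite in_itv/= andbT.
by rewrite -[X in measurable X]setTI; exact: mf.
Qed.

Lemma exp_Markov (f : T -> R) (s : R) : measurable_fun setT f ->
  (P [set w | (s < f w)%R] <= (expR (- s))%:E * \int[P]_w (expR (f w))%:E)%E.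
Proof.
move=> mf.
have mE : measurable_fun setT (fun w => (expR (f w))%:E).
  by apply/measurable_EFinP; exact: measurableT_comp.
have mA : measurable [set w | s < f w] by exact: measurable_gt.
rewrite -ge0_integralZl_EFin ?expR_ge0//.
rewrite -[X in P X]setIT -integral_indic//; apply: ge0_le_integral => //.
- by apply/measurable_EFinP; exact: measurable_indic.
- exact: measurable_funeM.
- move=> w _; rewrite -EFinM lee_fin -expRD indicE.
  case: (boolP (w \in _)) => /=; last by rewrite expR_ge0.
  by rewrite inE/= => sf; rewrite -[leLHS]expR0 ler_expR; lra.
Qed.

Lemma union_bound (I : finType) (E : I -> set T) (r : R) :
  (forall i, measurable (E i)) -> (forall i, (P (E i) <= r%:E)%E) ->
  (P (\bigcup_(i in [set: I]) E i) <= (#|I|%:R * r)%:E)%E.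
Proof.
move=> mE Er.
have -> : \bigcup_(i in [set: I]) E i = \big[setU/set0]_(i <- enum I) E i.
  by rewrite -bigcup_seq; apply/seteqP; split=> w [i _ Ew]; exists i => //=; rewrite mem_enum.
rewrite cardE; elim: (enum I) => [|i s IH].
  by rewrite big_nil measure0 mul0r.
rewrite big_cons /= -natr1 mulrDl mul1r EFinD addeC.
have mU : measurable (\big[setU/set0]_(j <- s) E j) by apply: bigsetU_measurable => j _; exact: mE.
by apply: (le_trans (measureU2 _ (mE i) mU)); exact: (leeD (Er i) IH).
Qed.

End Tails.

Section Edges.
Context d (T : measurableType d) (R : realType) (P : probability T R).
Variables (n : nat) (A : T -> 'M[bool]_n) (p : 'I_n -> 'I_n -> R) (q : R).
Let edge := {e : 'I_n * 'I_n | (e.1 < e.2)%N}.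
Hypothesis simpleA : forall w, simple_graph (A w).
Hypothesis mA : forall i j, measurable_fun setT (fun w => A w i j).
Hypothesis edgeA : forall i j : 'I_n, (i < j)%N -> P [set w | A w i j] = (p i j)%:E.
Hypothesis indepA : mutual_indep P (fun e : edge =>
  events_of (fun w => A w (val e).1 (val e).2)).
Hypothesis p_sym : forall i j, p i j = p j i.
Hypothesis p_ge0 : forall i j, 0 <= p i j.
Hypothesis p_le : forall i j, p i j <= q.
Implicit Types c : 'I_n -> 'I_n -> R.

Let X (e : edge) (w : T) : R := (A w (val e).1 (val e).2)%:R.

Let mA_edge i j : measurable [set w | A w i j].
Proof.
have -> : [set w | A w i j] = (fun w => A w i j) @^-1` [set true].
  by apply/seteqP; split=> w /= ->.
by rewrite -[X in measurable X]setTI; exact: mA.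
Qed.

Let mA_real i j : measurable_fun setT (fun w => (A w i j)%:R : R).
Proof.
rewrite (_ : (fun w => _) = \1_[set w | A w i j]); first exact: measurable_indic.
apply/funext => w; rewrite indicE; congr ((nat_of_bool _)%:R).
by apply/idP/idP => [Aw|]; rewrite ?inE// mem_set.
Qed.

Let mX e : measurable_fun setT (X e).
Proof. exact: mA_real. Qed.

Let edge_exp (e : edge) (x : R) :
  (\int[P]_w (expR (x * X e w))%:E =
   (1 + p (val e).1 (val e).2 * (expR x - 1))%:E)%E.
Proof.
pose E := [set w | A w (val e).1 (val e).2]; set pe := p _ _.
have mE : measurable E by exact: mA_edge.
have mEc : measurable (~` E) by exact: measurableC.
have PE : P E = pe%:E by rewrite edgeA//; exact: (valP e).
transitivity (\int[P]_w ((expR x)%:E * (\1_E w)%:E + (\1_(~` E) w)%:E))%E.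
  apply: eq_integral => w _; rewrite -EFinM -EFinD; congr EFin.
  rewrite !indicE in_setC /X; have -> : (w \in E) = A w (val e).1 (val e).2.
    by apply/idP/idP => [|Aw]; rewrite ?inE// mem_set.
  by case: (A w _ _); rewrite /= ?mulr1 ?mulr0 ?addr0 ?add0r// expR0.
rewrite ge0_integralD//; first last.
- by apply/measurable_EFinP; exact: measurable_indic.
- by apply: measurable_funeM; apply/measurable_EFinP; exact: measurable_indic.
rewrite ge0_integralZl_EFin ?expR_ge0//; last first.
  by apply/measurable_EFinP; exact: measurable_indic.
rewrite !integral_indic// !setIT.
rewrite [X in (_ + X)%E](_ : _ = (1 - pe%:E)%E); last first.
  by rewrite -PE; exact: probability_setC.
rewrite [X in (_ * X)%E](_ : _ = pe%:E)//.
by rewrite -EFinM -EFinB -EFinD; congr EFin; ring.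
Qed.

(** Exponential Markov inequality and independence of the edges; each factor of
    the moment generating function is bounded by
    [1 + p * (c + 2 * c ^+ 2) <= expR (p * (c + 2 * c ^+ 2))]. *)
Let edge_tail (c : edge -> R) s : (forall e, c e <= 2^-1) ->
  (P [set w | (s < \sum_e c e * (X e w - p (val e).1 (val e).2))%R] <=
   (expR (2 * (\sum_e p (val e).1 (val e).2 * c e ^+ 2) - s))%:E)%E.
Proof.
move=> c2; pose pe (e : edge) := p (val e).1 (val e).2.
pose Y w := \sum_e c e * X e w; pose m := \sum_e c e * pe e.
have YE w : \sum_e c e * (X e w - pe e) = Y w - m.
  by rewrite /Y /m -sumrB; apply: eq_bigr => e _; rewrite mulrBr.
have mY : measurable_fun setT Y.
  by apply: measurable_sum => e; exact: measurable_funM.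
have -> : [set w | s < \sum_e c e * (X e w - pe e)] = [set w | s + m < Y w].
  by apply/seteqP; split=> w /=; rewrite YE ltrBrDr.
apply: le_trans; first by exact: (@exp_Markov _ _ _ P Y (s + m) mY).
have prodE : (\int[P]_w (expR (Y w))%:E = \prod_e (1 + pe e * (expR (c e) - 1))%:E)%E.
  under eq_bigr do rewrite -edge_exp.
  rewrite -(@expectation_prod_indep _ _ _ P _ X (fun e x => expR (c e * x)))//.
  - by apply: eq_integral => w _; rewrite expR_sum.
  - by move=> e; apply: measurableT_comp => //; exact: measurable_funM.
  - by move=> e; rewrite edge_exp ltry.
  - apply: (mutual_indep_sub indepA) => e _ [V mV <-].
    exists ((fun b : bool => b%:R : R) @^-1` V) => //.
rewrite prodE prodEFin -EFinM lee_fin.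
rewrite (_ : 2 * _ - s = - (s + m) + \sum_e (c e * pe e + 2 * (pe e * c e ^+ 2))); last first.
  by rewrite big_split/= -mulr_sumr -/m; ring.
rewrite [leRHS]expRD ler_wpM2l ?expR_ge0// expR_sum.
apply: ler_prod => e _; apply/andP; split.
  by rewrite -lee_fin -edge_exp; apply: integral_ge0 => w _; rewrite lee_fin expR_ge0.
apply: le_trans (expR_ge1Dx _); rewrite lerD2l.
have := expR_le_quadratic (c2 e); have := p_ge0 (val e).1 (val e).2.
rewrite -/(pe e); nra.
Qed.

Let edge_sum (H : 'I_n -> 'I_n -> R) : (forall i, H i i = 0) ->
  \sum_i \sum_j H i j = \sum_(e : edge) (H (val e).1 (val e).2 + H (val e).2 (val e).1).
Proof.
move=> H0; rewrite pair_bigA/= (bigID (fun r : 'I_n * 'I_n => (r.1 < r.2)%N))/= big_split/=.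
have edges (K : 'I_n * 'I_n -> R) :
    \sum_(r : 'I_n * 'I_n | (r.1 < r.2)%N) K r = \sum_(e : edge) K (val e).
  rewrite (reindex_omap (val : edge -> _) insub)/=; last first.
    by move=> r ltr; rewrite insubT.
  by apply: eq_bigl => e; rewrite (valP e) valK eqxx.
rewrite (edges (fun r => H r.1 r.2)) -(edges (fun r => H r.2 r.1)); congr (_ + _).
rewrite (bigID (fun r : 'I_n * 'I_n => r.1 == r.2))/= big1 ?add0r; last first.
  by move=> [i j] /= /andP[_ /eqP->].
rewrite (reindex_inj (h := fun r : 'I_n * 'I_n => (r.2, r.1)))/=; last first.
  by move=> [i j] [k l] [-> ->].
apply: eq_bigl => -[i j] /=; rewrite -leqNgt ltn_neqAle andbC; congr (_ && _).
by rewrite eq_sym.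
Qed.

Let sum_edge_le : \sum_(e : edge) p (val e).1 (val e).2 <= n%:R * (n%:R * q).
Proof.
pose H i j := if i == j then 0 else p i j.
have H_ge0 i j : 0 <= H i j by rewrite /H; case: ifP.
apply: (@le_trans _ _ (\sum_i \sum_j H i j)).
  rewrite edge_sum => [|i]; last by rewrite /H eqxx.
  apply: ler_sum => e _; rewrite -[leLHS]addr0 lerD// /H.
  by case: eqP => // ee; have := valP e; rewrite ee ltnn.
apply: (@le_trans _ _ (\sum_(i < n) n%:R * q)); last first.
  by rewrite sumr_const card_ord -[leLHS]mulr_natl.
apply: ler_sum => i _; apply: (@le_trans _ _ (\sum_(j < n) q)); last first.
  by rewrite sumr_const card_ord -[leLHS]mulr_natl.
apply: ler_sum => j _; rewrite /H; case: ifP => // _.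
exact: le_trans (p_ge0 i j) (p_le i j).
Qed.

(** [edge_tail] for the edges at [i], with exponent 1/2: the exponent is at most
    [n * q / 2 + n * q / 2 - 3 / 2 * (n * q)]. *)
Lemma degree_tail i : (P [set w | (3 * (n%:R * q) < \sum_j (A w i j)%:R)%R] <=
  (expR (- (n%:R * q / 2)))%:E)%E.
Proof.
pose t (e : edge) : R := ((val e).1 == i)%:R + ((val e).2 == i)%:R.
have tt e : t e * t e = t e.
  rewrite /t; have := valP e; case: eqVneq => [->|_] ei; case: eqVneq => [ej|_]; rewrite ?addr0 ?add0r ?mulr1 ?mulr0//.
  by move: ei; rewrite ej ltnn.
have t2 e : 2^-1 * t e <= 2^-1.
  have /eqP := tt e; rewrite -subr_eq0 -[X in _ - X]mulr1 -mulrBr mulf_eq0 subr_eq0.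
  by move=> /orP[] /eqP->; rewrite ?mulr0 ?mulr1.
have sum_t (S : 'I_n -> 'I_n -> R) : (forall a b, S a b = S b a) -> S i i = 0 ->
    \sum_j S i j = \sum_(e : edge) t e * S (val e).1 (val e).2.
  move=> S_sym Sii; pose H a b := (a == i)%:R * S a b.
  transitivity (\sum_a \sum_b H a b).
    rewrite [RHS](bigD1 i)//= [X in _ + X]big1 ?addr0 => [|a /negbTE ai].
      by apply: eq_bigr => b _; rewrite /H eqxx mul1r.
    by rewrite big1// => b _; rewrite /H ai mul0r.
  rewrite edge_sum => [|a]; last first.
    by rewrite /H; case: eqVneq => [->|_]; rewrite ?Sii ?mulr0 ?mul0r.
  by apply: eq_bigr => e _; rewrite /H (S_sym (val e).2) -mulrDl.
have degE w : \sum_j (A w i j)%:R = \sum_(e : edge) t e * X e w.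
  apply: (sum_t (fun a b => (A w a b)%:R)) => [a b|]; last by rewrite (proj2 (simpleA w)).
  by rewrite -[in LHS](proj1 (simpleA w)) mxE.
have tp : \sum_(e : edge) t e * p (val e).1 (val e).2 <= n%:R * q.
  pose S a b := if a == b then 0 else p a b.
  have -> : \sum_(e : edge) t e * p (val e).1 (val e).2 = \sum_j S i j.
    rewrite (sum_t S) => [|a b|]; last by rewrite /S eqxx.
      apply: eq_bigr => e _; rewrite /S; case: eqP => // ee.
      by have := valP e; rewrite ee ltnn.
    by rewrite /S eq_sym p_sym.
  apply: (@le_trans _ _ (\sum_(j < n) q)); last by rewrite sumr_const card_ord -[leLHS]mulr_natl.
  apply: ler_sum => j _; rewrite /S; case: ifP => // _; exact: le_trans (p_ge0 i j) (p_le i j).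
have := edge_tail (n%:R * q) t2.
set u := \sum_e p _ _ * _; have -> : u = 4^-1 * \sum_(e : edge) t e * p (val e).1 (val e).2.
  rewrite /u mulr_sumr; apply: eq_bigr => e _.
  by rewrite exprMn [t e ^+ 2]expr2 tt; field.
move=> tail; apply: le_trans; last (apply: le_trans; first exact: tail).
  apply: le_measure; rewrite ?inE.
  - by apply: measurable_gt; apply: measurable_sum => j; exact: mA_real.
  - by apply: measurable_gt; apply: measurable_sum => e; apply: measurable_funM => //;
       apply: measurable_funB.
  - move=> w /=; rewrite degE => deg; under eq_bigr do rewrite mulrBr -!mulrA.
    by rewrite sumrB -!mulr_sumr; move: deg tp; lra.
by rewrite lee_fin ler_expR; move: tp; lra.
Qed.

(** [edge_tail] with exponent [1 / (4 * sqrt (n * q))].  The constant 14 leaves a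
    tail of [expR (- 3 * n)], which survives a union bound over the [4 ^ n] pairs
    of sign vectors. *)
Lemma cut_tail (x y : {ffun 'I_n -> bool}) : 1 <= n%:R * q ->
  (P [set w | (14 * n%:R * Num.sqrt (n%:R * q) <
     \sum_i \sum_j (if i == j then 0 else (A w i j)%:R - p i j) *
       ((-1) ^+ x i * (-1) ^+ y j))%R] <= (expR (- (3 * n%:R)))%:E)%E.
Proof.
set dg := n%:R * q => dg1; pose r := Num.sqrt dg.
have r1 : 1 <= r by rewrite -[leLHS]sqrtr1 ler_wsqrtr.
have rr : r ^+ 2 = dg by rewrite sqr_sqrtr// (le_trans ler01).
have r0 : 0 < r by exact: lt_le_trans r1.
pose c (e : edge) : R := (-1) ^+ x (val e).1 * (-1) ^+ y (val e).2 +
  (-1) ^+ x (val e).2 * (-1) ^+ y (val e).1.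
have c_le e : `|c e| <= 2.
  rewrite (le_trans (ler_normD _ _))// !normrM !normr_sign !mulr1; lra.
pose l := (4 * r)^-1.
have l0 : 0 < l by rewrite invr_gt0 mulr_gt0.
have lr : l * r = 4^-1 by rewrite /l; field; rewrite gt_eqF.
have l4 : l <= 4^-1 by rewrite lef_pV2 ?posrE ?mulr_gt0//; move: r1; lra.
have lc e : l * c e <= 2^-1.
  have := c_le e; rewrite ler_norml => /andP[_ +]; move: l0 l4; nra.
have sumE w : \sum_i \sum_j (if i == j then 0 else (A w i j)%:R - p i j) *
       ((-1) ^+ x i * (-1) ^+ y j) =
    \sum_(e : edge) c e * (X e w - p (val e).1 (val e).2).
  rewrite edge_sum => [|i]; last by rewrite eqxx mul0r.
  apply: eq_bigr => e _; have ne : ((val e).1 == (val e).2) = false.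
    by apply/eqP => ee; have := valP e; rewrite ee ltnn.
  rewrite ne eq_sym ne (p_sym (val e).2) /c /X.
  have -> : A w (val e).2 (val e).1 = A w (val e).1 (val e).2.
    by rewrite -[in LHS](proj1 (simpleA w)) mxE.
  ring.
have tail := edge_tail (l * (14 * n%:R * r)) lc.
apply: le_trans; last (apply: le_trans; first exact: tail).
  apply: le_measure; rewrite ?inE.
  - under eq_set do rewrite sumE.
    by apply: measurable_gt; apply: measurable_sum => e; apply: measurable_funM => //;
       apply: measurable_funB.
  - by apply: measurable_gt; apply: measurable_sum => e; apply: measurable_funM => //;
       apply: measurable_funB.
  - move=> w /=; rewrite sumE => big; under eq_bigr do rewrite -mulrA.
    by rewrite -mulr_sumr ltr_pM2l.
rewrite lee_fin ler_expR.
have -> : l * (14 * n%:R * r) = 14 / 4 * n%:R 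
  by transitivity (14 * n%:R * (l * r)); [ring|rewrite lr; field].
have : \sum_e p (val e).1 (val e).2 * (l * c e) ^+ 2 <= 4 * l ^+ 2 * (n%:R * dg).
  apply: (@le_trans _ _ (4 * l ^+ 2 * \sum_(e : edge) p (val e).1 (val e).2)).
    rewrite mulr_sumr; apply: ler_sum => e _; rewrite mulrC ler_wpM2r// exprMn.
    rewrite mulrC ler_wpM2r ?sqr_ge0// -[c e ^+ 2]real_normK ?num_real//.
    rewrite (_ : 4 = 2 ^+ 2); last by ring.
    by rewrite ler_sqr ?nnegrE.
  apply: ler_wpM2l; last exact: sum_edge_le.
  by rewrite mulr_ge0// sqr_ge0.
have -> : 4 * l ^+ 2 * (n%:R * dg) = 4^-1 * n%:R.
  by rewrite -rr; transitivity (4 * (l * r) ^+ 2 * n%:R); [ring|rewrite lr; field].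
have : 0 <= n%:R :> R by [].
lra.
Qed.

End Edges.

(** * Operator norm of a Gaussian matrix *)

Section Grid.
Context {R : realType} {n : nat}.
Hypothesis n0 : (0 < n)%N.

(** Points with coordinates in [(8 sqrt n)^-1 Z], of absolute value at most
    [sqrt n]; the grid is fine enough to be a (1/8)-net of the unit ball. *)
Definition grid_point (k : {ffun 'I_n -> 'I_(16 * n).+1}) : 'cV[R]_n :=
  \col_i (((k i)%:R - (8 * n)%:R) / (8 * Num.sqrt n%:R)).

Lemma grid_approx (u : 'cV[R]_n) : sqn u <= 1 ->
  exists k, sqn (u - grid_point k) <= 64^-1.
Proof.
move=> u1; pose r : R := Num.sqrt n%:R.
have r1 : 1 <= r by rewrite -[leLHS]sqrtr1 ler_wsqrtr// -[1]/(1%:R) ler_nat.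
have rr : r ^+ 2 = n%:R by rewrite sqr_sqrtr.
have r0 : 0 < r by exact: lt_le_trans r1.
have rn : r <= n%:R by rewrite -rr; move: r1; nra.
have ui i : `|u i 0| <= 1.
  rewrite -ler_sqr ?nnegrE// real_normK ?num_real// expr1n (le_trans _ u1)//.
  by rewrite /sqn (bigD1 i)//= lerDl; apply: sumr_ge0 => j _; exact: sqr_ge0.
pose t i := 8 * r * u i 0 + (8 * n)%:R.
have t0 i : 0 <= t i.
  by rewrite /t natrM; have := ui i; rewrite ler_norml => /andP[+ _]; move: r0 rn; nra.
have tn i : t i <= (16 * n)%:R.
  by rewrite /t !natrM; have := ui i; rewrite ler_norml => /andP[_ +]; move: r0 rn; nra.
pose f i := Num.truncn (t i).
have fP i : (f i)%:R <= t i < (f i).+1%:R by exact: truncn_itv.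
have fn i : (f i < (16 * n).+1)%N.
  by rewrite ltnS -(ler_nat R); have /andP[] := fP i; move=> h _; exact: le_trans h (tn i).
exists [ffun i => Ordinal (fn i)].
apply: (@le_trans _ _ (\sum_(i < n) (64 * r ^+ 2)^-1)); last first.
  rewrite sumr_const card_ord -[leLHS]mulr_natl -rr invfM mulrCA divff ?mulr1//.
  by rewrite sqrf_eq0 gt_eqF.
apply: ler_sum => i _; rewrite !mxE ffunE/=.
have -> : u i 0 - ((f i)%:R - (8 * n)%:R) / (8 * r) = (t i - (f i)%:R) / (8 * r).
  by rewrite /t; field; rewrite gt_eqF.
rewrite exprMn exprVn (_ : (8 * r) ^+ 2 = 64 * r ^+ 2); last by ring.
rewrite -[leRHS]mul1r ler_pM2r; last by rewrite invr_gt0 mulr_gt0// exprn_gt0.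
have /andP[] := fP i; rewrite -natr1 => h1 h2.
have : 0 <= t i - (f i)%:R by lra.
have : t i - (f i)%:R <= 1 by lra.
nra.
Qed.

(** Replacing two vectors of the unit ball by grid points changes the bilinear
    form by at most half of its supremum over the unit ball. *)
Lemma bilinear_grid_bound (G : 'M[R]_n) (tau : R) :
  (forall k l, sqn (grid_point k) <= 2 -> sqn (grid_point l) <= 2 ->
     dot (grid_point k) (G *m grid_point l) <= tau) ->
  op_norm_le G (2 * tau).
Proof.
move=> grid.
pose S := [set r | exists u v : 'cV[R]_n, [/\ sqn u <= 1, sqn v <= 1 & r = dot u (G *m v)]].
have S0 : S 0.
  exists 0, 0; split; rewrite ?mulmx0 ?/sqn ?/dot big1// ?ler01// => i _; rewrite !mxE ?expr0n ?mulr0//.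
have Sub : has_sup S.
  split; first by exists 0.
  exists (1 + frobenius_sq G) => _ [u [v [u1 v1 ->]]].
  have := dot_sq_le u (G *m v).
  have Gv : sqn (G *m v) <= frobenius_sq G.
    rewrite /sqn /frobenius_sq; apply: ler_sum => i _; rewrite mxE.
    rewrite (le_trans (sum_Cauchy_Schwarz _ _))// ler_piMr//.
    by apply: sumr_ge0 => j _; exact: sqr_ge0.
  have := sqn_ge0 u; have := sqn_ge0 (G *m v); move: u1 Gv; nra.
pose s := sup S.
have s_ub u v : sqn u <= 1 -> sqn v <= 1 -> dot u (G *m v) <= s.
  by move=> u1 v1; apply: ub_le_sup; [case: Sub|exists u, v].
have s0 : 0 <= s by apply: ub_le_sup; [case: Sub|].
have near_norm (u y : 'cV[R]_n) : sqn u <= 1 -> sqn (u - y) <= 64^-1 -> sqn y <= 81 / 64.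
  move=> u1 uy; have -> : y = 1 *: u + (-1) *: (u - y).
    by rewrite scaleN1r scale1r opprB addrC subrK.
  rewrite sqn_lin; have := dot_sq_le u (u - y).
  set a := dot _ _; have := sqn_ge0 (u - y); have := sqn_ge0 u => p1 p2 a2.
  have : a ^+ 2 <= 8^-1 ^+ 2 by rewrite (le_trans a2)//; move: p1 p2 u1 uy; nra.
  by rewrite -[a ^+ 2]real_normK ?num_real// ler_sqr ?nnegrE// ler_norml => /andP[? ?]; lra.
have stau : s <= tau + s / 2.
  apply: ge_sup; first by case: Sub.
  move=> _ [u [v [u1 v1 ->]]].
  have [k uk] := grid_approx u1; have [l vl] := grid_approx v1.
  set y := grid_point k in uk *; set z := grid_point l in vl *.
  have y2 := near_norm _ _ u1 uk; have z2 := near_norm _ _ v1 vl.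
  have yz : dot y (G *m z) <= tau by apply: grid; [move: y2|move: z2]; lra.
  have e1 : dot (8 *: (u - y)) (G *m v) <= s.
    by apply: s_ub => //; rewrite sqnZ; move: uk; lra.
  have e2 : dot ((8 / 9) *: y) (G *m (8 *: (v - z))) <= s.
    by apply: s_ub; rewrite sqnZ; [move: y2|move: vl]; lra.
  move: e1 e2; rewrite -scalemxAr dotZ ![dot (_ *: _) _]dotC !dotZ mulmxBr.
  rewrite ![dot (G *m _ - _) _]dotC ![dot (G *m _) _]dotC.
  have dotB (a b c : 'cV[R]_n) : dot a (b - c) = dot a b - dot a c.
    by rewrite -scaleN1r dotD dotZ mulN1r.
  rewrite !dotB ![dot (u - y) _]dotC !dotB ![dot (G *m v) _]dotC.
  lra.
have {}stau : s <= 2 * tau by lra.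
move=> v; set e := sqn (G *m v).
have [v0|v0] := eqVneq v 0.
  have z : sqn (0 : 'cV[R]_n) = 0 by rewrite /sqn big1// => i _; rewrite mxE expr0n.
  by rewrite /e v0 mulmx0 z mulr0.
have q0 : 0 < sqn v.
  by rewrite lt_def sqn_ge0 andbT; apply: contra v0 => /eqP/sqn_eq0 ->.
have [e0|e0] := eqVneq e 0; first by rewrite e0 mulr_ge0 ?sqr_ge0// ltW.
have {}e0 : 0 < e by rewrite lt_def e0 sqn_ge0.
have := s_ub ((Num.sqrt e)^-1 *: (G *m v)) ((Num.sqrt (sqn v))^-1 *: v).
have ee : Num.sqrt e ^+ 2 = e by rewrite sqr_sqrtr// ltW.
have qq : Num.sqrt (sqn v) ^+ 2 = sqn v by rewrite sqr_sqrtr// ltW.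
rewrite !sqnZ !exprVn ee qq -/e !mulVf ?gt_eqF// => /(_ (lexx _) (lexx _)).
rewrite -scalemxAr dotZ dotC dotZ dotvv -/e => se.
have se' : Num.sqrt e <= 2 * tau * Num.sqrt (sqn v).
  rewrite -ler_pdivrMr ?sqrtr_gt0// (le_trans _ stau)// (le_trans _ se)//.
  rewrite mulrC; apply: ler_wpM2l; first by rewrite invr_ge0 sqrtr_ge0.
  by rewrite -{3}ee expr2 mulKf// gt_eqF// sqrtr_gt0.
rewrite -ee -[X in _ * X]qq -exprMn.
by rewrite ler_sqr ?nnegrE ?sqrtr_ge0// mulr_ge0 ?sqrtr_ge0//; move: stau s0; lra.
Qed.

End Grid.

Section GaussianOperatorNorm.
Context d (T : measurableType d) (R : realType) (P : probability T R) (n : nat).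
Variable g : 'I_n -> 'I_n -> {RV P >-> R}.
Hypothesis normal_g : forall i j (V : set R), measurable V ->
  distribution P (g i j) V = normal_prob 0 1 V.
Hypothesis indep_g : mutual_indep P
  (fun p : 'I_n * 'I_n => events_of (g p.1 p.2 : T -> R)).
Hypothesis n2 : (2 <= n)%N.

Let M (w : T) : 'M[R]_n := \matrix_(i, j) g i j w.

Let form (y z : 'cV[R]_n) w : R := dot y (M w *m z).

Let formE (y z : 'cV[R]_n) w : form y z w =
  \sum_(p : 'I_n * 'I_n) y p.1 0 * z p.2 0 * g p.1 p.2 w.
Proof.
rewrite /form /dot -(pair_bigA _ (fun i j => y i 0 * z j 0 * g i j w))/=.
apply: eq_bigr => i _; rewrite mxE mulr_sumr; apply: eq_bigr => j _.
by rewrite mxE; ring.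
Qed.

Let measurable_form y z : measurable_fun setT (form y z).
Proof.
rewrite (_ : form y z = fun w => \sum_(p : 'I_n * 'I_n) y p.1 0 * z p.2 0 * g p.1 p.2 w).
  by apply: measurable_sum => p; exact: measurable_funM.
by apply/funext => w; rewrite formE.
Qed.

(** The moment generating function of the form is computed by the Gaussian
    shift by the rank one matrix [l *: (y *m z^T)]; [tau / 4] is the optimal
    exponent for variance 4. *)
Let form_tail y z tau : sqn y <= 2 -> sqn z <= 2 -> 0 < tau ->
  (P [set w | (tau < form y z w)%R] <= (expR (- (tau ^+ 2 / 8)))%:E)%E.
Proof.
move=> y2 z2 tau0; pose l := tau / 4.
have l0 : 0 < l by rewrite divr_gt0.
pose h : 'M[R]_n := \matrix_(i, j) (l * (y i 0 * z j 0)).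
have hE w : log_density g h w = l * form y z w - l ^+ 2 * (sqn y * sqn z) / 2.
  rewrite formE /log_density sumrB mulr_sumr; congr (_ - _).
    by apply: eq_bigr => p _; rewrite mxE; ring.
  rewrite /sqn mulr_suml mulr_sumr mulr_suml.
  rewrite -(pair_bigA _ (fun i j => h i j ^+ 2 / 2))/=; apply: eq_bigr => i _.
  rewrite mulr_sumr mulr_sumr mulr_suml; apply: eq_bigr => j _.
  by rewrite mxE; ring.
have mlog : measurable_fun setT (log_density g h) by exact: measurable_log_density.
apply: (@le_trans _ _ (P [set w | (l * tau - 2 * l ^+ 2 < log_density g h w)%R])).
  apply: le_measure; rewrite ?inE; [exact: measurable_gt|exact: measurable_gt|].
  move=> w /= tw; rewrite hE.
  have : l * tau < l * form y z w by rewrite ltr_pM2l.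
  have : sqn y * sqn z <= 4.
    by have := sqn_ge0 y; have := sqn_ge0 z; move: y2 z2; nra.
  by have := sqr_ge0 l; nra.
apply: le_trans; first by exact: (@exp_Markov _ _ _ P _ (l * tau - 2 * l ^+ 2) mlog).
rewrite (gauss_exp_moment normal_g indep_g) mule1 lee_fin ler_expR.
by rewrite /l; lra.
Qed.

(** Union bound over the pairs of grid points, of which there are at most
    [expR (12 * n * ln n)]. *)
Lemma gauss_op_norm : exists E : set T, [/\ measurable E,
  (P E <= (n%:R^-1)%:E)%E &
  forall w, ~ E w -> op_norm_le (M w) (24 * Num.sqrt (n%:R * ln n%:R))].
Proof.
have n0 : (0 < n)%N by exact: ltn_trans n2.
have nR : 0 < n%:R :> R by rewrite ltr0n.
have ln0 : 0 < ln n%:R :> R by rewrite ln_gt0// ltr1n.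
pose s : R := n%:R * ln n%:R.
have s0 : 0 < s by rewrite mulr_gt0.
pose tau := 12 * Num.sqrt s.
have tau0 : 0 < tau by rewrite mulr_gt0// sqrtr_gt0.
have tau2 : tau ^+ 2 / 8 = 18 * s.
  by rewrite /tau exprMn sqr_sqrtr ?ltW//; field.
pose K := {ffun 'I_n -> 'I_(16 * n).+1}.
pose bad (kl : K * K) : set T :=
  if (sqn (grid_point kl.1 : 'cV[R]_n) <= 2) && (sqn (grid_point kl.2 : 'cV[R]_n) <= 2)
  then [set w | tau < form (grid_point kl.1) (grid_point kl.2) w] else set0.
have mbad kl : measurable (bad kl).
  by rewrite /bad; case: ifP => // _; apply: measurable_gt; exact: measurable_form.
exists (\bigcup_(kl in [set: K * K]) bad kl); split.
- by apply: fin_bigcup_measurable => //; exact: finite_finset.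
- have bad_le kl : (P (bad kl) <= (expR (- (18 * s)))%:E)%E.
    rewrite /bad; case: ifP => [/andP[k2 l2]|_]; last by rewrite measure0 lee_fin expR_ge0.
    by rewrite -tau2; exact: form_tail.
  apply: (le_trans (union_bound mbad bad_le)); rewrite lee_fin.
  have card_le : #|{: K * K}|%:R <= expR (12 * s) :> R.
    rewrite card_prod !card_ffun !card_ord -expnD natrX.
    have : (16 * n).+1%:R <= expR (6 * ln n%:R) :> R.
      rewrite (expRM_natl 6) lnK ?posrE// -natrX ler_nat.
      apply: (@leq_trans (2 ^ 5 * n)%N); first by lia.
      by rewrite [(n ^ 6)%N]expnSr leq_mul2r leq_exp2r// n2 orbT.
    move=> N_le; apply: (@le_trans _ _ (expR (6 * ln n%:R) ^+ (n + n))).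
      by rewrite lerXn2r// ?nnegrE ?expR_ge0.
    by rewrite -(expRM_natl (n + n)) ler_expR natrD /s; lra.
  apply: (@le_trans _ _ (expR (12 * s) * expR (- (18 * s)))).
    by rewrite ler_wpM2r// expR_ge0.
  rewrite -expRD -[n%:R^-1]lnK ?posrE ?invr_gt0// ler_expR lnV ?posrE//.
  have n1 : 1 <= n%:R :> R by rewrite -[leLHS]/(1%:R) ler_nat.
  have : ln n%:R <= s by rewrite /s ler_peMl// ltW.
  by move: ln0; lra.
- move=> w Ew; rewrite (_ : 24 * _ = 2 * tau); last by rewrite /tau /s; ring.
  apply: (bilinear_grid_bound n0) => k l k2 l2; rewrite leNgt; apply/negP => kl.
  by apply: Ew; exists (k, l) => //; rewrite /bad k2 l2.
Qed.

End GaussianOperatorNorm.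

(** * Privacy for fixed parameters *)

Section SignEvent.
Context {R : realType} {n : nat}.
Variable lev : 'M[R]_n -> 'cV[R]_n.
Hypothesis lev_borel : forall i (V : set R), measurable V ->
  borel_mx [set M | V (lev M i 0)].

Definition spectral_labels (Y : 'M[R]_n) : {ffun 'I_n -> 'I_2} :=
  [ffun i => if 0 <= lev Y i 0 then 0 else 1].

Lemma measurable_spectral_labels d (U : measurableType d) (Y : U -> 'M[R]_n)
    (S : {set {ffun 'I_n -> 'I_2}}) :
  measurable_fun setT (Y : U -> mxspace R n) ->
  measurable [set u | spectral_labels (Y u) \in S].
Proof.
move=> mY; pose neg i := [set u | lev (Y u) i 0 < 0].
have mneg i : measurable (neg i).
  have := borel_mx_measurable (lev_borel i (measurable_itv `]-oo, 0[)).
  move=> /(mY measurableT); rewrite setTI.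
  by congr measurable; apply/seteqP; split=> u /=; rewrite /neg/= in_itv.
have -> : [set u | spectral_labels (Y u) \in S] =
    \bigcup_(f in [set f | f \in S]) \bigcap_(i in [set: 'I_n])
      (if f i == 0 then ~` neg i else neg i).
  apply/seteqP; split=> u /=.
    move=> uS; exists (spectral_labels (Y u)) => // i _; rewrite ffunE /neg.
    by case: leP => h //=; apply/negP; rewrite -leNgt.
  move=> [f fS fu]; suff -> : spectral_labels (Y u) = f by [].
  apply/ffunP => i; have := fu i I; rewrite ffunE /neg; case: eqVneq => [->|fi] /=.
    by move=> /negP; rewrite -leNgt => ->.
  rewrite ltNge => /negbTE ->; case: (f i) fi => [[|[|m]] //=] ? _; exact: val_inj.
apply: fin_bigcup_measurable => [|f _]; first exact: finite_finset.
apply: fin_bigcap_measurable => [|i _]; first exact: finite_finset.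
by case: ifP => // _; exact: measurableC.
Qed.

End SignEvent.

Section FixedParameters.
Context {R : realType} (n : nat).
Variables (lp : R -> 'M[bool]_n -> 'rV[R]_n * 'M[R]_n) (lev : 'M[R]_n -> 'cV[R]_n).
Variables (B : 'M[R]_2) (D eps delta eps1 delta1 : R).
Hypothesis lev_borel : forall i (V : set R), measurable V ->
  borel_mx [set M | V (lev M i 0)].
Hypotheses (n2 : (2 <= n)%N) (gap : B 0 1 < B 0 0).
Hypotheses (D1 : 1 <= D) (eps_gt0 : 0 < eps) (delta_gt0 : 0 < delta).
Hypotheses (eps1_gt0 : 0 < eps1) (delta1_01 : 0 < delta1 <= 1).

Let beta := B 0 0 - B 0 1.
Let beta0 : 0 < beta. Proof. by rewrite subr_gt0. Qed.
Let nR : 0 < n%:R :> R. Proof. by rewrite ltr0n (leq_trans _ n2). Qed.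
Let D0 : 0 < D. Proof. exact: lt_le_trans D1. Qed.

Definition noise_scale (l : R) : R :=
  Num.sqrt (noise_variance n B (eps / (4 * D * l)) (delta / l)).

Lemma Lhat_gt0 H z : 0 < Lhat lp eps1 delta1 D H z.
Proof. by rewrite (lt_le_trans (_ : 0 < 2^-1))// /Lhat le_max lexx. Qed.

Lemma noise_varianceE l : 0 < l ->
  noise_variance n B (eps / (4 * D * l)) (delta / l) =
  96 * 16 * D ^+ 2 / (n%:R ^+ 2 * eps ^+ 2 * beta) * (l ^+ 2 * (ln l - ln delta)).
Proof.
move=> l0; rewrite /noise_variance -/beta div1r invf_div ln_div ?posrE//.
by field; rewrite !gt_eqF.
Qed.

Lemma measurable_Lhat H : measurable_fun setT (Lhat lp eps1 delta1 D H).
Proof.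
apply: measurable_maxr => //; apply: measurable_funD => //.
exact: measurable_funD.
Qed.

Lemma measurable_noise_scale H :
  measurable_fun setT (fun z => noise_scale (Lhat lp eps1 delta1 D H z)).
Proof.
rewrite /noise_scale; under eq_fun do rewrite noise_varianceE ?Lhat_gt0//.
apply: (@measurableT_comp _ _ _ _ _ _ (@Num.sqrt R)).
  apply: continuous_measurable_fun; exact: sqrt_continuous.
apply: measurable_funM => //; apply: measurable_funM.
  by apply: measurable_funX; exact: measurable_Lhat.
apply: measurable_funB => //; apply: measurableT_comp; last exact: measurable_Lhat.
exact: measurable_ln.
Qed.

Definition noisy_matrix H (zM : R * mxspace R n) : 'M[R]_n :=
  Xhat (centered B (trunc lp D H)) + noise_scale (Lhat lp eps1 delta1 D H zM.1) *: zM.2.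

Lemma theta_hatE H z (M : 'M[R]_n) :
  theta_hat lev lp B D eps delta eps1 delta1 H z M =
  spectral_labels lev (noisy_matrix H (z, M)).
Proof. by []. Qed.

Lemma measurable_noisy_matrix H :
  measurable_fun setT (noisy_matrix H : _ -> mxspace R n).
Proof.
apply: measurable_mxspace => i j; rewrite /noisy_matrix.
rewrite (_ : (fun w => _) = (fun w : R * mxspace R n => Xhat (centered B (trunc lp D H)) i j
   + noise_scale (Lhat lp eps1 delta1 D H w.1) * (w.2 : 'M[R]_n) i j)); last first.
  by apply/funext => w; rewrite !mxE.
apply: measurable_funD => //; apply: measurable_funM.
  exact: (measurableT_comp (measurable_noise_scale H)).
exact: (measurableT_comp (measurable_mxspace_entry i j)).
Qed.

(** After this shift of the Laplace variable both graphs have the same noise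
    scale. *)
Lemma Lhat_shift G H z :
  Lhat lp eps1 delta1 D G z =
  Lhat lp eps1 delta1 D H (z + (2 * d_trunc lp D G - 2 * d_trunc lp D H)).
Proof. by rewrite /Lhat; congr Num.max; ring. Qed.

Hypothesis lp_ok : lp_rule lp.
Hypothesis delta_le : delta <= expR (- 2 * eps).

Let ln_delta : 2 * eps <= - ln delta.
Proof. by have := delta_le; rewrite -{1}(lnK delta_gt0) ler_expR; lra. Qed.

(** The squared distance of the two estimates is of order [D * l / n ^+ 2] and
    the squared noise scale of order
    [D ^+ 2 * l ^+ 2 * (ln l - ln delta) / (n * eps) ^+ 2]; the bound on [delta]
    makes [ln l - ln delta] cancel one factor [eps]. *)
Lemma scaled_sensitivity G H (S : {set 'I_n}) l :
  simple_graph G -> simple_graph H -> agree_off S G H -> (#|S| <= 1)%N ->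
  5 + 2 * d_trunc lp D G <= l ->
  0 < noise_scale l /\
  frobenius_sq ((noise_scale l)^-1 *:
    (Xhat (centered B (trunc lp D G)) - Xhat (centered B (trunc lp D H)))) <= eps / 4.
Proof.
move=> sG sH GH S1 dl.
have l5 : 5 <= l by have := d_trunc_ge0 lp_ok (ltW D0) sG; lra.
have l0 : 0 < l by lra.
have lnl : 0 <= ln l by rewrite ln_ge0//; lra.
have ld : 2 * eps <= ln l - ln delta by move: ln_delta; lra.
pose c := 96 * 16 * D ^+ 2 / (n%:R ^+ 2 * eps ^+ 2 * beta).
have c0 : 0 < c.
  have h96 : 0 < 96 :> R by rewrite ltr0n.
  by apply: divr_gt0; apply: mulr_gt0; rewrite ?mulr_gt0 ?exprn_gt0.
have ld0 : 0 < ln l - ln delta by move: eps_gt0 ld; lra.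
have v0 : 0 < c * (l ^+ 2 * (ln l - ln delta)).
  by apply: mulr_gt0 => //; apply: mulr_gt0 => //; exact: exprn_gt0.
have sc : noise_scale l ^+ 2 = c * (l ^+ 2 * (ln l - ln delta)).
  by rewrite sqr_sqrtr noise_varianceE// ltW.
have s0 : 0 < noise_scale l by rewrite /noise_scale sqrtr_gt0 noise_varianceE.
split=> //; set X1 := Xhat _; set X2 := Xhat _.
have -> : frobenius_sq ((noise_scale l)^-1 *: (X1 - X2)) =
    frobenius_sq (X1 - X2) / noise_scale l ^+ 2.
  rewrite /frobenius_sq mulr_suml; apply: eq_bigr => i _.
  by rewrite mulr_suml; apply: eq_bigr => j _; rewrite !mxE exprMn exprVn mulrC.
rewrite ler_pdivrMr ?exprn_gt0//.
apply: le_trans (Xhat_stability _ _) _.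
have -> : \sum_i \sum_j `|centered B (trunc lp D G) i j - centered B (trunc lp D H) i j| =
    2 / (n%:R * beta) * \sum_i \sum_j `|(trunc lp D G i j)%:R - (trunc lp D H i j)%:R|.
  rewrite mulr_sumr; apply: eq_bigr => i _; rewrite mulr_sumr; apply: eq_bigr => j _.
  have k0 : 0 <= 2 / (n%:R * beta) by rewrite divr_ge0// mulr_ge0// ltW.
  by rewrite -[in RHS](ger0_norm k0) -normrM !mxE -/beta; congr `|_|; ring.
have tr := trunc_distance lp_ok (ltW D0) sG sH GH S1.
apply: (@le_trans _ _ (2 / n%:R * (2 / (n%:R * beta) * (8 * D * l)))).
  rewrite ler_wpM2l ?divr_ge0 ?(ltW nR)// ler_wpM2l ?divr_ge0 ?mulr_ge0 ?(ltW nR) ?(ltW beta0)//.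
  by rewrite (le_trans tr)// ler_wpM2l// mulr_ge0// ltW.
rewrite sc.
have -> : 2 / n%:R * (2 / (n%:R * beta) * (8 * D * l)) =
    32 * D * l / (n%:R ^+ 2 * beta) by field; rewrite !gt_eqF.
have -> : eps / 4 * (c * (l ^+ 2 * (ln l - ln delta))) =
    32 * D * l / (n%:R ^+ 2 * beta) * (12 * D * l * (ln l - ln delta) / eps).
  by rewrite /c; field; rewrite !gt_eqF.
rewrite ler_peMr//.
  by rewrite divr_ge0 ?mulr_ge0 ?sqr_ge0// ltW.
rewrite ler_pdivlMr// mul1r.
apply: (@le_trans _ _ (12 * D * l * (2 * eps))).
  have : 1 <= D * l by move: D1 l5; nra.
  by move: eps_gt0; nra.
by rewrite ler_wpM2l// !mulr_ge0// ltW.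
Qed.

Section Mechanism.
Context d (T : measurableType d) (P : probability T R).
Variables (A : T -> 'M[bool]_n) (Z : {RV P >-> R}) (g : 'I_n -> 'I_n -> {RV P >-> R}).
Hypothesis noise : independent_noise A (8 / eps1) Z g.

Let M (w : T) : 'M[R]_n := \matrix_(i, j) g i j w.

(** For a fixed value of the Laplace variable not below [- t], the estimate
    is at least [5 + 2 * d_trunc], and both outputs are the same function of
    a Gaussian matrix and of its translate by [h]. *)
Lemma theta_hat_node_DP : node_DP P (eps + eps1) (expR (- (eps / 2)) + delta1)
  (fun H w => theta_hat lev lp B D eps delta eps1 delta1 H (Z w) (M w)).
Proof.
move=> G H sG sH dGH S.
have [K K1 GH] := d_node_le1 n2 dGH.
have b0 : 0 < 8 / eps1 by rewrite divr_gt0.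
pose F J : set (R * mxspace R n) := [set zM | spectral_labels lev (noisy_matrix J zM) \in S].
have mF J : measurable (F J).
  by apply: measurable_spectral_labels => //; exact: measurable_noisy_matrix.
have [d10 d11] := andP delta1_01.
have lnd1 : 0 <= ln (1 / delta1) by rewrite ln_ge0// ler_pdivlMr// mul1r.
pose s := 2 * d_trunc lp D G - 2 * d_trunc lp D H.
pose t := 8 * ln (1 / delta1) / eps1.
have t0 : 0 <= t by rewrite divr_ge0 ?mulr_ge0// ltW.
have s8 : `|s| <= 8.
  have HG : agree_off K H G.
    apply/forallP => i; apply/forallP => j; apply/implyP => ij.
    by move/forallP: GH => /(_ i)/forallP/(_ j)/implyP/(_ ij); rewrite eq_sym.
  have := d_trunc_sensitivity lp_ok (ltW D0) sG sH GH K1.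
  have := d_trunc_sensitivity lp_ok (ltW D0) sH sG HG K1.
  by rewrite ler_norml /s; lra.
have := @shifted_noise_comparison _ _ _ P n Z g (8 / eps1) A b0 noise (F G) (F H)
  s t eps (expR (- (3 / 4 * eps))) (mF G) (mF H) t0 (expR_ge0 _).
rewrite (_ : expR (- t / _) = delta1); last first.
  rewrite (_ : - t / _ = - ln (1 / delta1)); last by rewrite /t; field; rewrite gt_eqF.
  by rewrite expRN lnK ?posrE ?divr_gt0// div1r invrK.
move=> cmp; apply: le_trans (cmp _) _ => [z zt|].
  set l := Lhat lp eps1 delta1 D G z.
  have lH : Lhat lp eps1 delta1 D H (z + s) = l by rewrite /l (Lhat_shift G H).
  have l5 : 5 + 2 * d_trunc lp D G <= l.
    by rewrite /l /Lhat le_max; apply/orP; right; move: zt; rewrite /t; lra.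
  have [s0 sens] := scaled_sensitivity sG sH GH K1 l5.
  set X1 := Xhat (centered B (trunc lp D G)) in sens *.
  set X2 := Xhat (centered B (trunc lp D H)) in sens *.
  set h := _ *: (X1 - X2) in sens.
  pose C : set 'M[R]_n := [set Y | spectral_labels lev (X2 + noise_scale l *: Y) \in S].
  have mC : measurable (C : set (mxspace R n)).
    apply: measurable_spectral_labels => //; apply: measurable_mxspace => i j.
    rewrite (_ : (fun w => _) = (fun w : mxspace R n => X2 i j + noise_scale l * (w : 'M[R]_n) i j)); last first.
      by apply/funext => w; rewrite !mxE.
    apply: measurable_funD => //; apply: measurable_funM => //.
    exact: measurable_mxspace_entry.
  have FG : [set w | F G (z, M w)] = [set w | C (M w + h)].
    apply/seteqP; suff E w : noisy_matrix G (z, M w) = X2 + noise_scale l *: (M w + h).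
      by split=> w; rewrite /F /C /= E.
    rewrite /noisy_matrix/= -/X1 -/l scalerDr /h scalerA divff ?gt_eqF// scale1r.
    by rewrite addrCA [X2 + _]addrC subrK addrC.
  have FH : [set w | F H (z + s, M w)] = [set w | C (M w)].
    by apply/seteqP; split=> w; rewrite /F /C /= /noisy_matrix/= lH.
  rewrite FG FH.
  have := gauss_shift_bound (noise_normal noise) (noise_indep_normal noise) h eps mC.
  move=> /le_trans; apply; rewrite leeD2l// lee_fin ler_expR; move: sens; lra.
rewrite leeD//.
  rewrite lee_wpmul2r// lee_fin ler_expR lerD2l ler_pdivrMr//.
  by rewrite mulrC divfK ?gt_eqF.
by rewrite lee_fin lerD2r ler_expR; move: eps_gt0; lra.
Qed.

End Mechanism.
End FixedParameters.

(** * Accuracy for fixed parameters *)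

Section Estimation.
Context {R : realType} (n : nat).
Variables (B : 'M[R]_2) (theta : 'I_n -> 'I_2) (A : 'M[bool]_n).
Hypotheses (n2 : (2 <= n)%N) (B11 : B 0 0 = B 1 1) (B10 : B 0 1 = B 1 0).
Hypothesis gap : B 0 1 < B 0 0.

Let beta := B 0 0 - B 0 1.
Let beta0 : 0 < beta. Proof. by rewrite subr_gt0. Qed.
Let nR : 0 < n%:R :> R. Proof. by rewrite ltr0n (leq_trans _ n2). Qed.

Definition label_sign (k : 'I_2) : R := if k == 0 then 1 else -1.

Definition planted : 'cV[R]_n := \col_i (label_sign (theta i) / Num.sqrt n%:R).

Let rr : Num.sqrt n%:R ^+ 2 = n%:R :> R.
Proof. by rewrite sqr_sqrtr// ltW. Qed.

Let r0 : 0 < Num.sqrt n%:R :> R.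
Proof. by rewrite sqrtr_gt0. Qed.

Lemma label_sign_sq k : label_sign k ^+ 2 = 1.
Proof. by rewrite /label_sign; case: ifP; rewrite ?sqrrN expr1n. Qed.

Lemma planted_sq i : planted i 0 ^+ 2 = n%:R^-1.
Proof. by rewrite mxE exprMn exprVn rr label_sign_sq mul1r. Qed.

Lemma planted_unit : sqn planted = 1.
Proof.
rewrite /sqn; under eq_bigr do rewrite planted_sq.
by rewrite sumr_const card_ord -[LHS]mulr_natl divff ?gt_eqF.
Qed.

Let Xstar : 'M[R]_n := planted *m planted^T.

Let XstarE i j : Xstar i j = label_sign (theta i) * label_sign (theta j) / n%:R.
Proof. by rewrite mxE big_ord1 !mxE mulrACA -invfM -expr2 rr. Qed.

Let Xstar_feasible : sdp_feasible Xstar.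
Proof.
split; last by move=> i; rewrite XstarE -expr2 label_sign_sq mul1r.
apply/psd_bilin; split; first by rewrite /Xstar trmx_mul trmxK.
move=> v; rewrite (_ : bilin _ _ _ = (\sum_i v i * planted i 0) ^+ 2) ?sqr_ge0//.
rewrite expr2 mulr_suml; apply: eq_bigr => i _; rewrite mulr_sumr.
by apply: eq_bigr => j _; rewrite mxE big_ord1 !mxE; ring.
Qed.

Definition edge_noise i j : R :=
  if i == j then 0 else (A i j)%:R - B (theta i) (theta j).

Let edge_prob i j : B (theta i) (theta j) =
  (B 0 0 + B 0 1) / 2 + beta / 2 * (label_sign (theta i) * label_sign (theta j)).
Proof.
have cases (k : 'I_2) : k = 0 \/ k = 1.
  by case: k => [[|[|m]] //=] h; [left|right]; exact: val_inj.
rewrite /label_sign /beta.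
by case: (cases (theta i)) => ->; case: (cases (theta j)) => -> /=;
   rewrite -?B11 -?B10; field.
Qed.

(** The semidefinite estimate is close to the planted rank one matrix: the
    error is an inner product with the centred adjacency matrix, which
    Grothendieck's inequality bounds by the cut norm. *)
Lemma Xhat_error c :
  (forall x y : {ffun 'I_n -> bool},
     \sum_i \sum_j edge_noise i j * ((-1) ^+ x i * (-1) ^+ y j) <= c) ->
  frobenius_sq (Xhat (centered B A) - Xstar) <= 258 * c / (n%:R ^+ 2 * beta).
Proof.
move=> cut; have cut' := cut_norm_signs cut.
set Y := centered B A; set X := Xhat Y.
have Xf : sdp_feasible X by exact: Xhat_feasible.
apply: (le_trans (Xhat_dist_feasible Y Xstar_feasible)); rewrite -/X.
have -> : mxip (Y - Xstar) (X - Xstar) =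
   2 / (n%:R ^+ 2 * beta) * (\sum_i \sum_j edge_noise i j * (n%:R * X i j) +
     \sum_i \sum_j edge_noise i j * (- label_sign (theta i) * label_sign (theta j))).
  rewrite -big_split mulr_sumr; apply: eq_bigr => i _ /=.
  rewrite -big_split mulr_sumr; apply: eq_bigr => j _ /=.
  rewrite /edge_noise; case: eqVneq => [->|_].
    have -> : (X - Xstar) j j = 0.
      by rewrite mxE [(- Xstar) j j]mxE (proj2 Xf) (proj2 Xstar_feasible) subrr.
    by rewrite !mul0r mulr0 addr0 mulr0.
  have -> : (Y - Xstar) i j = 2 / (n%:R * beta) * ((A i j)%:R - B (theta i) (theta j)).
    rewrite mxE [(- Xstar) i j]mxE XstarE edge_prob !mxE -/beta.
    by field; rewrite !gt_eqF.
  have -> : (X - Xstar) i j = X i j - label_sign (theta i) * label_sign (theta j) / n%:R.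
    by rewrite mxE [(- Xstar) i j]mxE XstarE.
  by field; rewrite !gt_eqF.
have gro : \sum_i \sum_j edge_noise i j * (n%:R * X i j) <= 128 * c.
  have := @Grothendieck_psd R n edge_noise c cut' (n%:R *: X).
  under eq_bigr do under eq_bigr do rewrite mxE.
  apply; last by move=> i; rewrite mxE (proj2 Xf) divff ?gt_eqF.
  have [/psd_bilin[XT X0] _] := Xf; apply/psd_bilin; split; first by rewrite linearZ/= XT.
  move=> v; rewrite (_ : bilin _ v v = n%:R * bilin X v v) ?mulr_ge0 ?(ltW nR)//.
  rewrite /bilin mulr_sumr; apply: eq_bigr => i _; rewrite mulr_sumr.
  by apply: eq_bigr => j _; rewrite mxE; ring.
have pla : \sum_i \sum_j edge_noise i j * (- label_sign (theta i) * label_sign (theta j)) <= c.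
  by apply: cut' => i; rewrite /label_sign; case: ifP; rewrite ?normrN normr1.
have -> : 258 * c / (n%:R ^+ 2 * beta) = 2 / (n%:R ^+ 2 * beta) * (128 * c + c).
  by field; rewrite !gt_eqF.
rewrite ler_pM2l; last by rewrite divr_gt0// mulr_gt0// exprn_gt0.
exact: lerD.
Qed.

Variable lev : 'M[R]_n -> 'cV[R]_n.
Hypothesis lev_ok : forall M, (exists x, leading_unit_eigenvector M x) ->
  leading_unit_eigenvector M (lev M).

(** Up to a global sign the labels are the signs of a unit vector close to the
    planted one. *)
Lemma spectral_loss (E : 'M[R]_n) (r : R) : op_norm_le E r -> 0 <= r <= 8^-1 ->
  loss (spectral_labels lev (Xstar + E)) theta <= 12 * r ^+ 2.
Proof.
move=> Er r01; have [r_ge0 r8] := andP r01.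
have lead := lev_ok (leading_perturbation_exists planted_unit Er r_ge0 r8).
set y := lev (Xstar + E) in lead *.
have close := leading_perturbation_close planted_unit Er r_ge0 r8 lead.
have y1 : sqn y = 1 by case: lead.
set c := dot planted y in close.
pose s : 'S_2 := if 0 <= c then 1%g else tperm 0 1.
pose Mis : {set 'I_n} :=
  [set i | s (spectral_labels lev (Xstar + E) i) != theta i]%SET.
have mis i : i \in Mis -> c * planted i 0 * y i 0 <= 0.
  rewrite inE /spectral_labels ffunE -/y mxE.
  have rV0 : 0 <= (Num.sqrt n%:R)^-1 :> R by rewrite invr_ge0 ltW.
  rewrite (_ : c * _ * _ = (Num.sqrt n%:R)^-1 * (c * label_sign (theta i) * y i 0)); last by ring.
  move=> neq; rewrite mulr_ge0_le0//; move: neq; rewrite /s /label_sign.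
  have cases (k : 'I_2) : k = 0 \/ k = 1.
    by case: k => [[|[|m]] //=] h; [left|right]; exact: val_inj.
  case: (leP 0 c) => c0; case: (leP 0 (y i 0)) => yi;
    case: (cases (theta i)) => ->; rewrite ?perm1 ?tpermL ?tpermR//= => _; nra.
have count := sign_mismatch_count planted_unit y1 planted_sq mis close r01.
have -> : 12 * r ^+ 2 = 2 * (6 * r ^+ 2) by ring.
apply: le_trans (ler_wpM2l (ler0n _ 2) count).
rewrite /loss; apply: (@le_trans _ _ (2 / n%:R * \sum_(i < n)
   (s (spectral_labels lev (Xstar + E) i) != theta i)%:R)).
  exact: bigmin_le_cond.
rewrite mulrAC -mulrA ler_wpM2l// ler_wpM2r ?invr_ge0 ?(ltW nR)//.
rewrite -sum1_card natr_sum [leRHS]big_mkcond/= ler_sum// => i _.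
by rewrite inE; case: ifP.
Qed.

End Estimation.

(** The right-hand side is the square root of the variance at [m], in the form of
    [noise_varianceE]; the estimate at which it is evaluated is random. *)
Lemma noise_scale_le (R : realType) (n : nat) (B : 'M[R]_2) (D eps delta l m : R) :
  (2 <= n)%N -> B 0 1 < B 0 0 -> 1 <= D -> 0 < eps -> 0 < delta ->
  0 < l -> l <= m -> 0 <= ln m - ln delta ->
  noise_scale n B D eps delta l <= Num.sqrt
    (96 * 16 * D ^+ 2 / (n%:R ^+ 2 * eps ^+ 2 * (B 0 0 - B 0 1)) *
     (m ^+ 2 * (ln m - ln delta))).
Proof.
move=> n2 gap D1 eps0 delta0 l0 lm ld; have D0 := lt_le_trans ltr01 D1.
rewrite /noise_scale noise_varianceE// ler_wsqrtr//.
have nR : 0 < n%:R :> R by rewrite ltr0n (leq_trans _ n2).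
have h96 : 0 <= 96 :> R by rewrite ler0n.
have g0 : 0 <= B 0 0 - B 0 1 by rewrite subr_ge0 ltW.
have c0 : 0 <= 96 * 16 * D ^+ 2 by apply: mulr_ge0; [exact: mulr_ge0|exact: sqr_ge0].
have c1 : 0 <= n%:R ^+ 2 * eps ^+ 2 * (B 0 0 - B 0 1).
  by apply: mulr_ge0 => //; apply: mulr_ge0; exact: sqr_ge0.
apply: ler_wpM2l; first exact: divr_ge0.
have l2 : l ^+ 2 <= m ^+ 2 by rewrite ler_sqr ?nnegrE// ?(le_trans (ltW l0))// ltW.
apply: (@le_trans _ _ (l ^+ 2 * (ln m - ln delta))).
  by rewrite ler_wpM2l ?sqr_ge0// lerD2r ler_ln ?posrE// (lt_le_trans l0).
exact: ler_wpM2r.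
Qed.

Section Utility.
Context {R : realType} (n : nat).
Variables (lp : R -> 'M[bool]_n -> 'rV[R]_n * 'M[R]_n) (lev : 'M[R]_n -> 'cV[R]_n).
Variables (B : 'M[R]_2) (theta : 'I_n -> 'I_2) (D eps delta eps1 delta1 : R).
Hypotheses (lp_ok : lp_rule lp) (lev_ok : eigenvector_rule lev).
Hypotheses (n2 : (2 <= n)%N) (B11 : B 0 0 = B 1 1) (B10 : B 0 1 = B 1 0).
Hypotheses (gap : B 0 1 < B 0 0) (B01_gt0 : 0 < B 0 1).
Hypotheses (D1 : 1 <= D) (eps_gt0 : 0 < eps) (delta_gt0 : 0 < delta).
Hypothesis eps1_gt0 : 0 < eps1.

Let dg : R := n%:R * B 0 0.
Hypotheses (dg1 : 1 <= dg) (dgD : 3 * dg <= D).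
Hypothesis dg_large : n%:R * expR (- (dg / 2)) <= n%:R^-1.

Context d (T : measurableType d) (P : probability T R).
Variables (A : T -> 'M[bool]_n) (Z : {RV P >-> R}) (g : 'I_n -> 'I_n -> {RV P >-> R}).
Hypothesis noise : independent_noise A (8 / eps1) Z g.
Hypothesis sbm : is_SBM P B theta A.

Let M (w : T) : 'M[R]_n := \matrix_(i, j) g i j w.

Let estimate w := theta_hat lev lp B D eps delta eps1 delta1 (A w) (Z w) (M w).

Let lmax := Num.max 2^-1 (5 + 8 / eps1 * ln n%:R + 8 * ln (1 / delta1) / eps1).
Variable s0 : R.
Hypothesis s0_ge0 : 0 <= s0.
Hypothesis scale_le : forall l, 0 < l -> l <= lmax ->
  noise_scale n B D eps delta l <= s0.

Let r := Num.sqrt (258 * (14 * n%:R * Num.sqrt dg) / (n%:R ^+ 2 * (B 0 0 - B 0 1))) +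
  s0 * (24 * Num.sqrt (n%:R * ln n%:R)).
Hypothesis r_le : r <= 8^-1.

Let nR : 0 < n%:R :> R. Proof. by rewrite ltr0n (leq_trans _ n2). Qed.
Let n1 : 1 <= n%:R :> R. Proof. by rewrite -[leLHS]/(1%:R) ler_nat (leq_trans _ n2). Qed.

Let measurable_estimate (S : {set {ffun 'I_n -> 'I_2}}) :
  measurable [set w | estimate w \in S].
Proof.
have [_ mA _ _] := sbm; have [_ lev_borel] := lev_ok.
have -> : [set w | estimate w \in S] = \bigcup_(H in [set: 'M[bool]_n])
   ((\bigcap_(p in [set: 'I_n * 'I_n]) ((fun w => A w p.1 p.2) @^-1` [set H p.1 p.2])) `&`
    [set w | spectral_labels lev (noisy_matrix lp B D eps delta eps1 delta1 H (Z w, M w)) \in S]).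
  apply/seteqP; split=> w /=.
    by move=> wS; exists (A w).
  move=> [H _ [AH]]; suff -> : H = A w by [].
  by apply/matrixP => i j; rewrite -(AH (i, j) I).
apply: fin_bigcup_measurable => [|H _]; first exact: finite_finset.
apply: measurableI.
  apply: fin_bigcap_measurable => [|p _]; first exact: finite_finset.
  by rewrite -[X in measurable X]setTI; exact: mA.
apply: measurable_spectral_labels => //.
have mZM : measurable_fun setT (fun w => (Z w, M w : mxspace R n)).
  by apply: measurable_fun_pair => //; exact: measurable_gauss_matrix.
have mN := @measurable_noisy_matrix R n lp B D eps delta eps1 delta1 n2 gap D1 eps_gt0 delta_gt0 H.
exact: (measurableT_comp mN mZM).
Qed.

Let p i j := B (theta i) (theta j).

Let label_cases (k : 'I_2) : k = 0 \/ k = 1.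
Proof. by case: k => [[|[|m]] //=] h; [left|right]; exact: val_inj. Qed.

Let p_bounds i j : 0 <= p i j <= B 0 0.
Proof.
rewrite /p; case: (label_cases (theta i)) => ->; case: (label_cases (theta j)) => ->;
  rewrite -?B11 -?B10; move: gap B01_gt0; lra.
Qed.

Let p_sym i j : p i j = p j i.
Proof.
by rewrite /p; case: (label_cases (theta i)) => ->; case: (label_cases (theta j)) => ->.
Qed.

(** Outside a small event the graph has low degrees and small cut norm, the
    Laplace variable is at most its scale times [ln n], and the Gaussian matrix
    has operator norm of order [sqrt (n ln n)]. *)
Let good_event : exists E : set T, [/\ measurable E,
  (P E <= (4 / n%:R)%:E)%E &
  forall w, ~ E w -> [/\ forall i, \sum_j (A w i j)%:R <= 3 * dg,
    forall x y : {ffun 'I_n -> bool},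
      \sum_i \sum_j edge_noise B theta (A w) i j * ((-1) ^+ x i * (-1) ^+ y j) <=
      14 * n%:R * Num.sqrt dg,
    Z w <= 8 / eps1 * ln n%:R &
    op_norm_le (M w) (24 * Num.sqrt (n%:R * ln n%:R))]].
Proof.
have [simpleA mA edgeA indA] := sbm.
have p0 i j : 0 <= p i j by have /andP[] := p_bounds i j.
have p_le i j : p i j <= B 0 0 by have /andP[] := p_bounds i j.
have mAij i j : measurable_fun setT (fun w => (A w i j)%:R : R).
  apply: (@measurableT_comp _ _ _ _ _ _ (fun b : bool => b%:R : R)) => //; exact: mA.
pose Edeg i := [set w | 3 * (n%:R * B 0 0) < \sum_j (A w i j)%:R].
have mEdeg i : measurable (Edeg i) by apply: measurable_gt; exact: measurable_sum.
have PEdeg := union_bound mEdeg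
  (degree_tail simpleA mA edgeA indA p_sym p0 p_le).
pose Ecut (xy : {ffun 'I_n -> bool} * {ffun 'I_n -> bool}) :=
  [set w | 14 * n%:R * Num.sqrt (n%:R * B 0 0) <
    \sum_i \sum_j (if i == j then 0 else (A w i j)%:R - p i j) *
       ((-1) ^+ xy.1 i * (-1) ^+ xy.2 j)].
have mEcut xy : measurable (Ecut xy).
  apply: measurable_gt; apply: measurable_sum => i; apply: measurable_sum => j.
  by apply: measurable_funM => //; case: (i == j) => //; exact: measurable_funB.
have PEcut := union_bound mEcut
  (fun xy => cut_tail simpleA mA edgeA indA p_sym p0 p_le xy.1 xy.2 dg1).
have [Eop [mEop PEop Eop_ok]] :=
  gauss_op_norm (noise_normal noise) (noise_indep_normal noise) n2.
pose EZ := [set w | 8 / eps1 * ln n%:R < Z w].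
have mEZ : measurable EZ by exact: measurable_gt.
have lnn : 0 <= ln n%:R :> R by exact: ln_ge0.
have b0 : 0 < 8 / eps1 by rewrite divr_gt0.
have PEZ : (P EZ <= (n%:R^-1)%:E)%E.
  have := laplace_upper_tail b0 (noise_laplace noise) (mulr_ge0 (ltW b0) lnn).
  rewrite (_ : - (8 / eps1 * ln n%:R) / (8 / eps1) = - ln n%:R).
    by rewrite expRN lnK ?posrE.
  by field; rewrite gt_eqF.
pose U1 := \bigcup_(i in [set: 'I_n]) Edeg i.
pose U2 := \bigcup_(xy in [set: {ffun 'I_n -> bool} * {ffun 'I_n -> bool}]) Ecut xy.
have mU1 : measurable U1 by apply: fin_bigcup_measurable => //; exact: finite_finset.
have mU2 : measurable U2 by apply: fin_bigcup_measurable => //; exact: finite_finset.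
exists ((U1 `|` U2) `|` (EZ `|` Eop)); split.
- by do ?apply: measurableU.
- have P1 : (P U1 <= (n%:R^-1)%:E)%E.
    by apply: (le_trans PEdeg); rewrite lee_fin card_ord.
  have P2 : (P U2 <= (n%:R^-1)%:E)%E.
    apply: (le_trans PEcut); rewrite lee_fin card_prod !card_ffun card_bool card_ord.
    rewrite natrM natrX.
    have two_e : 2 <= expR 1 :> R by have := expR_ge1Dx (1 : R); lra.
    have two_n : 2 ^+ n <= expR n%:R :> R.
      by rewrite -[n%:R]mulr1 expRM_natl lerXn2r ?nnegrE ?expR_ge0.
    apply: (@le_trans _ _ (expR n%:R * expR n%:R * expR (- (3 * n%:R)))).
      by rewrite ler_wpM2r ?expR_ge0// ler_pM.
    rewrite -!expRD (_ : n%:R + n%:R + - (3 * n%:R) = - n%:R); last by ring.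
    by rewrite expRN lef_pV2 ?posrE ?expR_gt0//; have := expR_ge1Dx (n%:R : R); lra.
  rewrite (_ : 4 / n%:R = (n%:R^-1 + n%:R^-1) + (n%:R^-1 + n%:R^-1)); last by ring.
  rewrite !EFinD; apply: (le_trans (measureU2 _ _ _)); [exact: measurableU|exact: measurableU|].
  by apply: leeD; apply: (le_trans (measureU2 _ _ _)) => //; exact: leeD.
- move=> w nE; split.
  + move=> i; rewrite leNgt; apply/negP => deg; apply: nE.
    by left; left; exists i.
  + move=> x y; rewrite leNgt; apply/negP => cut; apply: nE.
    by left; right; exists (x, y).
  + by rewrite leNgt; apply/negP => Zw; apply: nE; right; left.
  + by apply: Eop_ok => Ew; apply: nE; right; right.
Qed.

(** On the good event the truncation is the identity, and the matrix whose
    leading eigenvector is taken differs from the planted one by at most [r] in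
    operator norm. *)
Lemma theta_hat_loss q : 12 * r ^+ 2 <= q ->
  ((1 - 4 / n%:R)%:E <= P [set w | (loss (estimate w) theta <= q)%R])%E.
Proof.
move=> rq.
have [E [mE PE Egood]] := good_event.
have [simpleA mA edgeA indA] := sbm.
pose S : {set {ffun 'I_n -> 'I_2}} :=
  [set f : {ffun 'I_n -> 'I_2} | loss f theta <= q]%SET.
have GE : [set w | loss (estimate w) theta <= q] = [set w | estimate w \in S].
  by apply/seteqP; split=> w /=; rewrite inE.
rewrite GE; have mG := measurable_estimate S.
have sub : ~` E `<=` [set w | estimate w \in S].
  move=> w /Egood[deg cut Zw op]; rewrite /= inE; apply: le_trans rq.
  have sA := simpleA w.
  have [d0 TA] := trunc_low_degree lp_ok (le_trans ler01 D1) sA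
    (fun u => le_trans (deg u) dgD).
  rewrite /estimate theta_hatE /noisy_matrix/= TA.
  set l := Lhat _ _ _ _ _ _.
  have l_le : l <= lmax.
    rewrite /l /lmax /Lhat d0 mulr0 addr0 ge_max !le_max lexx/=.
    by apply/orP; right; rewrite lerD2r lerD2l.
  have sl := scale_le (Lhat_gt0 lp D eps1 delta1 (A w) (Z w)) l_le.
  have err := Xhat_error n2 B11 B10 gap cut.
  set X := Xhat _ in err *; set Xs := _ *m _ in err.
  have -> : X + noise_scale n B D eps delta l *: M w =
      Xs + ((X - Xs) + noise_scale n B D eps delta l *: M w).
    by rewrite addrA [Xs + _]addrC subrK.
  have c0 : 0 <= 258 * (14 * n%:R * Num.sqrt dg) / (n%:R ^+ 2 * (B 0 0 - B 0 1)).
    by apply: le_trans err; exact: frobenius_ge0.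
  apply: (spectral_loss theta n2); first by case: lev_ok.
    apply: op_norm_leD.
    - exact: sqrtr_ge0.
    - by rewrite mulr_ge0// mulr_ge0// sqrtr_ge0.
    - by apply: op_norm_le_frobenius; [exact: sqrtr_ge0|rewrite sqr_sqrtr].
    - have op' := op_norm_le_scale (sqrtr_ge0 _ : 0 <= noise_scale n B D eps delta l) op.
      move=> v; apply: (le_trans (op' v)); rewrite ler_wpM2r ?sqn_ge0//.
      have rn : 0 <= 24 * Num.sqrt (n%:R * ln n%:R) :> R by rewrite mulr_ge0// sqrtr_ge0.
      by rewrite ler_sqr ?nnegrE ?mulr_ge0// ?sqrtr_ge0// ler_wpM2r.
  by rewrite r_le andbT addr_ge0 ?sqrtr_ge0// mulr_ge0// mulr_ge0// sqrtr_ge0.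
apply: (@le_trans _ _ (P (~` E))); last by apply: le_measure; rewrite ?inE//; exact: measurableC.
rewrite (_ : P (~` E) = (1 - P E)%E); last exact: probability_setC.
by rewrite EFinB leeB.
Qed.

End Utility.

(** * Asymptotics *)

Section Asymptotic.
Context {R : realType}.

Lemma near_even_oo (Q : nat -> Prop) :
  (\forall n \near \oo, Q n) -> \forall n \near even_oo, Q n.
Proof. by move=> H; apply: filterS H => n Qn _. Qed.

Lemma ln_large (K : R) : \forall n \near even_oo, K <= ln n%:R.
Proof.
apply: near_even_oo; exists (Num.truncn (expR K)).+1 => // n /= Kn.
have eK : expR K <= n%:R.
  apply: le_trans (ltW (truncnS_gt _)) _; by rewrite ler_nat.
have n0 : 0 < n%:R :> R by rewrite (lt_le_trans _ eK)// expR_gt0.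
by rewrite -[K]expRK ler_ln ?posrE ?expR_gt0.
Qed.

Lemma powR_ln (n : nat) (x : R) : (0 < n)%N -> n%:R `^ x = expR (x * ln n%:R).
Proof. by move=> n0; rewrite /powR pnatr_eq0 gtn_eqF. Qed.

Lemma is_poly_bounds (p : nat -> R) : is_poly p ->
  exists alpha C : R, [/\ 0 < alpha, 0 < C &
    \forall n \near even_oo, n%:R `^ alpha <= C * p n /\ p n <= C * n%:R `^ alpha].
Proof.
move=> [alpha alpha0 [[C1 C10 H1] [C2 C20 H2]]].
exists alpha, (Num.max C1 C2); split=> //; first by rewrite lt_max C10.
near=> n.
have h1 : p n <= C1 * n%:R `^ alpha by near: n.
have h2 : n%:R `^ alpha <= C2 * p n by near: n.
have np : 0 <= n%:R `^ alpha by exact: powR_ge0.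
have p0 : 0 <= p n by have := le_trans np h2; rewrite pmulr_rge0.
split; [apply: le_trans h2 _|apply: le_trans h1 _]; rewrite ler_wpM2r// le_max lexx ?orbT//.
Unshelve. all: by end_near. Qed.

Lemma is_poly_powR (alpha : R) : 0 < alpha -> is_poly (fun n => n%:R `^ alpha).
Proof.
by move=> alpha0; exists alpha => //; split; exists 1 => //; near=> n; rewrite mul1r.
Unshelve. all: by end_near. Qed.

Lemma max_entry_planted (B : 'M[R]_2) : B 0 0 = B 1 1 -> B 0 1 = B 1 0 ->
  0 <= B 0 0 -> 0 <= B 0 1 -> max_entry B = Num.max (B 0 0) (B 0 1).
Proof.
move=> B11 B10 B00 B01; rewrite /max_entry !big_ord_recl !big_ord0.
have -> : lift ord0 ord0 = 1 :> 'I_2 by exact: val_inj.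
rewrite -[ord0]/(0 : 'I_2) -B11 -B10 (max_l B01) (max_l B00).
by rewrite (@max_l _ _ (Num.max (B 0 1) _) 0) ?le_max ?B01// (maxC (B 0 1)) maxxx.
Qed.

Lemma min_diag_planted (B : 'M[R]_2) : B 0 0 = B 1 1 ->
  \big[Num.min/B 0 0]_(j < 2) B j j = B 0 0.
Proof.
move=> B11; rewrite !big_ord_recl big_ord0.
have -> : lift ord0 ord0 = 1 :> 'I_2 by exact: val_inj.
by rewrite -[ord0]/(0 : 'I_2) -B11 !minxx.
Qed.

Lemma node_DP_mono d (T : measurableType d) (P : probability T R) (n : nat)
    (O : finType) (e e' dl dl' : R) (M : 'M[bool]_n -> T -> O) :
  e <= e' -> dl <= dl' -> node_DP P e dl M -> node_DP P e' dl' M.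
Proof.
move=> ee dd DP G G' sG sG' GG' S; apply: le_trans (DP G G' sG sG' GG' S) _.
by rewrite leeD// ?lee_fin// lee_wpmul2r// lee_fin ler_expR.
Qed.

(** Were [an] negative, the entries of [B0] would be too, and the lower bound
    would leave only values of [an] of order [ln n / n]; the expected degree
    would then be of order [ln n]. *)
Lemma planted_regime (B0 : 'M[R]_2) (n : nat) (an : R) :
  (2 <= n)%N -> B0 0 0 = B0 1 1 -> B0 0 1 = B0 1 0 -> B0 0 1 < B0 0 0 ->
  sbm_matrix (an *: B0) ->
  50 * ln n%:R / (n%:R * B0 0 0) <= an ->
  ln n%:R ^+ 3 < n%:R * max_entry (an *: B0) ->
  1 <= ln (n%:R : R) -> 50 * (B0 0 1 / B0 0 0) <= ln n%:R ->
  [/\ 0 < an, 0 < B0 0 1 & max_entry (an *: B0) = an * B0 0 0].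
Proof.
move=> n2 B11 B10 gap [Bpos _ _] an_ge dl l1 lK.
have nR : 0 < n%:R :> R by rewrite ltr0n (leq_trans _ n2).
have := Bpos 0 0; have := Bpos 0 1; rewrite !mxE => /andP[p01 _] /andP[p00 _].
have maxE : max_entry (an *: B0) = Num.max (an * B0 0 0) (an * B0 0 1).
  by rewrite max_entry_planted ?mxE ?B11 ?B10 ?(ltW p00) ?(ltW p01)// -?B11 -?B10 ltW.
have [an0|an0|an_eq0] := ltgtP an 0; last by move: p00; rewrite an_eq0 mul0r ltxx.
  have b00 : B0 0 0 < 0 by move: p00; rewrite nmulr_rgt0.
  have b01 : B0 0 1 < 0 by move: p01; rewrite nmulr_rgt0.
  exfalso; move: dl; rewrite maxE max_r; last by rewrite ler_nM2l// ltW.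
  apply/negP; rewrite -leNgt.
  have : an * B0 0 0 <= 50 * ln n%:R / n%:R.
    have -> : 50 * ln n%:R / n%:R = 50 * ln n%:R / (n%:R * B0 0 0) * B0 0 0.
      by field; rewrite lt_eqF// gt_eqF.
    by rewrite ler_nM2r.
  rewrite ler_pdivlMr// => h.
  have k0 : 0 < B0 0 1 / B0 0 0 by rewrite nmulr_rgt0// invr_lt0.
  have -> : n%:R * (an * B0 0 1) = an * B0 0 0 * n%:R * (B0 0 1 / B0 0 0).
    by field; rewrite lt_eqF.
  apply: (@le_trans _ _ (50 * ln n%:R * (B0 0 1 / B0 0 0))); first by rewrite ler_pM2r.
  rewrite mulrAC (_ : ln n%:R ^+ 3 = ln n%:R ^+ 2 * ln n%:R); last by ring.
  by rewrite ler_pM2r ?(lt_le_trans ltr01)// (le_trans lK)//; move: l1; nra.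
have b01 : 0 < B0 0 1 by move: p01; rewrite pmulr_rgt0.
by split=> //; rewrite maxE max_l// ler_pM2l// ltW.
Qed.

End Asymptotic.

Section Rates.
Context {R : realType}.

Lemma rate_bound (l d D eps : R) : 1 <= l -> l ^+ 3 <= d -> 0 < eps -> D ^+ 2 * l <= eps ->
  1 / Num.sqrt d + D ^+ 2 / eps <= 2 / l.
Proof.
move=> l1 ld eps0 Dl; have l0 := lt_le_trans ltr01 l1.
have d0 : 0 < d by apply: lt_le_trans ld; rewrite exprn_gt0.
have ls : l <= Num.sqrt d.
  rewrite -[l]ger0_norm ?(ltW l0)// -sqrtr_sqr ler_wsqrtr//.
  by apply: le_trans ld; rewrite ler_weXn2l.
have h1 : 1 / Num.sqrt d <= 1 / l by rewrite ler_pM2l// lef_pV2 ?posrE ?sqrtr_gt0.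
have h2 : D ^+ 2 / eps <= 1 / l by rewrite ler_pdivrMr// mulrAC ler_pdivlMr// mul1r.
by rewrite (_ : 2 / l = 1 / l + 1 / l) ?lerD//; ring.
Qed.

(** With [k] the relative gap of the two probabilities, the cut norm
    contributes [1 / sqrt d] to the squared radius.  The noise contributes
    [D ^+ 2 / eps] times [l ^+ 3 / d]: two of the logarithms come from the
    size of the noisy estimate of the truncation distance, and the third from
    the operator norm of the Gaussian matrix. *)
Lemma radius_bound (N l d k gap D eps La C L : R) :
  0 < N -> 1 <= l -> l ^+ 3 <= d -> 0 < k -> N * gap = k * d ->
  0 < eps -> 0 <= L -> L <= C * eps ->
  (Num.sqrt (258 * (14 * N * Num.sqrt d) / (N ^+ 2 * gap)) +
   Num.sqrt (96 * 16 * D ^+ 2 / (N ^+ 2 * eps ^+ 2 * gap) * ((La * l) ^+ 2 * L)) *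
     (24 * Num.sqrt (N * l))) ^+ 2 <=
  2 * (258 * 14 / k + 96 * 16 * 24 ^+ 2 * La ^+ 2 * C / k) *
    (1 / Num.sqrt d + D ^+ 2 / eps).
Proof.
move=> N0 l1 ld k0 gapE eps0 L0 LC; have l0 := lt_le_trans ltr01 l1.
have d0 : 0 < d by apply: lt_le_trans ld; rewrite exprn_gt0.
have sd0 : 0 < Num.sqrt d by rewrite sqrtr_gt0.
have gap0 : 0 < gap by have := mulr_gt0 k0 d0; rewrite -gapE pmulr_rgt0.
have -> : gap = k * d / N by rewrite -gapE mulrAC divff ?gt_eqF// mul1r.
set u := Num.sqrt (258 * _ / _); set v := Num.sqrt _ * _.
have p258 : 0 < 258 * 14 :> R by rewrite mulr_gt0 ?ltr0n.
have p96 : 0 < 96 * 16 :> R by rewrite mulr_gt0 ?ltr0n.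
have uE : u ^+ 2 = 258 * 14 / k * (1 / Num.sqrt d).
  rewrite /u; have -> : 258 * (14 * N * Num.sqrt d) / (N ^+ 2 * (k * d / N)) = 258 * 14 / k * (1 / Num.sqrt d) :> R.
    rewrite -[X in k * X](sqr_sqrtr (ltW d0)).
    by field; rewrite !gt_eqF.
  by rewrite sqr_sqrtr// mulr_ge0 ?divr_ge0 ?(ltW k0) ?(ltW p258) ?(ltW sd0).
have vE : v ^+ 2 <= 96 * 16 * 24 ^+ 2 * La ^+ 2 * C / k * (D ^+ 2 / eps).
  rewrite /v [leLHS]exprMn [(24 * _) ^+ 2]exprMn sqr_sqrtr; last first.
    apply: mulr_ge0; last by apply: mulr_ge0 => //; exact: sqr_ge0.
    apply: divr_ge0; first by apply: mulr_ge0; [exact: ltW|exact: sqr_ge0].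
    apply: mulr_ge0; first by rewrite mulr_ge0 ?sqr_ge0.
    by rewrite divr_ge0// ?mulr_ge0// ltW.
  rewrite sqr_sqrtr; last by rewrite mulr_ge0// ltW.
  have -> : 96 * 16 * D ^+ 2 / (N ^+ 2 * eps ^+ 2 * (k * d / N)) * ((La * l) ^+ 2 * L) *
      (24 ^+ 2 * (N * l)) =
      96 * 16 * 24 ^+ 2 * La ^+ 2 / k * (D ^+ 2 / eps) * ((L / eps) * (l ^+ 3 / d)).
    by field; rewrite !gt_eqF.
  have -> : 96 * 16 * 24 ^+ 2 * La ^+ 2 * C / k * (D ^+ 2 / eps) =
      96 * 16 * 24 ^+ 2 * La ^+ 2 / k * (D ^+ 2 / eps) * C by field; rewrite !gt_eqF.
  apply: ler_wpM2l.
    apply: mulr_ge0; last by rewrite divr_ge0 ?sqr_ge0// ltW.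
    apply: divr_ge0; last exact: ltW.
    by apply: mulr_ge0; rewrite ?sqr_ge0// mulr_ge0// ?ltW// sqr_ge0.
  have x1 : l ^+ 3 / d <= 1 by rewrite ler_pdivrMr// mul1r.
  have x0 : 0 <= l ^+ 3 / d by rewrite divr_ge0 ?exprn_ge0// ltW.
  have y1 : L / eps <= C by rewrite ler_pdivrMr.
  have y0 : 0 <= L / eps by rewrite divr_ge0// ltW.
  by rewrite -[C]mulr1 ler_pM.
have C0 : 0 <= C by move: (le_trans L0 LC); rewrite pmulr_lge0.
have sq : (u + v) ^+ 2 <= 2 * (u ^+ 2 + v ^+ 2).
  by rewrite -subr_ge0 (_ : _ - _ = (u - v) ^+ 2) ?sqr_ge0//; ring.
apply: (le_trans sq).
rewrite -[leRHS]mulrA; apply: ler_wpM2l => //.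
set K1 := 258 * 14 / k in uE *; set K2 := _ * C / k in vE *.
have K10 : 0 <= K1 by rewrite divr_ge0 ?ltW.
have K20 : 0 <= K2.
  apply: divr_ge0; last exact: ltW.
  by apply: mulr_ge0 => //; apply: mulr_ge0; rewrite ?sqr_ge0// mulr_ge0 ?sqr_ge0.
set X := 1 / _ in uE *; set Y := D ^+ 2 / eps in vE *.
have X0 : 0 <= X by rewrite divr_ge0// ltW.
have Y0 : 0 <= Y by rewrite divr_ge0 ?sqr_ge0// ltW.
rewrite uE mulrDl !mulrDr.
apply: lerD; first by rewrite lerDl mulr_ge0.
by apply: (le_trans vE); rewrite lerDr mulr_ge0.
Qed.

(** The bounds on [eps1] and [delta1] make the estimate of the truncation
    distance logarithmic. *)
Lemma estimate_bound (l e c K alpha delta1 : R) :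
  1 <= l -> 0 < e -> 1 <= c * e -> 0 < c -> 1 <= K -> 0 < alpha -> 0 < delta1 ->
  K^-1 * expR (- (alpha * l)) <= delta1 ->
  Num.max 2^-1 (5 + 8 / e * l + 8 * ln (1 / delta1) / e) <=
    (5 + 8 * c + 8 * c * (ln K + alpha)) * l.
Proof.
move=> l1 e0 ce c0 K1 alpha0 d0 dK; have K0 := lt_le_trans ltr01 K1.
have l0 := lt_le_trans ltr01 l1.
have lK : 0 <= ln K by exact: ln_ge0.
have lnd : ln (1 / delta1) <= (ln K + alpha) * l.
  have : ln (K^-1 * expR (- (alpha * l))) <= ln delta1.
    by rewrite ler_ln// posrE mulr_gt0 ?invr_gt0 ?expR_gt0.
  rewrite lnM ?posrE ?invr_gt0 ?expR_gt0// expRK lnV ?posrE// div1r lnV ?posrE//.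
  have : ln K <= ln K * l by rewrite ler_peMr.
  lra.
have ie : e^-1 <= c by rewrite -div1r ler_pdivrMr.
have ie0 : 0 <= e^-1 by rewrite invr_ge0 ltW.
have w0 : 0 <= (ln K + alpha) * l by rewrite mulr_ge0 ?addr_ge0// ltW.
have h1 : 8 / e * l <= 8 * c * l by rewrite ler_pM2r// ler_pM2l.
have h2 : 8 * ln (1 / delta1) / e <= 8 * c * ((ln K + alpha) * l).
  apply: (@le_trans _ _ (8 * ((ln K + alpha) * l) / e)).
    by apply: ler_wpM2r => //; rewrite ler_pM2l.
  rewrite -[leLHS]mulrA -[leRHS]mulrA ler_pM2l// [leRHS]mulrC; apply: ler_wpM2l ie; exact: w0.
have c8 : 0 <= 8 * c * l by rewrite !mulr_ge0// ltW.
have w8 : 0 <= 8 * c * ((ln K + alpha) * l) by rewrite mulr_ge0// mulr_ge0// ltW.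
rewrite [leRHS](_ : _ = 5 * l + 8 * c * l + 8 * c * ((ln K + alpha) * l)); last by ring.
by rewrite ge_max; apply/andP; split; lra.
Qed.

Lemma poly_inverse_bounds (p delta1 : nat -> R) :
  is_poly p -> asymp delta1 (fun n => 1 / p n) ->
  exists alpha K : R, [/\ 0 < alpha, 1 <= K &
    \forall n \near even_oo,
      K^-1 * expR (- (alpha * ln n%:R)) <= delta1 n <= K * expR (- (alpha * ln n%:R))].
Proof.
move=> /is_poly_bounds[alpha [C [alpha0 C0 pC]]] [[c1 c10 H1] [c2 c20 H2]].
exists alpha, (Num.max 1 (Num.max (c1 * C) (c2 * C))); split => //.
  by rewrite le_max lexx.
near=> n.
have n0 : (0 < n)%N by near: n; apply: near_even_oo; exists 1%N.
have [h1 h2] : n%:R `^ alpha <= C * p n /\ p n <= C * n%:R `^ alpha by near: n.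
have h3 : delta1 n <= c1 * (1 / p n) by near: n.
have h4 : 1 / p n <= c2 * delta1 n by near: n.
move: h1 h2; rewrite powR_ln// => h1 h2.
set E := expR (alpha * ln n%:R) in h1 h2.
have E0 : 0 < E by exact: expR_gt0.
have p0 : 0 < p n by move: (lt_le_trans E0 h1); rewrite pmulr_rgt0.
rewrite expRN -/E; set K := Num.max _ _.
have K1 : 1 <= K by rewrite le_max lexx.
have K0 := lt_le_trans ltr01 K1.
apply/andP; split.
  have cK : c2 * C <= K by rewrite !le_max lexx !orbT.
  rewrite -invfM -div1r ler_pdivrMr; last by rewrite mulr_gt0.
  have : 1 <= c2 * delta1 n * p n by rewrite -ler_pdivrMr.
  move=> h5; apply: (le_trans h5).
  have dl0 : 0 < delta1 n.
    by move: (lt_le_trans ltr01 h5); rewrite pmulr_lgt0// pmulr_rgt0.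
  rewrite mulrAC mulrC; apply: ler_wpM2l; first exact: ltW.
  apply: (@le_trans _ _ (c2 * C * E)); last by rewrite ler_pM2r.
  by rewrite -mulrA ler_pM2l.
have cK : c1 * C <= K by rewrite !le_max lexx !orbT.
apply: (le_trans h3).
apply: (@le_trans _ _ (c1 * C * E^-1)); last by rewrite ler_pM2r// invr_gt0.
rewrite -mulrA ler_pM2l// ler_pdivrMr// mulrAC ler_pdivlMr// mul1r.
exact: h1.
Unshelve. all: by end_near. Qed.

End Rates.

(** All constants are explicit: [Cr] bounds the squared radius in terms of the
    rate, and [128 * Cr <= l] makes the radius at most 1/8. *)
Lemma theta_hat_loss_rate (R : realType) (n : nat)
    (lp : R -> 'M[bool]_n -> 'rV[R]_n * 'M[R]_n) (lev : 'M[R]_n -> 'cV[R]_n)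
    (B : 'M[R]_2) (theta : 'I_n -> 'I_2) (D eps delta eps1 delta1 : R)
    (k c K alpha C q : R) d (T : measurableType d) (P : probability T R)
    (A : T -> 'M[bool]_n) (Z : {RV P >-> R}) (g : 'I_n -> 'I_n -> {RV P >-> R}) :
  let l := ln n%:R in
  let dg := n%:R * B 0 0 in
  let La := 5 + 8 * c + 8 * c * (ln K + alpha) in
  let Cr := 2 * (258 * 14 / k + 96 * 16 * 24 ^+ 2 * La ^+ 2 * (La + C) / k) in
  lp_rule lp -> eigenvector_rule lev ->
  (2 <= n)%N -> B 0 0 = B 1 1 -> B 0 1 = B 1 0 -> B 0 1 < B 0 0 -> 0 < B 0 1 ->
  2 <= l -> 128 * Cr <= l -> l ^+ 3 <= dg -> 3 * dg <= D -> D ^+ 2 * l <= eps ->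
  0 < k -> n%:R * (B 0 0 - B 0 1) = k * dg ->
  0 < delta -> 0 <= - ln delta <= C * eps ->
  0 < c -> 1 <= c * eps1 -> 1 <= K -> 0 < alpha -> 0 < delta1 ->
  K^-1 * expR (- (alpha * l)) <= delta1 ->
  independent_noise A (8 / eps1) Z g -> is_SBM P B theta A -> 12 * Cr <= q ->
  ((1 - 4 / n%:R)%:E <=
   P [set w | (loss (theta_hat lev lp B D eps delta eps1 delta1 (A w) (Z w)
                       (\matrix_(i, j) g i j w)) theta <=
               q * (1 / Num.sqrt dg + D ^+ 2 / eps))%R])%E.
Proof.
move=> l dg La Cr lp_ok lev_ok n2 B11 B10 gap B01 l2 lCr ldg dgD Dl k0 gapE
  delta0 /andP[lnd0 lndC] c0 ce K1 alpha0 delta10 dK noise sbm Crq.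
have n0 : 0 < n%:R :> R by rewrite ltr0n (leq_trans _ n2).
have l1 : 1 <= l by apply: le_trans l2; rewrite ler1n.
have l0 := lt_le_trans ltr01 l1.
have dg1 : 1 <= dg by apply: le_trans ldg; rewrite exprn_ege1.
have D1 : 1 <= D by move: dg1 dgD; lra.
have leps : l <= eps.
  by apply: le_trans Dl; rewrite ler_peMl ?(ltW l0)// exprn_ege1.
have eps0 : 0 < eps := lt_le_trans l0 leps.
have eps10 : 0 < eps1 by have := lt_le_trans ltr01 ce; rewrite pmulr_rgt0.
have La5 : 5 <= La.
  have lK : 0 <= ln K by exact: ln_ge0.
  have : 0 <= 8 * c * (ln K + alpha) by rewrite !mulr_ge0 ?addr_ge0// ltW.
  by rewrite /La; lra.
have m1 : 1 <= La * l by rewrite mulr_ege1//; lra.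
have lnm0 : 0 <= ln (La * l) by exact: ln_ge0.
have lnm : ln (La * l) <= La * eps.
  apply: (@le_trans _ _ (La * l)); last by rewrite ler_pM2l//; lra.
  by have := ln_sublinear (lt_le_trans ltr01 m1); exact: ltW.
have ld0 : 0 <= ln (La * l) - ln delta by rewrite addr_ge0.
have ldC : ln (La * l) - ln delta <= (La + C) * eps by rewrite [leRHS]mulrDl; exact: lerD.
have rad := @radius_bound R n%:R l dg k (B 0 0 - B 0 1) D eps La (La + C)
  (ln (La * l) - ln delta) n0 l1 ldg k0 gapE eps0 ld0 ldC.
have rate := rate_bound l1 ldg eps0 Dl.
set s0 := Num.sqrt (96 * _ * _ / _ * _) in rad.
set r := _ + _ * _ in rad.
have rate0 : 0 <= 1 / Num.sqrt dg + D ^+ 2 / eps.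
  by rewrite addr_ge0// divr_ge0 ?sqrtr_ge0 ?sqr_ge0// ltW.
have small : 12 * r ^+ 2 <= q * (1 / Num.sqrt dg + D ^+ 2 / eps).
  apply: le_trans (ler_wpM2r rate0 Crq).
  by rewrite -[leRHS]mulrA ler_pM2l.
have Cr0 : 0 <= Cr.
  have C0 : 0 <= C by move: (le_trans lnd0 lndC); rewrite pmulr_lge0.
  rewrite /Cr; apply: mulr_ge0 => //; apply: addr_ge0.
    by apply: divr_ge0; [rewrite mulr_ge0|exact: ltW].
  apply: divr_ge0; last exact: ltW.
  apply: mulr_ge0; last by apply: addr_ge0 => //; lra.
  apply: mulr_ge0; last exact: sqr_ge0.
  by rewrite mulr_ge0 ?sqr_ge0// mulr_ge0.
apply: (@theta_hat_loss R n lp lev B theta D eps delta eps1 delta1 lp_ok lev_ok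
  n2 B11 B10 gap B01 D1 eps0 delta0 eps10 dg1 dgD _ _ T P A Z g noise sbm s0) => //.
- have nE : n%:R = expR l by rewrite lnK.
  rewrite -/dg nE -expRN -expRD ler_expR.
  have : l * 4 <= l ^+ 3.
    by rewrite exprS ler_pM2l// expr2; apply: le_trans (ler_pM _ _ l2 l2) => //; lra.
  by move: ldg; lra.
- exact: sqrtr_ge0.
- move=> l' l'0 l'm; apply: noise_scale_le => //.
  by apply: le_trans l'm _; exact: estimate_bound.
- rewrite -ler_sqr ?nnegrE ?invr_ge0//; last first.
    by rewrite addr_ge0 ?sqrtr_ge0// mulr_ge0 ?sqrtr_ge0// mulr_ge0// sqrtr_ge0.
  apply: (le_trans rad); apply: (@le_trans _ _ (Cr * (2 / l))); first exact: ler_wpM2l.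
  rewrite mulrA ler_pdivrMr//; move: lCr; rewrite expr2; lra.
Qed.

(** The lower bound on [delta] has an exponent of order [eps], and [ln n], to
    which the polynomial factor contributes, is at most [eps] as well. *)
Lemma sandwiched_delta (R : realType) (eps delta h p p' : nat -> R) :
  asymp h eps -> is_poly p -> is_poly p' ->
  (\forall n \near even_oo,
     expR (- h n) / p n < delta n < expR (- 2 * eps n) / p' n) ->
  (\forall n \near even_oo, ln n%:R <= eps n) ->
  exists C, \forall n \near even_oo, [/\ 0 < delta n, delta n <= expR (- 2 * eps n) &
    0 <= - ln (delta n) <= C * eps n].
Proof.
move=> [[c c0 hc] _] /is_poly_bounds[al [Cp [al0 Cp0 pC]]] /is_poly_bounds[al' [C' [al'0 C'0 p'C]]]
  dP le.
exists (c + (`|ln Cp| + al)); near=> n.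
have n0 : (0 < n)%N by near: n; apply: near_even_oo; exists 1%N.
have [h1 h2] : n%:R `^ al <= Cp * p n /\ p n <= Cp * n%:R `^ al by near: n.
have [h3 _] : n%:R `^ al' <= C' * p' n /\ p' n <= C' * n%:R `^ al' by near: n.
have l1 : 1 <= ln n%:R :> R by near: n; exact: ln_large.
have l' : ln C' / al' <= ln n%:R by near: n; exact: ln_large.
have leps : ln n%:R <= eps n by near: n.
have hn : h n <= c * eps n by near: n.
have /andP[d1 d2] : expR (- h n) / p n < delta n < expR (- 2 * eps n) / p' n by near: n.
move: h1 h2 h3; rewrite !powR_ln// => h1 h2 h3.
have p0 : 0 < p n by move: (lt_le_trans (expR_gt0 _) h1); rewrite pmulr_rgt0.
have p'1 : 1 <= p' n.
  rewrite -(ler_pM2l C'0) mulr1; apply: le_trans h3.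
  by rewrite -ler_ln ?posrE ?expR_gt0// expRK -ler_pdivrMl// mulrC.
have delta0 : 0 < delta n by apply: lt_trans d1; rewrite divr_gt0 ?expR_gt0.
have dle : delta n <= expR (- 2 * eps n).
  apply: (le_trans (ltW d2)).
  by rewrite ler_pdivrMr ?(lt_le_trans ltr01)// ler_peMr// expR_ge0.
split=> //; apply/andP; split.
  rewrite oppr_ge0; have : ln (delta n) <= - 2 * eps n.
    by rewrite -[leRHS]expRK ler_ln ?posrE ?expR_gt0.
  by move: l1 leps; lra.
have lnd : - h n - ln (p n) <= ln (delta n).
  have : ln (expR (- h n) / p n) <= ln (delta n).
    by rewrite ler_ln ?posrE ?divr_gt0 ?expR_gt0// ltW.
  by rewrite lnM ?posrE ?invr_gt0 ?expR_gt0// expRK lnV ?posrE.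
have lnp : ln (p n) <= ln Cp + al * ln n%:R.
  have : ln (p n) <= ln (Cp * expR (al * ln n%:R)).
    by rewrite ler_ln ?posrE ?mulr_gt0 ?expR_gt0.
  by rewrite lnM ?posrE ?expR_gt0// expRK.
have h5 : ln Cp <= `|ln Cp| * eps n.
  apply: (le_trans (ler_norm _)); rewrite ler_peMr//; exact: le_trans l1 leps.
have h6 : al * ln n%:R <= al * eps n by rewrite ler_pM2l.
rewrite !mulrDl; move: hn lnd lnp h5 h6; lra.
Unshelve. all: by end_near. Qed.

(** Half of the smaller exponent absorbs the constant [1 + K]. *)
Lemma failure_le_poly (R : realType) (alpha K : R) : 0 < alpha -> 1 <= K ->
  exists2 beta : R, 0 < beta & \forall n \near even_oo,
    expR (- ln n%:R) + K * expR (- (alpha * ln n%:R)) <= 1 / n%:R `^ beta :> R.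
Proof.
move=> alpha0 K1; pose beta := Num.min alpha 1 / 2.
have K0 := lt_le_trans ltr01 K1.
have beta0 : 0 < beta by rewrite divr_gt0// lt_min alpha0 ltr01.
have b1 : 2 * beta <= 1 by rewrite /beta mulrC divfK// ge_min lexx orbT.
have ba : 2 * beta <= alpha by rewrite /beta mulrC divfK// ge_min lexx.
exists beta => //; near=> n.
have n0 : (0 < n)%N by near: n; apply: near_even_oo; exists 1%N.
have l1 : 1 <= ln n%:R :> R by near: n; exact: ln_large.
have lK : ln (1 + K) / beta <= ln n%:R by near: n; exact: ln_large.
set l := ln n%:R in l1 lK *; have l0 := lt_le_trans ltr01 l1.
rewrite powR_ln// -/l div1r -expRN.
have h1 : expR (- l) <= expR (- (2 * beta * l)).
  by rewrite ler_expR lerN2 ler_piMl// ltW.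
have h2 : K * expR (- (alpha * l)) <= K * expR (- (2 * beta * l)).
  by rewrite ler_pM2l// ler_expR lerN2 ler_pM2r.
apply: (le_trans (lerD h1 h2)).
rewrite -[X in X + _]mul1r -mulrDl.
have -> : - (2 * beta * l) = - (beta * l) - (beta * l) by ring.
rewrite expRD mulrA ler_piMl ?expR_ge0// expRN ler_pdivrMr ?expR_gt0// mul1r.
rewrite -ler_ln ?posrE ?expR_gt0 ?addr_gt0// expRK.
by rewrite mulrC -ler_pdivrMr.
Unshelve. all: by end_near. Qed.

Theorem theorem8 (R : realType)
    (* deterministic rules *)
    (lp : forall n : nat, R -> 'M[bool]_n -> 'rV[R]_n * 'M[R]_n)
    (lev : forall n : nat, 'M[R]_n -> 'cV[R]_n)
    (* parameters *)
    (B0 : 'M[R]_2) (a D eps delta eps1 delta1 : nat -> R)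
    (theta : forall n : nat, 'I_n -> 'I_2)
    (* random graph and noise *)
    (disp : nat -> measure_display)
    (T : forall n : nat, measurableType (disp n))
    (P : forall n : nat, probability (T n) R)
    (G : forall n : nat, T n -> 'M[bool]_n)
    (Z : forall n : nat, {RV (P n) >-> R})
    (g : forall n : nat, 'I_n -> 'I_n -> {RV (P n) >-> R}) :
  let B := fun n : nat => a n *: B0 in
  let d := fun n : nat => n%:R * max_entry (B n) in
  let algo := fun (n : nat) (H : 'M[bool]_n) (w : T n) =>
    theta_hat (lev n) (lp n) (B n) (D n) (eps n) (delta n) (eps1 n) (delta1 n)
      H (Z n w) (\matrix_(i, j) g n i j w) in
  (forall n : nat, lp_rule (lp n)) ->
  (forall n : nat, eigenvector_rule (lev n)) ->
  (\forall n \near even_oo, balanced (theta n)) ->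
  (\forall n \near even_oo, sbm_matrix (B n)) ->
  (\forall n \near even_oo, is_SBM (P n) (B n) (theta n) (G n)) ->
  (\forall n \near even_oo,
     independent_noise (G n) (8 / eps1 n) (Z n) (g n)) ->
  (\forall n \near even_oo,
     50 * ln n%:R / (n%:R * \big[Num.min/B0 0 0]_(j < 2) B0 j j) <= a n) ->
  (a n @[n --> even_oo] --> (0 : R)) ->
  B0 0 0 = B0 1 1 -> B0 0 1 = B0 1 0 -> B0 0 1 < B0 0 0 ->
  (\forall n \near even_oo, 3 * d n <= D n <= n%:R) ->
  asymp eps1 (fun _ : nat => 1) ->
  (exists2 p : nat -> R, is_poly p & asymp delta1 (fun n : nat => 1 / p n)) ->
  (exists h p p' : nat -> R,
     [/\ asymp h eps, is_poly p, is_poly p'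
       & \forall n \near even_oo,
           expR (- h n) / p n < delta n < expR (- 2 * eps n) / p' n]) ->
  (\forall n \near even_oo, ln n%:R ^+ 3 < d n) ->
  (\forall n \near even_oo, D n ^+ 2 * ln n%:R < eps n) ->
  [/\ exists2 p : nat -> R, is_poly p &
        \forall n \near even_oo, node_DP (P n) (3 * eps n) (1 / p n) (algo n),
      exists2 c : R, 0 < c & exists2 p : nat -> R, is_poly p &
        \forall n \near even_oo,
          ((1 - 1 / p n)%:E <=
           P n [set w | (loss (algo n (G n w) w) (theta n) <=
                  c * (1 / Num.sqrt (d n) + D n ^+ 2 / eps n))%R])%E
    & precsim (fun n : nat => 1 / Num.sqrt (d n) + D n ^+ 2 / eps n)
        (fun n : nat => 1 / ln n%:R)].
Proof.
move=> B d algo lp_ok lev_ok _ sbmB sbm noise a_ge _ B11 B10 gap Dd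
  [[c1 c10 eps1_le] [c2 c20 eps1_ge]] [p1 p1_poly delta1_p1]
  [h [p [p' [h_eps p_poly p'_poly deltaP]]]] dl De.
have regime : \forall n \near even_oo, [/\ (2 <= n)%N, 2 <= ln n%:R :> R,
    B n 0 1 < B n 0 0, 0 < B n 0 1 & d n = n%:R * B n 0 0].
  near=> n.
  have n2 : (2 <= n)%N by near: n; apply: near_even_oo; exists 2%N.
  have l2 : 2 <= ln n%:R :> R by near: n; exact: ln_large.
  have lK : 50 * (B0 0 1 / B0 0 0) <= ln n%:R by near: n; exact: ln_large.
  have a_n : 50 * ln n%:R / (n%:R * B0 0 0) <= a n.
    by rewrite -{1}(min_diag_planted B11); near: n.
  have sbmBn : sbm_matrix (B n) by near: n.
  have dln : ln n%:R ^+ 3 < d n by near: n.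
  have l1 : 1 <= ln n%:R :> R by apply: le_trans l2; rewrite ler1n.
  have [an0 B01 maxE] := planted_regime n2 B11 B10 gap sbmBn a_n dln l1 lK.
  by split; rewrite // /d /B ?maxE ?mxE ?ltr_pM2l// mulr_gt0.
have scale : \forall n \near even_oo, [/\ 3 * d n <= D n,
    ln n%:R ^+ 3 <= d n, D n ^+ 2 * ln n%:R <= eps n & ln n%:R <= eps n].
  near=> n.
  have [n2 l2 _ _ _] : [/\ (2 <= n)%N, 2 <= ln n%:R :> R,
    B n 0 1 < B n 0 0, 0 < B n 0 1 & d n = n%:R * B n 0 0] by near: n.
  have /andP[dD _] : 3 * d n <= D n <= n%:R by near: n.
  have dln : ln n%:R ^+ 3 < d n by near: n.
  have Den : D n ^+ 2 * ln n%:R < eps n by near: n.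
  split; [by []|exact: ltW|exact: ltW|]; apply: le_trans (ltW Den).
  have l1 : 1 <= ln n%:R :> R by apply: le_trans l2; rewrite ler1n.
  have : 1 <= ln n%:R ^+ 3 :> R by rewrite exprn_ege1.
  move=> h1; rewrite ler_peMl ?(le_trans ler01)// exprn_ege1//.
  by move: dD dln h1; lra.
have [C delta_eps] : exists C, \forall n \near even_oo, [/\ 0 < delta n,
    delta n <= expR (- 2 * eps n) & 0 <= - ln (delta n) <= C * eps n].
  apply: (sandwiched_delta h_eps p_poly p'_poly deltaP).
  by apply: filterS scale => n [].
have [alpha [K [alpha0 K1 delta1_bounds]]] := poly_inverse_bounds p1_poly delta1_p1.
have K0 := lt_le_trans ltr01 K1.
have [beta beta0 failure] := failure_le_poly alpha0 K1.
split.
- exists (fun n => n%:R `^ beta); first exact: is_poly_powR.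
  near=> n.
  have [n2 l2 gapn B01 dE] : [/\ (2 <= n)%N, 2 <= ln n%:R :> R,
    B n 0 1 < B n 0 0, 0 < B n 0 1 & d n = n%:R * B n 0 0] by near: n.
  have [dD dln Den leps] : [/\ 3 * d n <= D n, ln n%:R ^+ 3 <= d n,
    D n ^+ 2 * ln n%:R <= eps n & ln n%:R <= eps n] by near: n.
  have [delta0 delta_le _] : [/\ 0 < delta n, delta n <= expR (- 2 * eps n) &
    0 <= - ln (delta n) <= C * eps n] by near: n.
  have /andP[d1_ge d1_le] : K^-1 * expR (- (alpha * ln n%:R)) <= delta1 n <=
    K * expR (- (alpha * ln n%:R)) by near: n.
  have fail : expR (- ln n%:R) + K * expR (- (alpha * ln n%:R)) <=
    1 / n%:R `^ beta :> R by near: n.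
  have e1 : eps1 n <= c1 * 1 by near: n.
  have e2 : 1 <= c2 * eps1 n by near: n.
  have lc : c1 <= ln n%:R by near: n; exact: ln_large.
  have noisen : independent_noise (G n) (8 / eps1 n) (Z n) (@g n) by near: n.
  have eps10 : 0 < eps1 n by have := lt_le_trans ltr01 e2; rewrite pmulr_rgt0.
  have l1 : 1 <= ln n%:R :> R by apply: le_trans l2; rewrite ler1n.
  have D1 : 3 <= D n.
    have : 1 <= ln n%:R ^+ 3 :> R by rewrite exprn_ege1.
    by move: dD dln; lra.
  have epsD : 2 * ln n%:R <= eps n.
    apply: le_trans Den; rewrite ler_pM2r ?(lt_le_trans ltr01)//.
    by rewrite expr2; apply: le_trans (ler_pM _ _ D1 D1) => //; lra.
  have eps0 : 0 < eps n by move: epsD l1; lra.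
  have delta10 : 0 < delta1 n.
    by apply: lt_le_trans d1_ge; rewrite mulr_gt0 ?invr_gt0 ?expR_gt0.
  have tot : expR (- (eps n / 2)) + delta1 n <= 1 / n%:R `^ beta.
    apply: le_trans fail; rewrite lerD// ler_expR lerN2; move: epsD; lra.
  have delta11 : delta1 n <= 1.
    apply: le_trans (le_trans tot _); first by rewrite lerDr expR_ge0.
    rewrite powR_ln ?(leq_trans _ n2)// ler_pdivrMr ?expR_gt0// mul1r.
    rewrite -[leLHS]expR0 ler_expR.
    by apply: mulr_ge0; [exact: ltW|exact: le_trans l1].
  have DP := @theta_hat_node_DP R n (lp n) (lev n) (B n) (D n) (eps n) (delta n)
    (eps1 n) (delta1 n) _ n2 gapn _ eps0 delta0 eps10 _ (lp_ok n) delta_le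
    (disp n) (T n) (P n) (G n) (Z n) (@g n) noisen.
  apply: node_DP_mono tot (DP _ _ _).
  + by move: lc e1 leps epsD l1; lra.
  + by case: (lev_ok n).
  + by move: D1; lra.
  + by rewrite delta10.
- pose k := (B0 0 0 - B0 0 1) / B0 0 0.
  pose La := 5 + 8 * c2 + 8 * c2 * (ln K + alpha).
  pose Cr := 2 * (258 * 14 / k + 96 * 16 * 24 ^+ 2 * La ^+ 2 * (La + C) / k).
  (* [k], hence [Cr], is known to be positive only through a large [n]. *)
  exists (Num.max 1 (12 * Cr)); first by rewrite lt_max ltr01.
  exists (fun n => n%:R `^ 2^-1); first by apply: is_poly_powR; rewrite invr_gt0.
  near=> n.
  have [n2 l2 gapn B01 dE] : [/\ (2 <= n)%N, 2 <= ln n%:R :> R,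
    B n 0 1 < B n 0 0, 0 < B n 0 1 & d n = n%:R * B n 0 0] by near: n.
  have [dD dln Den leps] : [/\ 3 * d n <= D n, ln n%:R ^+ 3 <= d n,
    D n ^+ 2 * ln n%:R <= eps n & ln n%:R <= eps n] by near: n.
  have [delta0 delta_le ln_delta] : [/\ 0 < delta n, delta n <= expR (- 2 * eps n) &
    0 <= - ln (delta n) <= C * eps n] by near: n.
  have /andP[d1_ge _] : K^-1 * expR (- (alpha * ln n%:R)) <= delta1 n <=
    K * expR (- (alpha * ln n%:R)) by near: n.
  have e2 : 1 <= c2 * eps1 n by near: n.
  have lCr : 128 * Cr <= ln n%:R by near: n; exact: ln_large.
  (* [4 <= sqrt n], so that [4 / n <= 1 / sqrt n]. *)
  have l4 : 2 * ln 4 <= ln n%:R :> R by near: n; exact: ln_large.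
  have noisen : independent_noise (G n) (8 / eps1 n) (Z n) (@g n) by near: n.
  have sbmn : is_SBM (P n) (B n) (@theta n) (G n) by near: n.
  have delta10 : 0 < delta1 n.
    by apply: lt_le_trans d1_ge; rewrite mulr_gt0 ?invr_gt0 ?expR_gt0.
  have b0 : 0 < B n 0 0 := lt_trans B01 gapn.
  have b00 : B0 0 0 != 0 by apply: contraTneq b0 => b0; rewrite !mxE b0 mulr0 ltxx.
  have kE : n%:R * (B n 0 0 - B n 0 1) = k * (n%:R * B n 0 0).
    by rewrite /k !mxE; field.
  have n0 : 0 < n%:R :> R by rewrite ltr0n (leq_trans _ n2).
  have k0 : 0 < k.
    have : 0 < k * (n%:R * B n 0 0) by rewrite -kE mulr_gt0// subr_gt0.
    by rewrite pmulr_lgt0// mulr_gt0.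
  have Bn11 : B n 0 0 = B n 1 1 by rewrite !mxE B11.
  have Bn10 : B n 0 1 = B n 1 0 by rewrite !mxE B10.
  rewrite dE in dD dln *.
  have util := @theta_hat_loss_rate R n (lp n) (lev n) (B n) (@theta n) (D n) (eps n) (delta n)
    (eps1 n) (delta1 n) k c2 K alpha C
    (Num.max 1 (12 * Cr)) (disp n) (T n) (P n) (G n) (Z n) (@g n)
    (lp_ok n) (lev_ok n) n2 Bn11 Bn10 gapn B01 l2 lCr dln dD Den k0 kE delta0
    ln_delta c20 e2 K1 alpha0 delta10 d1_ge noisen sbmn _.
  apply: le_trans (util _); last by rewrite le_max lexx orbT.
  rewrite lee_fin lerD2l lerN2 powR_ln ?(leq_trans _ n2)//.
  rewrite ler_pdivlMr ?expR_gt0// mulrAC ler_pdivrMr// mul1r.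
  rewrite -[X in X * _]lnK ?posrE// -expRD -{2}(@lnK R n%:R)// ler_expR.
  by move: l4; lra.
- exists 2 => //; near=> n.
  have [n2 l2 _ _ dE] : [/\ (2 <= n)%N, 2 <= ln n%:R :> R,
    B n 0 1 < B n 0 0, 0 < B n 0 1 & d n = n%:R * B n 0 0] by near: n.
  have [dD dln Den leps] : [/\ 3 * d n <= D n, ln n%:R ^+ 3 <= d n,
    D n ^+ 2 * ln n%:R <= eps n & ln n%:R <= eps n] by near: n.
  have l1 : 1 <= ln n%:R :> R by apply: le_trans l2; rewrite ler1n.
  rewrite mulrA mulr1; apply: rate_bound => //.
  exact: lt_le_trans (lt_le_trans ltr01 l1) leps.
Unshelve. all: by end_near. Qed.
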